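(* Let $q=2$. Let $u_\varepsilon=u_\varepsilon(r_\varepsilon)$ be the value of the extreme problem $$u_\varepsilon^2=\frac{1}{2\varepsilon^4}\inf_{\eta\in\Theta_2(r_\varepsilon)}\sum_{k\in\mathbb N}\eta_k^4,$$ let $\{\tilde\eta_k\}_{k\in\mathbb N}$ be an extreme sequence of this problem, put $$w_k=\frac{\tilde\eta_k^2}{\sqrt{2\sum_{j\in\mathbb N}\tilde\eta_j^4}},\quad k\in\mathbb N,\qquad w_0=\sup_{k\in\mathbb N}w_k,$$ and consider the tests $\psi_{\varepsilon,H}=\mathbf 1_{\{t_\varepsilon>H\}}$ based on $t_\varepsilon=\sum_{k\in\mathbb N}w_k\big((y_k/\varepsilon)^2-1\big)$. All limits are as $\varepsilon\to0$. (1)(a) If $u_\varepsilon\to0$, then $\beta_\varepsilon(r_\varepsilon,\vartheta)\to1-\vartheta$ for any $\vartheta\in(0,1)$ and $\gamma_\varepsilon(r_\varepsilon)\to1$. If $u_\varepsilon=O(1)$, then $\liminf\beta_\varepsilon(r_\varepsilon,\vartheta)>0$ for any $\vartheta\in(0,1)$ and $\liminf\gamma_\varepsilon(r_\varepsilon)>0$. (1)(b) If $u_\varepsilon\asymp1$ and $w_0=o(1)$, then the families $\psi_{\varepsilon,H}$ with $H=H^{(\vartheta)}$ (for $\vartheta\in(0,1)$) and with $H=u_\varepsilon/2$ are asymptotically minimax, that is, $$\alpha_\varepsilon(\psi_{\varepsilon,H^{(\vartheta)}})\le\vartheta+o(1),\qquad \beta_\varepsilon(\Theta_2(r_\varepsilon),\psi_{\varepsilon,H^{(\vartheta)}})=\beta_\varepsilon(r_\varepsilon,\vartheta)+o(1),$$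 $$\gamma_\varepsilon(\Theta_2(r_\varepsilon),\psi_{\varepsilon,u_\varepsilon/2})=\gamma_\varepsilon(r_\varepsilon)+o(1),$$ and the sharp asymptotics $$\beta_\varepsilon(r_\varepsilon,\vartheta)=\Phi(H^{(\vartheta)}-u_\varepsilon)+o(1),\qquad \gamma_\varepsilon(r_\varepsilon)=2\Phi(-u_\varepsilon/2)+o(1)$$ hold true. (2) If $u_\varepsilon\to\infty$, then for any $c\in(0,1)$ the family $\psi_{\varepsilon,H}$ with $H=H_\varepsilon\sim c\,u_\varepsilon$ is asymptotically minimax consistent, that is, $\gamma_\varepsilon(\Theta_2(r_\varepsilon),\psi_{\varepsilon,H_\varepsilon})\to0$.
   Context: Model: one observes $y=\{y_k\}_{k\in\mathbb N}$, $y_k=\eta_k+\varepsilon\xi_k$, with $\xi_k$ i.i.d. $N(0,1)$, $\varepsilon>0$ small and $\eta\in\ell^2$ unknown. $P_{\varepsilon,\eta}$, $E_{\varepsilon,\eta}$ denote the corresponding probability and expectation. Sets: $a=\{a_k\}$, $\sigma=\{\sigma_k\}$ are given sequences with $a_k>0$, $a_k\to\infty$, $\sigma_k>0$, $\sigma_k\to\infty$ as $k\to\infty$. For $q=2$, $$\Theta_2=\Big\{\eta\in\ell^2:\sum_k|a_k\sigma_k\eta_k|^2\le1\Big\},\qquad \Theta_2(r)=\Big\{\eta\in\Theta_2:\sum_k\sigma_k^2\eta_k^2\ge r^2\Big\}.$$ $r_\varepsilon>0$ is a given family with $r_\varepsilon\to0$ as $\varepsilon\to0$. One tests $H_0:\eta=0$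 against $H_1:\eta\in\Theta_2(r_\varepsilon)$. It is assumed that $\Theta_2(r_\varepsilon)\neq\varnothing$, $u_\varepsilon>0$ and that an extreme sequence exists (this sequence, and hence the $w_k$ and $w_0$, depend on $\varepsilon$). Tests and errors: a (randomized) test $\psi$ is a measurable function of $y$ with values in $[0,1]$ ($H_0$ is rejected with probability $\psi(y)$). $\alpha_\varepsilon(\psi)=E_{\varepsilon,0}\psi$; for a set $\Theta$, $\beta_\varepsilon(\Theta,\psi)=\sup_{\eta\in\Theta}E_{\varepsilon,\eta}(1-\psi)$, $\gamma_\varepsilon(\Theta,\psi)=\alpha_\varepsilon(\psi)+\beta_\varepsilon(\Theta,\psi)$. For $\vartheta\in(0,1)$: $\beta_\varepsilon(\Theta,\vartheta)=\inf_{\psi:\alpha_\varepsilon(\psi)\le\vartheta}\beta_\varepsilon(\Theta,\psi)$, and $\gamma_\varepsilon(\Theta)=\inf_\psi\gamma_\varepsilon(\Theta,\psi)$. Write $\beta_\varepsilon(r_\varepsilon,\vartheta)=\beta_\varepsilon(\Theta_2(r_\varepsilon),\vartheta)$, $\gamma_\varepsilon(r_\varepsilon)=\gamma_\varepsilon(\Theta_2(r_\varepsilon))$. $\Phi$ is the standard normal distribution function and $\Phi(H^{(\vartheta)})=1-\vartheta$. $A_\varepsilon\asymp B_\varepsilon$ means the ratio is bounded above and away from $0$ for small $\varepsilon$; $A_\varepsilon\sim B_\varepsilon$ means the ratio tends to $1$. *)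

(* Defs.v *)
From HB Require Import structures.
From mathcomp Require Import all_boot all_order all_algebra finmap.
From mathcomp Require Import all_classical all_reals all_analysis.
Import Order.TTheory GRing.Theory Num.Theory numFieldNormedType.Exports.

Set Implicit Arguments.
Unset Strict Implicit.
Unset Printing Implicit Defensive.

Local Open Scope classical_set_scope.
Local Open Scope ring_scope.

(* Sums of nonnegative terms are taken in [\bar R], so that conditions such as
   [sqsum x <= 1] include the convergence of the series. *)
Definition sqsum (R : realType) (x : nat -> R) : \bar R :=
  (\sum_(0 <= k <oo) (x k ^+ 2)%:E)%E.

Definition quartsum (R : realType) (x : nat -> R) : \bar R :=
  (\sum_(0 <= k <oo) (x k ^+ 4)%:E)%E.

Definition ell2 (R : realType) : set (nat -> R) :=
  [set eta | (sqsum eta < +oo)%E].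

Definition Theta2 (R : realType) (a s : nat -> R) : set (nat -> R) :=
  [set eta | ell2 eta /\ (sqsum (fun k => a k * s k * eta k)%R <= 1)%E].

Definition Theta2r (R : realType) (a s : nat -> R) (r : R) : set (nat -> R) :=
  [set eta | Theta2 a s eta /\
             ((r ^+ 2)%:E <= sqsum (fun k => s k * eta k)%R)%E].

(* The product sigma-algebra on R^N, generated by the coordinates. *)
Definition coordinate_sets (R : realType) : set (set (nat -> R)) :=
  \bigcup_(k in [set: nat])
    preimage_set_system setT (fun y : nat -> R => y k) measurable.

Definition observations (R : realType) :=
  g_sigma_algebraType (@coordinate_sets R).

Definition mutually_independent (d : measure_display) (T : measurableType d)
    (R : realType) (P : probability T R) (xi : nat -> {RV P >-> R}) : Prop :=
  forall (J : {fset nat}) (B : nat -> set R), (forall k, measurable (B k)) ->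
    (P (\bigcap_(k in [set` J]) (xi k @^-1` B k)) =
       \prod_(k <- J) P (xi k @^-1` B k))%E.

Definition iid_standard_normal (d : measure_display) (T : measurableType d)
    (R : realType) (P : probability T R) (xi : nat -> {RV P >-> R}) : Prop :=
  mutually_independent xi /\
  forall (k : nat) (B : set R), measurable B ->
    distribution P (xi k) B = normal_prob 0 1 B.

(* The observation y_k = eta_k + eps xi_k. *)
Definition observe (d : measure_display) (T : measurableType d)
    (R : realType) (P : probability T R) (xi : nat -> {RV P >-> R})
    (eps : R) (eta : nat -> R) (w : T) : nat -> R :=
  fun k => eta k + eps * xi k w.

(* E_{eps,eta} f(y) *)
Definition Eobs (d : measure_display) (T : measurableType d)
    (R : realType) (P : probability T R) (xi : nat -> {RV P >-> R})
    (eps : R) (eta : nat -> R) (f : (nat -> R) -> R) : R :=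
  fine ('E_P[fun w => f (observe xi eps eta w)])%E.

Definition is_test (R : realType) (psi : (nat -> R) -> R) : Prop :=
  measurable_fun [set: observations R] (psi : observations R -> R) /\
  forall y, 0 <= psi y <= 1.

Definition alpha (d : measure_display) (T : measurableType d)
    (R : realType) (P : probability T R) (xi : nat -> {RV P >-> R})
    (eps : R) (psi : (nat -> R) -> R) : R :=
  Eobs xi eps (fun=> 0) psi.

Definition beta (d : measure_display) (T : measurableType d)
    (R : realType) (P : probability T R) (xi : nat -> {RV P >-> R})
    (eps : R) (Theta : set (nat -> R)) (psi : (nat -> R) -> R) : R :=
  sup [set Eobs xi eps eta (fun y => 1 - psi y) | eta in Theta].

Definition gamma (d : measure_display) (T : measurableType d)
    (R : realType) (P : probability T R) (xi : nat -> {RV P >-> R})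
    (eps : R) (Theta : set (nat -> R)) (psi : (nat -> R) -> R) : R :=
  alpha xi eps psi + beta xi eps Theta psi.

Definition minimax_beta (d : measure_display) (T : measurableType d)
    (R : realType) (P : probability T R) (xi : nat -> {RV P >-> R})
    (eps : R) (Theta : set (nat -> R)) (theta : R) : R :=
  inf [set beta xi eps Theta psi |
         psi in [set psi | is_test psi /\ alpha xi eps psi <= theta]].

Definition minimax_gamma (d : measure_display) (T : measurableType d)
    (R : realType) (P : probability T R) (xi : nat -> {RV P >-> R})
    (eps : R) (Theta : set (nat -> R)) : R :=
  inf [set gamma xi eps Theta psi | psi in [set psi | is_test psi]].

Definition extreme_inf (R : realType) (a s : nat -> R) (r : R) : \bar R :=
  ereal_inf [set quartsum eta | eta in Theta2r a s r].

Definition extreme_value (R : realType) (a s : nat -> R) (r eps : R) : R :=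
  Num.sqrt ((2 * eps ^+ 4)^-1 * fine (extreme_inf a s r)).

Definition extreme_sequence (R : realType) (a s : nat -> R) (r : R)
    (eta : nat -> R) : Prop :=
  Theta2r a s r eta /\ quartsum eta = extreme_inf a s r.

Definition weight (R : realType) (eta : nat -> R) (k : nat) : R :=
  eta k ^+ 2 / Num.sqrt (2 * fine (quartsum eta)).

Definition weight0 (R : realType) (eta : nat -> R) : R :=
  sup (range (weight eta)).

(* The series converges almost surely under each P_{eps,eta}; where it
   diverges, [limn] returns a default value. *)
Definition tstat (R : realType) (eta : nat -> R) (eps : R) (y : nat -> R) : R :=
  limn (series (fun k => weight eta k * ((y k / eps) ^+ 2 - 1))).

Definition psi_test (R : realType) (eta : nat -> R) (eps H : R) :
    (nat -> R) -> R :=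
  \1_[set y | H < tstat eta eps y].

Definition Phi (R : realType) (x : R) : R :=
  fine (normal_prob 0 1 `]-oo, x]).

(* Main.v *)
Require Import Defs.
From HB Require Import structures.
From mathcomp Require Import all_boot all_order all_algebra finmap.
From mathcomp Require Import all_classical all_reals all_analysis.
From mathcomp Require Import measurable_realfun.
From mathcomp Require Import ring lra.
Import Order.TTheory GRing.Theory Num.Theory numFieldNormedType.Exports.

Set Implicit Arguments.
Unset Strict Implicit.
Unset Printing Implicit Defensive.

Local Open Scope classical_set_scope.
Local Open Scope ring_scope.

(* In the variables [eta k ^+ 2] the extreme problem minimises a convex
   functional over a convex set. Its first-order condition says that
   [\sum_k w_k (eta_k / eps)^2 >= u] for every alternative [eta], and a mass
   transfer argument shows that the extreme sequence has finite support, so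
   that [w_k = (teta_k / eps)^2 / (2 u)] and [t_eps] is a finite sum.

   Upper bounds: under [eta] the statistic is [t0 + L + D], with
   [t0 = \sum_k w_k (xi_k^2 - 1)] of variance 1, [D >= u], and [L] centred of
   variance at most [4 w_0 D]. Stein's method puts [t0] within [4 w_0] of
   N(0,1); Chebyshev's inequality is enough when [u] tends to infinity.

   Lower bounds: the prior with independent random signs on [teta] has
   likelihood ratio [\prod_k exp(- th_k^2 / 2) cosh(th_k xi_k)], where
   [th_k = teta_k / eps]. It is at least [exp(u t0 - u^2 / 2 - D4)] with
   [E|D4| <= 3 u^2 w_0], since [cosh z >= exp(z^2 / 2 - z^4 / 12)]. For small
   [w_0] this is nearly the likelihood ratio of N(u,1) against N(0,1), and the
   Neyman-Pearson bound applies; for bounded [u] it is bounded below with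
   positive probability. *)

(** * The standard normal distribution *)

(** The weights change with [eps], so a limit theorem for one fixed sequence would not do: each
    estimate is proved at a single noise level with an explicit error, and limits are taken only at
    the very end, by squeezing. Stein's equation suits this purpose because its error depends on the
    test function only through its supremum. Distribution functions and truncated likelihood ratios
    are then handled by the same bound; the likelihood ratio itself is unbounded, which is why it
    always appears under a minimum with the critical value.

    For the lower bounds no prior measure is constructed. The average over signs is replaced by one
    sign pattern that does at least as well as the average, and this pattern is again an alternative
    because [Theta2r] depends on [eta] only through its squares. A bound of the likelihood ratio
    from below is enough, since the risk of a test increases with it.

    Independence enters through one identity only: integrals do not change when one coordinate of
    the noise is replaced by a fresh normal variable. *)

Section gauss.
Context {R : realType}.
Implicit Types (x y u c t : R).
Local Notation mu := (@lebesgue_measure R).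
Local Notation N := (@normal_prob R 0 1).
Local Notation phi := (@normal_pdf R 0 1).

(** The change of variables is expressed with a Radon-Nikodym derivative; it agrees almost
    everywhere with the density because both have the same integral over every measurable set. *)
Lemma ge0_integral_normal m s (f : _ -> \bar R) : measurable_fun [set: R] f ->
  (forall x, 0 <= f x)%E ->
  (\int[@normal_prob R m s]_x f x = \int[mu]_x (f x * (normal_pdf m s x)%:E))%E.
Proof.
move=> mf f0; have dom := normal_prob_dominates m s.
rewrite -(Radon_Nikodym_SigmaFinite.change_of_variables dom f0 measurableT mf).
have mRN : measurable_fun setT
    (Radon_Nikodym_SigmaFinite.f (normal_prob m s) (@lebesgue_measure R)).
  exact: measurable_int (Radon_Nikodym_SigmaFinite.f_integrable dom).
have mpdf : measurable_fun setT (fun x => (normal_pdf m s x)%:E).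
  by apply/measurable_EFinP; exact: measurable_normal_pdf.
apply: ae_eq_integral => //.
- exact: emeasurable_funM.
- exact: emeasurable_funM.
have : ae_eq mu setT (Radon_Nikodym_SigmaFinite.f (normal_prob m s) mu)
    (fun x => (normal_pdf m s x)%:E).
  apply: integral_ae_eq => //.
    exact: Radon_Nikodym_SigmaFinite.f_integrable.
  by move=> E _ mE; rewrite -Radon_Nikodym_SigmaFinite.f_integral.
by apply: filterS => x + Dx => /(_ Dx) /= ->.
Qed.

Let addt t : measurableTypeR R -> measurableTypeR R := fun x => x + t.
Let maddt t : measurable_fun setT (addt t).
Proof. exact: measurable_funD. Qed.

Lemma lebesgue_measureD t (A : set R) : measurable A ->
  pushforward mu (addt t) A = mu A.
Proof.
move=> mA; apply/esym/lebesgue_measure_unique.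
- move=> _ [[a b]] _ <-.
  rewrite /= /pushforward.
  have -> : addt t @^-1` `]a, b] = `]a - t, b - t]%classic.
    by apply/seteqP; split=> x /=; rewrite !in_itv/= /addt ltrBlDr lerBrDr.
  rewrite !lebesgue_measure_itv/=.
  rewrite !lte_fin ltrD2r; case: ifP => // _; rewrite -!EFinB; congr EFin; ring.
- exact: mA.
Qed.

Lemma ge0_integral_lebesgueD t (f : _ -> \bar R) : measurable_fun [set: R] f ->
  (forall x, 0 <= f x)%E -> (\int[mu]_x f (x + t)%R = \int[mu]_x f x)%E.
Proof.
move=> mf f0; have := @ge0_integral_pushforward _ _ _ _ R _ (maddt t) mu setT f.
rewrite preimage_setT => <- //.
by apply: eq_measure_integral => A mA _; exact: lebesgue_measureD.
Qed.

Lemma phiE x : phi x = normal_peak 1 * expR (- (x ^+ 2 / 2)).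
Proof.
by rewrite normal_pdfE ?oner_neq0// /normal_fun subr0 expr1n mulNr.
Qed.

Lemma phi_gt0 x : 0 < phi x.
Proof. by rewrite phiE mulr_gt0 ?expR_gt0// normal_peak_gt0// oner_neq0. Qed.

Lemma phi_shift x t : phi (x - t) = phi x * expR (t * x - t ^+ 2 / 2).
Proof.
rewrite !phiE -[RHS]mulrA -expRD; congr (_ * expR _); lra.
Qed.

Lemma phiN x : phi (- x) = phi x.
Proof. by rewrite !phiE sqrrN. Qed.

Lemma peak_le1 : @normal_peak R 1 <= 1.
Proof.
have p2 := pi_ge2 R.
rewrite /normal_peak invf_le1 ?sqrtr_gt0; last by lra.
by rewrite -[leLHS]sqrtr1 ler_sqrt; lra.
Qed.

Lemma phi_le1 x : phi x <= 1.
Proof. exact: (le_trans (normal_pdf_ub _ _ (oner_neq0 _)) peak_le1). Qed.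

Lemma mphi : measurable_fun setT phi.
Proof. exact: measurable_normal_pdf. Qed.

(** Translation invariance of Lebesgue measure moves the shift onto the density, and [phi_shift]
    turns it into the likelihood ratio of N(t,1) against N(0,1). *)
Lemma ge0_integral_normal_shift t (g : _ -> \bar R) : measurable_fun [set: R] g ->
  (forall x, 0 <= g x)%E ->
  (\int[N]_x g (x + t)%R = \int[N]_x (g x * (expR (t * x - t ^+ 2 / 2))%:E))%E.
Proof.
move=> mg g0.
rewrite ge0_integral_normal//; last first.
  by apply: measurableT_comp => //; exact: maddt.
have me : measurable_fun [set: R] (fun x => (expR (t * x - t ^+ 2 / 2))%:E).
  apply/measurable_EFinP; apply: measurableT_comp => //.
  by apply: measurable_funB => //; apply: measurable_funM.
rewrite ge0_integral_normal//; last 2 first.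
- exact: emeasurable_funM.
- by move=> x; rewrite mule_ge0// lee_fin expR_ge0.
have -> : (\int[mu]_x (g (x + t)%R * (phi x)%:E) =
    \int[mu]_x (fun x => g x * (phi (x - t))%:E) (x + t)%R)%E.
  by apply: eq_integral => x _ /=; rewrite addrK.
rewrite (ge0_integral_lebesgueD t (f := fun x => g x * (phi (x - t))%:E)%E).
- apply: eq_integral => x _; rewrite phi_shift -muleA; congr (_ * _)%E.
  by rewrite -EFinM mulrC.
- apply: emeasurable_funM => //; apply/measurable_EFinP.
  by apply: measurableT_comp; [exact: mphi|exact: measurable_funB].
- by move=> x; rewrite mule_ge0// lee_fin ltW// phi_gt0.
Qed.

(** From [1 + z <= exp z] at a small multiple of [y], raised to the power [m]. The rate 1/8 is meant
    for [y = x ^+ 2]: the exponent [- x ^+ 2 / 2 + x ^+ 2 / 8] stays below [- x ^+ 2 / 4], the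
    exponent of N(0,2). *)
Lemma poly_le_exp m : exists2 C : R, 0 < C &
  forall y, 0 <= y -> (1 + y) ^+ m <= C * expR (y / 8).
Proof.
case: m => [|m].
  exists 1 => // y y0; rewrite expr0 mul1r -[leLHS]expR0 ler_expR; lra.
have k0 : 0 < 8 * m.+1%:R :> R by rewrite mulr_gt0// ltr0n.
exists ((8 * m.+1%:R) ^+ m.+1) => [|y y0]; first exact: exprn_gt0.
have -> : y / 8 = m.+1%:R * (y / (8 * m.+1%:R)).
  by field; rewrite lt0r_neq0// ltr0n.
have H : 1 + y <= 8 * m.+1%:R * expR (y / (8 * m.+1%:R)).
  have := expR_ge1Dx (y / (8 * m.+1%:R)); rewrite -(ler_pM2l k0).
  apply: le_trans; rewrite mulrDr mulr1 (mulrC _ (y / _)) divfK ?gt_eqF// lerD2r.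
  have : 1 <= m.+1%:R :> R by rewrite ler1n.
  lra.
rewrite expRM_natl -exprMn; apply: lerXn2r => //; rewrite nnegrE; first lra.
by apply: le_trans H; lra.
Qed.

(** Domination by another normal density reduces the integrability of all polynomial moments to that
    of a density. *)
Lemma poly_pdf_le m : exists2 C : R, 0 < C & forall x,
  (1 + x ^+ 2) ^+ m * phi x <= C * normal_pdf 0 (Num.sqrt 2) x.
Proof.
have [C C0 HC] := poly_le_exp m.
have s2 : Num.sqrt 2 != 0 :> R by rewrite gt_eqF// sqrtr_gt0.
have p2 : 0 < normal_peak (Num.sqrt 2) :> R by exact: normal_peak_gt0.
exists (C / normal_peak (Num.sqrt 2)) => [|x]; first by rewrite divr_gt0.
rewrite [in leRHS]normal_pdfE// /normal_fun subr0 mulrA divfK ?gt_eqF//.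
rewrite phiE mulrCA mulrC.
have -> : Num.sqrt 2 ^+ 2 *+ 2 = 4 :> R by rewrite sqr_sqrtr//; lra.
apply: (@le_trans _ _ ((1 + x ^+ 2) ^+ m * expR (- (x ^+ 2 / 2)))).
  by rewrite ler_piMr ?peak_le1// mulr_ge0 ?expR_ge0// exprn_ge0// addr_ge0// sqr_ge0.
apply: (@le_trans _ _ (C * expR (x ^+ 2 / 8) * expR (- (x ^+ 2 / 2)))).
  by rewrite ler_wpM2r ?expR_ge0// HC// sqr_ge0.
rewrite -mulrA -expRD ler_pM2l// ler_expR.
have := sqr_ge0 x; lra.
Qed.

Lemma integral_normal (f : R -> R) : measurable_fun setT f ->
  (\int[N]_x (f x)%:E = \int[mu]_x (f x * phi x)%:E)%E.
Proof.
move=> mf; rewrite [LHS]integralE [RHS]integralE; congr (_ - _)%E.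
- rewrite ge0_integral_normal//.
    apply: eq_integral => x _; rewrite !funeposE /= -!EFin_max -EFinM; congr EFin.
    by rewrite maxr_pMl ?mul0r// ltW// phi_gt0.
  by apply: measurable_funepos; exact/measurable_EFinP.
- rewrite ge0_integral_normal//.
    apply: eq_integral => x _; rewrite !funenegE /= -!EFin_max -EFinM; congr EFin.
    by rewrite maxr_pMl ?mul0r ?mulNr// ltW// phi_gt0.
  by apply: measurable_funeneg; exact/measurable_EFinP.
Qed.

Lemma integrable_poly_normal (f : R -> R) C m : measurable_fun setT f ->
  (forall x, `|f x| <= C * (1 + x ^+ 2) ^+ m) ->
  N.-integrable setT (EFin \o f) /\
  mu.-integrable setT (EFin \o (fun x => f x * phi x)).
Proof.
move=> mf fC; have [K K0 HK] := poly_pdf_le m.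
have C0 : 0 <= C.
  by have := le_trans (normr_ge0 _) (fC 0); rewrite expr0n/= addr0 expr1n mulr1.
have Imu : mu.-integrable setT (EFin \o (fun x => f x * phi x)).
  have I0 : mu.-integrable setT
      (fun x => (C * K)%:E * (normal_pdf 0 (Num.sqrt 2) x)%:E)%E.
    by apply: integrableZl => //; exact: integrable_normal_pdf.
  apply: (le_integrable measurableT _ _ I0).
  - by apply/measurable_EFinP; apply: measurable_funM => //; exact: mphi.
  - move=> x _ /=; rewrite lee_fin normrM (ger0_norm (ltW (phi_gt0 x))).
    rewrite [leRHS]ger0_norm; last first.
      by rewrite mulr_ge0 ?normal_pdf_ge0// mulr_ge0// ltW.
    apply: (@le_trans _ _ (C * (1 + x ^+ 2) ^+ m * phi x)).
      by rewrite ler_wpM2r// ltW// phi_gt0.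
    by rewrite -!mulrA ler_wpM2l.
split => //; apply/integrableP; split; first exact/measurable_EFinP.
have /integrableP[_] := Imu; congr (_ < _)%E.
rewrite ge0_integral_normal//; last first.
  by apply/measurable_EFinP; exact: measurableT_comp.
apply: eq_integral => x _ /=; rewrite -EFinM normrM.
by rewrite (ger0_norm (ltW (phi_gt0 x))).
Qed.

(** One extra power of [1 + x ^+ 2] is spent in order to leave a factor that decays. *)
Lemma poly_phi_bound (g : R -> R) C m :
  (forall x, `|g x| <= C * (1 + x ^+ 2) ^+ m) ->
  exists K, forall x, `|g x * phi x| <= K * (1 + x ^+ 2)^-1.
Proof.
move=> gC; have [K K0 HK] := poly_pdf_le m.+1.
have C0 : 0 <= C.
  by have := le_trans (normr_ge0 _) (gC 0); rewrite expr0n/= addr0 expr1n mulr1.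
exists (C * (K * normal_peak (Num.sqrt 2))) => x.
have x1 : 0 < 1 + x ^+ 2 by have := sqr_ge0 x; lra.
rewrite ler_pdivlMr// normrM (ger0_norm (ltW (phi_gt0 x))).
apply: (@le_trans _ _ (C * (1 + x ^+ 2) ^+ m * phi x * (1 + x ^+ 2))).
  by rewrite ler_wpM2r ?(ltW x1)// ler_wpM2r// ltW// phi_gt0.
have -> : C * (1 + x ^+ 2) ^+ m * phi x * (1 + x ^+ 2) =
  C * ((1 + x ^+ 2) ^+ m.+1 * phi x) by rewrite (exprS _ m); ring.
rewrite ler_wpM2l// (le_trans (HK x))// ler_pM2l//.
by apply: normal_pdf_ub; rewrite gt_eqF// sqrtr_gt0.
Qed.

(** The sign [s] serves both boundary terms of an integration by parts over [[- n, n]]. *)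
Lemma cvg_poly_phi (g : R -> R) C m (s : R) : s ^+ 2 = 1 ->
  (forall x, `|g x| <= C * (1 + x ^+ 2) ^+ m) ->
  g (s * n%:R) * phi (s * n%:R) @[n --> \oo] --> (0 : R).
Proof.
move=> s1 /poly_phi_bound[K HK].
apply: norm_cvg0; apply: (@squeeze_cvgr _ _ _ _ (cst 0) (fun n => K * harmonic n)).
- near=> n; rewrite normr_ge0/=.
  have := HK (s * n%:R); rewrite exprMn s1 mul1r => /le_trans; apply.
  have K0 : 0 <= K.
    by have := le_trans (normr_ge0 _) (HK 0); rewrite expr0n/= addr0 invr1 mulr1.
  rewrite ler_wpM2l// /harmonic/= lef_pV2 ?posrE ?ltr0n//.
  rewrite -nat1r lerD2l -natrX ler_nat.
  by case: (n) => // q; rewrite leq_pmulr.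
- exact: cvg_cst.
- rewrite -(mulr0 K); apply: cvgM; [exact: cvg_cst|exact: cvg_harmonic].
Unshelve. all: by end_near. Qed.

Lemma is_derive_phi x : is_derive x 1 phi (- x * phi x).
Proof.
have -> : phi = (fun x => normal_peak 1 * expR (- (x ^+ 2 / 2))).
  by apply/funext => z; rewrite phiE.
apply: is_derive_eq.
by rewrite /GRing.scale/=; field.
Qed.

(** Stein's identity: the integrand times [phi] is the derivative of [g * phi]. It is integrated
    over [[- n, n]], where the boundary terms vanish in the limit, and dominated convergence gives
    the whole line. Polynomial growth is allowed because [g] will be a monomial or of the form
    [x * F (p x)]. *)
Lemma normal_ibp (g g' : R -> R) C m :
  (forall x, is_derive x 1 g (g' x)) -> continuous g' ->
  (forall x, `|g x| <= C * (1 + x ^+ 2) ^+ m) ->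
  (forall x, `|g' x| <= C * (1 + x ^+ 2) ^+ m) ->
  N.-integrable setT (fun x => (g' x - x * g x)%:E) /\
  (\int[N]_x (g' x - x * g x)%:E = 0)%E.
Proof.
move=> dg cg' gC g'C.
have C0 : 0 <= C.
  by have := le_trans (normr_ge0 _) (gC 0); rewrite expr0n/= addr0 expr1n mulr1.
have cg : continuous g.
  by move=> x; apply: differentiable_continuous; apply/derivable1_diffP; case: (dg x).
pose k x := g' x - x * g x.
have ck : continuous k.
  move=> x; apply: cvgB; first exact: cg'.
  by apply: cvgM; [exact: cvg_id|exact: cg].
have mk : measurable_fun setT k by exact: continuous_measurable_fun.
have kC x : `|k x| <= 2 * C * (1 + x ^+ 2) ^+ m.+1.
  apply: (le_trans (ler_normB _ _)); rewrite normrM.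
  apply: (@le_trans _ _ (C * (1 + x ^+ 2) ^+ m + `|x| * (C * (1 + x ^+ 2) ^+ m))).
    by rewrite lerD// ler_wpM2l.
  set A := (1 + x ^+ 2) ^+ m; rewrite exprS -/A.
  have A0 : 0 <= A by rewrite exprn_ge0// addr_ge0// sqr_ge0.
  have : 1 + `|x| <= 2 * (1 + x ^+ 2).
    rewrite -(real_normK (num_real x)); have := sqr_ge0 (`|x| - 1); have := sqr_ge0 `|x|; lra.
  move=> /(ler_wpM2l (mulr_ge0 C0 A0)); lra.
have [Nk muk] := integrable_poly_normal mk kC.
split; first exact: Nk.
rewrite (integral_normal mk).
pose G x := g x * phi x.
have dG x : is_derive x 1 G (k x * phi x).
  have dphi := is_derive_phi x; have dgx := dg x.
  have := is_deriveM dgx dphi => H; apply: (is_derive_eq H).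
  rewrite /GRing.scale/= /k; ring.
have cG : continuous G.
  by move=> x; apply: differentiable_continuous; apply/derivable1_diffP; case: (dG x).
pose fn n x := (k x * phi x * \1_`[- n%:R, n%:R] x)%:E.
have L1 : (\int[mu]_x fn n x @[n --> \oo] --> \int[mu]_x (k x * phi x)%:E)%E.
  apply: (@dominated_cvg _ _ _ mu setT measurableT fn _
     (fun x => `|k x * phi x|%:E)) => //.
  - move=> n; apply/measurable_EFinP; apply: measurable_funM => //.
    by apply: measurable_funM => //; exact: mphi.
  - move=> x _; apply: cvg_near_cst; near=> n.
    rewrite /fn indicE mem_set ?mulr1//= in_itv/= -ler_norml.
    by near: n; exact: nbhs_infty_ger.
  - exact: (integrable_abse muk).
  - move=> n x _; rewrite /fn lee_fin normrM ler_piMr//.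
    by rewrite indicE; case: (_ \in _); rewrite ?normr1 ?normr0.
(* The index [n.+1] keeps the interval nondegenerate, as the fundamental theorem of calculus asks
   for distinct end points. *)
have L2 n : (\int[mu]_x fn n.+1 x = (G n.+1%:R)%:E - (G (- n.+1%:R))%:E)%E.
  rewrite -(@continuous_FTC2 _ (fun x => k x * phi x)).
  - rewrite [RHS]integral_mkcond; apply: eq_integral => x _.
    rewrite /fn patchE indicE; case: (_ \in _); rewrite ?mulr1 ?mulr0//.
  - have : 0 < n.+1%:R :> R by rewrite ltr0n.
    by lra.
  - apply: continuous_subspaceT => x; apply: cvgM; first exact: ck.
    exact: continuous_normal_pdf.
  - split.
    + by move=> x _; case: (dG x).
    + exact/cvg_at_right_filter/cG.
    + exact/cvg_at_left_filter/cG.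
  - by move=> x _; rewrite derive1E; case: (dG x).
have L3 : (\int[mu]_x fn n.+1 x @[n --> \oo] --> (0 - 0)%:E)%E.
  rewrite (_ : (fun _ => _) = (fun n => (G n.+1%:R - G (- n.+1%:R))%:E)); last first.
    by apply/funext => n; rewrite L2.
  apply: cvg_EFin; first by near=> n.
  apply: cvgB.
    rewrite (cvg_shiftS (fun n => G n%:R)).
    have := @cvg_poly_phi g C m 1 (expr1n _ _) gC.
    by under eq_fun do rewrite mul1r.
  rewrite (cvg_shiftS (fun n => G (- n%:R))).
  have := @cvg_poly_phi g C m (-1) (etrans (sqrrN _) (expr1n _ _)) gC.
  by under eq_fun do rewrite mulN1r.
rewrite subrr in L3.
move: L1; rewrite -(cvg_shiftS (fun n => _)) => L1.
exact: (cvg_unique _ L1 L3).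
Unshelve. all: by end_near. Qed.

Lemma ge0_integral_lebesgueN (f : _ -> \bar R) : measurable_fun [set: R] f ->
  (forall x, 0 <= f x)%E -> (\int[mu]_x f (- x)%R = \int[mu]_x f x)%E.
Proof.
move=> mf f0.
have mN : measurable_fun setT (-%R : measurableTypeR R -> measurableTypeR R).
  exact: oppr_measurable.
have := @ge0_integral_pushforward _ _ _ _ R _ mN mu setT f.
rewrite preimage_setT => <- //.
by apply: eq_measure_integral => A mA _; exact: lebesgue_measureN.
Qed.

Lemma normal_probN (A : set R) : measurable A -> N (-%R @^-1` A) = N A.
Proof.
move=> mA; rewrite /normal_prob [LHS]integral_mkcond [RHS]integral_mkcond.
have mf : measurable_fun [set: R] ((fun x => (phi x)%:E) \_ A).
  apply/(measurable_restrictT _ mA); apply: measurable_funTS.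
  by apply/measurable_EFinP; exact: mphi.
rewrite -(ge0_integral_lebesgueN mf).
  by apply: eq_integral => x _; rewrite !patchE -[phi (- x)]phiN opprK.
by move=> x; rewrite patchE; case: ifP => // _; rewrite lee_fin ltW// phi_gt0.
Qed.

Lemma normal_prob1 x : N [set x] = 0%E.
Proof.
have /null_content_dominatesP := @normal_prob_dominates R 0 1.
by apply => //; exact: lebesgue_measure_set1.
Qed.

Lemma PhiE x : (Phi x)%:E = N `]-oo, x].
Proof. by rewrite /Phi fineK// fin_num_measure. Qed.

Lemma normal_prob_gt x : N `]x, +oo[ = (1 - Phi x)%:E.
Proof.
rewrite EFinB PhiE -probability_setC//; congr (N _).
by rewrite setCitvl.
Qed.

Lemma PhiN x : Phi (- x) = 1 - Phi x.
Proof.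
apply: EFin_inj; rewrite PhiE -normal_prob_gt -normal_probN//.
have -> : -%R @^-1` `]-oo, - x] = [set x] `|` `]x, +oo[.
  apply/seteqP; split => y /=; rewrite !in_itv/= lerN2 ?andbT.
    by rewrite le_eqVlt => /orP[/eqP|]; [left|right].
  by move=> [->|/ltW].
rewrite measureU//.
  by rewrite -[RHS]add0e; congr (_ + _)%E; exact: normal_prob1.
by apply/seteqP; split => y //= []->; rewrite in_itv/= ltxx.
Qed.

(** The Lipschitz constant 1 comes from [phi <= 1]. *)
Lemma Phi_lip x y : x <= y -> Phi x <= Phi y <= Phi x + (y - x).
Proof.
move=> xy.
have E : N `]-oo, y] = (N `]-oo, x] + N `]x, y])%E.
  rewrite -measureU//; last first.
    apply/seteqP; split => z //= []; rewrite !in_itv/= => zx /andP[xz _].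
    by move: (lt_le_trans xz zx); rewrite ltxx.
  congr (N _); apply/seteqP; split => z /=; rewrite !in_itv/=.
    by move=> zy; case: (leP z x) => zx; [left|right; apply/andP].
  by move=> [zx|/andP[]//]; exact: le_trans zx xy.
have B : (N `]x, y] <= (y - x)%:E)%E.
  rewrite /normal_prob; apply: (@le_trans _ _ (\int[mu]_(z in `]x, y]) 1%:E))%E.
    apply: ge0_le_integral => //=.
    - by move=> z _; rewrite lee_fin ltW// phi_gt0.
    - by apply: measurable_funTS; apply/measurable_EFinP; exact: mphi.
    - by move=> z _; rewrite lee_fin phi_le1.
  rewrite integral_cst//= mul1e lebesgue_measure_itv/= lte_fin.
  by case: ifPn => // _; rewrite lee_fin subr_ge0.
rewrite -!lee_fin EFinD !PhiE E leeDl//=.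
by rewrite leeD2l.
Qed.

Lemma cvg_phiy : phi x @[x --> +oo] --> (0 : R).
Proof.
have -> : phi = (fun x => normal_peak 1 * gauss_fun (x * (Num.sqrt 2)^-1)).
  apply/funext => x; rewrite phiE /gauss_fun exprMn exprVn sqr_sqrtr//.
rewrite -(mulr0 (normal_peak 1)); apply: cvgM; first exact: cvg_cst.
apply: (cvg_comp (fun x => x * (Num.sqrt 2)^-1) gauss_fun); last exact: cvg_gauss_fun.
by apply: gt0_cvgMly; [rewrite invr_gt0 sqrtr_gt0|exact: cvg_id].
Qed.

(** On [[x, +oo[] the factor [x] is at most [t], and [t * phi t] has the primitive [- phi]. *)
Lemma mills x : 0 <= x -> (x%:E * N `[x, +oo[ <= (phi x)%:E)%E.
Proof.
move=> x0.
have cphi : continuous phi by apply: continuous_normal_pdf; exact: oner_neq0.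
have -> : (phi x)%:E = (\int[mu]_(t in `[x, +oo[) (t * phi t)%:E)%E.
  rewrite (@ge0_continuous_FTC2y _ _ (fun t => - phi t) x 0).
  - by rewrite sub0e -EFinN opprK.
  - by move=> t xt; apply: mulr_ge0; [exact: le_trans xt|exact/ltW/phi_gt0].
  - by apply: continuous_subspaceT => t; apply: cvgM; [exact: cvg_id|exact: cphi].
  - by rewrite -[X in _ --> X]oppr0; apply: cvgN; exact: cvg_phiy.
  - by move=> t _; apply: derivableN; case: (is_derive_phi t).
  - by apply: cvgN; apply/cvg_at_right_filter/cphi.
  - move=> t _; rewrite derive1E.
    have dphi := is_derive_phi t; have := is_deriveN dphi => -[_ ->].
    by rewrite mulNr opprK.
rewrite /normal_prob -ge0_integralZl//=.
- apply: ge0_le_integral => //=.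
  + by move=> t _; rewrite mule_ge0// lee_fin ltW// phi_gt0.
  + by apply: measurable_funTS; apply/measurable_EFinP; apply: measurable_funM => //; exact: mphi.
  + by apply: measurable_funTS; apply/measurable_EFinP; apply: measurable_funM => //; exact: mphi.
  + move=> t; rewrite in_itv/= andbT => xt; rewrite -EFinM lee_fin ler_wpM2r//.
    by rewrite ltW// phi_gt0.
- by apply: measurable_funTS; apply/measurable_EFinP; exact: mphi.
- by move=> t _; rewrite lee_fin ltW// phi_gt0.
Qed.

Lemma millsN x : x <= 0 -> ((- x)%:E * N `]-oo, x] <= (phi x)%:E)%E.
Proof.
move=> x0; have := @mills (- x); rewrite oppr_ge0 phiN => /(_ x0).
congr (_ * _ <= _)%E; rewrite -normal_probN//; congr (N _).
by apply/seteqP; split => y /=; rewrite !in_itv/= andbT lerN2.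
Qed.

Lemma integrable_normal_bounded (f : R -> R) K : measurable_fun setT f ->
  (forall x, `|f x| <= K) -> N.-integrable setT (EFin \o f).
Proof.
move=> mf fK; apply: (integrable_poly_normal (C := K) (m := 0) mf _).1.
by move=> x; rewrite expr0 mulr1.
Qed.

Lemma abs_exprX_le m x : `|x ^+ m| <= 1 * (1 + x ^+ 2) ^+ m.
Proof.
rewrite mul1r normrX; apply: lerXn2r; rewrite ?nnegrE ?addr_ge0 ?sqr_ge0//.
rewrite -(real_normK (num_real x)); have := sqr_ge0 (`|x| - 1); have := normr_ge0 x; nra.
Qed.

Lemma normal_integrable_exprX m : N.-integrable setT (EFin \o (fun x => x ^+ m)).
Proof.
apply: (integrable_poly_normal _ (abs_exprX_le m)).1.
exact: measurable_funX.
Qed.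

Lemma normal_moment0 : \int[N]_x (x ^+ 0) = 1.
Proof.
under eq_Rintegral do rewrite expr0.
by rewrite Rintegral_cst//= probability_setT mul1r.
Qed.

Lemma normal_momentSS m : \int[N]_x (x ^+ m.+2) = m.+1%:R * \int[N]_x (x ^+ m).
Proof.
have dg x : is_derive x 1 (fun x => x ^+ m.+1) (m.+1%:R * x ^+ m).
  have -> : (fun x => x ^+ m.+1) = (id : R -> R) ^+ m.+1.
    by apply/funext => z; rewrite exprfctE.
  by apply: is_derive_eq; rewrite /GRing.scale/= mulr1.
have [|||_ /(congr1 fine)] := normal_ibp dg _ (C := m.+1%:R) (m := m.+1).
- move=> x; apply: cvgM; first exact: cvg_cst.
  exact: exprn_continuous.
- move=> x; apply: le_trans (abs_exprX_le _ _) _; rewrite ler_wpM2r ?ler1n//.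
  by rewrite exprn_ge0// addr_ge0// sqr_ge0.
- move=> x; rewrite normrM normr_nat ler_wpM2l//.
  apply: le_trans (abs_exprX_le _ _) _; rewrite mul1r [leRHS]exprS ler_peMl//.
    by rewrite exprn_ge0// addr_ge0// sqr_ge0.
  by rewrite lerDl sqr_ge0.
move=> H; have {H} : \int[N]_x (m.+1%:R * x ^+ m - x * x ^+ m.+1) = 0 by [].
have Im := normal_integrable_exprX m.
have E (x : R) : x * x ^+ m.+1 = x ^+ m.+2 by rewrite -exprS.
rewrite RintegralB//=.
- rewrite RintegralZl//; under [X in _ - X]eq_Rintegral do rewrite E.
  by move=> /eqP; rewrite subr_eq0 => /eqP.
- exact: (integrableZl measurableT m.+1%:R Im).
- have -> : (fun x : R => x * x ^+ m.+1) = (fun x => x ^+ m.+2) by exact/funext.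
  exact: normal_integrable_exprX.
Qed.

Lemma normal_moment2 : \int[N]_x (x ^+ 2) = 1.
Proof. by rewrite normal_momentSS normal_moment0 mulr1. Qed.

Lemma normal_moment4 : \int[N]_x (x ^+ 4) = 3.
Proof. by rewrite normal_momentSS normal_moment2 mulr1. Qed.

Lemma normal_moment8 : \int[N]_x (x ^+ 8) = 105.
Proof. rewrite 2!normal_momentSS normal_moment4; lra. Qed.

Lemma normal_moment1 : \int[N]_x x = 0.
Proof.
have dg x : is_derive x 1 (fun=> 1 : R) 0 by exact: is_derive_cst.
have [|||_ /(congr1 fine)] := normal_ibp dg _ (C := 1) (m := 0).
- by move=> x; exact: cvg_cst.
- by move=> x; rewrite normr1 expr0 mulr1.
- by move=> x; rewrite normr0 expr0 mulr1.
move=> H; have {H} : \int[N]_x (0 - x * 1) = 0 by [].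
under eq_Rintegral do rewrite mulr1 sub0r -mulN1r.
rewrite RintegralZl//; last exact: (normal_integrable_exprX 1).
by rewrite mulN1r => /eqP; rewrite oppr_eq0 => /eqP.
Qed.

(** This is the Bayes risk of the Neyman-Pearson test: the minimum is the likelihood ratio of N(u,1)
    to the left of [H] and the critical value to the right, so one piece is the error of the second
    kind and the other a multiple of the error of the first kind. *)
Lemma integral_min_expR u H : 0 < u ->
  \int[N]_x Num.min (expR (u * x - u ^+ 2 / 2)) (expR (u * H - u ^+ 2 / 2)) =
  Phi (H - u) + expR (u * H - u ^+ 2 / 2) * (1 - Phi H).
Proof.
move=> u0; set c := expR (u * H - _).
pose e x := expR (u * x - u ^+ 2 / 2).
have me : measurable_fun setT e.
  apply: measurableT_comp => //.
  by apply: measurable_funB => //; apply: measurable_funM.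
apply: EFin_inj; rewrite /Rintegral fineK; last first.
  apply: integrable_fin_num => //.
  apply: (integrable_normal_bounded (K := c)).
    by apply: measurable_minr.
  by move=> x; rewrite ger0_norm ?ge_min ?lexx ?orbT// le_min !expR_ge0.
have -> : [set: R] = `]-oo, H] `|` `]H, +oo[ by rewrite -setCitvl setUv.
rewrite ge0_integral_setU//=; last 3 first.
- rewrite -setCitvl setUv; apply/measurable_EFinP; exact: measurable_minr.
- by move=> x _; rewrite lee_fin le_min !expR_ge0.
- by rewrite -setCitvl; apply/disj_setPS; rewrite setICr.
rewrite EFinD; congr (_ + _)%E.
  have -> : (Phi (H - u))%:E = (\int[N]_x (\1_(`]-oo, H]%classic : set R) (x + u))%:E)%E.
    rewrite PhiE -[X in N X]setIT -integral_indic//; apply: eq_integral => x _.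
    rewrite !indicE; set p := _ \in _; set q := _ \in _; suff -> : p = q by [].
    by rewrite /p /q; apply/idP/idP; rewrite !inE/= !in_itv/= lerBrDr.
  pose g x : \bar R := (\1_(`]-oo, H]%classic : set R) x)%:E.
  have mg : measurable_fun [set: R] g by exact/measurable_EFinP.
  have := ge0_integral_normal_shift u mg; rewrite {1}/g => -> //.
  rewrite [LHS]integral_mkcond; apply: eq_integral => x _.
  rewrite patchE /g indicE; case: ifPn => [|]; last by rewrite mul0e.
  rewrite inE/= in_itv/= mul1e => xH; congr EFin; apply/min_idPl.
  by rewrite ler_expR lerD2r ler_pM2l.
transitivity (\int[N]_(x in `]H, +oo[) c%:E)%E.
  apply: eq_integral => x; rewrite inE/= in_itv/= andbT => xH; congr EFin.
  by apply/min_idPr; rewrite ler_expR lerD2r ler_pM2l// ltW.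
by rewrite integral_cst//= normal_prob_gt EFinM.
Qed.

(** * Bounded solutions of Stein's equation *)

Section stein_solution.
Variables (h : R -> R) (c : R).
Hypotheses (hcont : continuous h) (h0c : forall x, 0 <= h x <= c).

Let mh : measurable_fun setT h. Proof. exact: continuous_measurable_fun. Qed.
Let m := \int[N]_x h x.
Let h' x := h x - m.
(** [f = If / phi] is the classical solution of [f' - x f = h - m], and [f'] is read off from the
    equation. *)
Let If : R -> R := fun x => \int[mu]_(t in `]-oo, x]) (h' t * phi t).
Let f x := (phi x)^-1 * If x.
Let f' x := x * f x + h' x.

Let c0 : 0 <= c. Proof. by have /andP[] := h0c 0; exact: le_trans. Qed.

Let Nh : N.-integrable setT (EFin \o h).
Proof.
by apply: (integrable_normal_bounded (K := c)) => // x; have /andP[h0 hc] := h0c x; rewrite ger0_norm.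
Qed.

Let mE : (m%:E = \int[N]_x (h x)%:E)%E.
Proof. by rewrite /m /Rintegral fineK// integrable_fin_num. Qed.

Let m0c : 0 <= m <= c.
Proof.
rewrite -!lee_fin mE; apply/andP; split.
  by apply: integral_ge0 => x _; rewrite lee_fin; have /andP[] := h0c x.
apply: (@le_trans _ _ (\int[N]_x c%:E)%E).
  apply: ge0_le_integral => //=.
  - by move=> x _; rewrite lee_fin; have /andP[] := h0c x.
  - exact/measurable_EFinP.
  - by move=> x _; rewrite lee_fin; have /andP[] := h0c x.
by rewrite integral_cst//= probability_setT mule1.
Qed.

Let h'c x : `|h' x| <= c.
Proof.
have /andP[h0 hc] := h0c x; have /andP[m0 mc] := m0c.
by rewrite ler_norml /h'; apply/andP; split; lra.
Qed.

Let mh' : measurable_fun setT h'. Proof. exact: measurable_funB. Qed.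

Let muh' : mu.-integrable setT (EFin \o (fun x => h' x * phi x)).
Proof.
apply: (integrable_poly_normal (C := c) (m := 0) mh' _).2.
by move=> x; rewrite expr0 mulr1.
Qed.

Let If_abs (A : set R) : measurable A ->
  (`|\int[mu]_(t in A) (h' t * phi t)|%:E <= c%:E * N A)%E.
Proof.
move=> mA.
have mp : measurable_fun A (fun x => (phi x)%:E).
  by apply: measurable_funTS; apply/measurable_EFinP; exact: mphi.
have iA : mu.-integrable A (EFin \o (fun x => h' x * phi x)).
  exact: integrableS muh'.
apply: (@le_trans _ _ (\int[mu]_(t in A) `|(h' t * phi t)%:E|)%E).
  rewrite /Rintegral -abse_EFin fineK ?integrable_fin_num//.
  by apply: le_abse_integral => //; exact: measurable_int iA.
rewrite /normal_prob -ge0_integralZl//=; last first.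
  by move=> x _; rewrite lee_fin ltW// phi_gt0.
apply: ge0_le_integral => //=.
- apply: measurable_funTS; apply/measurable_EFinP.
  by apply: measurableT_comp => //; apply: measurable_funM => //; exact: mphi.
- exact: measurable_funeM.
- move=> x _; rewrite -EFinM lee_fin normrM (ger0_norm (ltW (phi_gt0 x))).
  by rewrite ler_wpM2r// ltW// phi_gt0.
Qed.

Let Iftot : \int[mu]_(t in setT) (h' t * phi t) = 0.
Proof.
rewrite /Rintegral -integral_normal// /h'.
under eq_integral do rewrite EFinB.
rewrite integralB//=.
  by rewrite integral_cst//= probability_setT mule1 -mE subee.
exact: finite_measure_integrable_cst.
Qed.

(** The total integral vanishes, so [If] may be computed over either tail; the tail on the side of
    [x] is the one that Mills' inequality controls. *)
Let IfC x : If x = - \int[mu]_(t in `[x, +oo[) (h' t * phi t).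
Proof.
apply/eqP; rewrite -addr_eq0; apply/eqP; rewrite -[RHS]Iftot /If.
have -> : [set: R] = `]-oo, x] `|` `]x, +oo[.
  by rewrite -setCitvl setUv.
rewrite Rintegral_setU//=; last 2 first.
- by rewrite -setCitvl setUv; exact: muh'.
- by rewrite -setCitvl; apply/disj_setPS; rewrite setICr.
congr (_ + _); rewrite -Rintegral_itv_obnd_cbnd//.
exact: integrableS muh'.
Qed.

Let xf_le x : `|x * f x| <= c.
Proof.
have p0 := phi_gt0 x.
have key : `|x| * `|If x| <= c * phi x.
  rewrite -lee_fin !EFinM.
  have [x0|x0] := leP 0 x.
    rewrite IfC normrN (ger0_norm x0).
    apply: (@le_trans _ _ (x%:E * (c%:E * N `[x, +oo[)))%E.
      by rewrite lee_wpmul2l ?lee_fin// If_abs.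
    by rewrite muleCA lee_wpmul2l ?lee_fin// mills.
  rewrite (ltr0_norm x0).
  apply: (@le_trans _ _ ((- x)%:E * (c%:E * N `]-oo, x])))%E.
    by rewrite lee_wpmul2l ?lee_fin ?oppr_ge0 ?(ltW x0)// If_abs.
  by rewrite muleCA lee_wpmul2l ?lee_fin// millsN// ltW.
by rewrite /f mulrCA !normrM normfV (gtr0_norm p0) mulrC ler_pdivrMr.
Qed.

Let dIf x : is_derive x 1 If (h' x * phi x).
Proof.
have ch : continuous (fun x => h' x * phi x).
  move=> t; apply: cvgM; last by apply: continuous_normal_pdf; exact: oner_neq0.
  by apply: cvgB; [exact: hcont|exact: cvg_cst].
have x1 : x < x + 1 by rewrite ltrDl.
have iu : mu.-integrable `]-oo, (x + 1)] (EFin \o (fun x => h' x * phi x)).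
  exact: integrableS muh'.
have [d1 d2] := continuous_FTC1 x1 iu (ltNyr _) (ch x).
by apply: DeriveDef; [exact: d1|rewrite -derive1E d2].
Qed.

Let df x : is_derive x 1 f (f' x).
Proof.
have p0 : phi x != 0 by rewrite gt_eqF// phi_gt0.
have dphi := is_derive_phi x.
have dV := is_deriveV p0 dphi.
have := is_deriveM dV (dIf x) => H; apply: (is_derive_eq H).
by rewrite /GRing.scale/= /f' /f; field.
Qed.

(** [F' = x F + (h - m)] is a sum of two terms of size at most [c], whence [2 * c]. Where [|x| >= 1]
    the bound on [x F] also bounds [F]; where [|x| < 1] the division by [phi] costs at most
    [1 / phi 1]. *)
Lemma stein_solution : exists K (F F' : R -> R),
  [/\ forall x, is_derive x 1 F (F' x), continuous F',
      forall x, F' x - x * F x = h x - \int[N]_x h x,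
      forall x, `|F x| <= K & forall x, `|F' x| <= 2 * c].
Proof.
have cf : continuous f.
  by move=> x; apply: differentiable_continuous; apply/derivable1_diffP; case: (df x).
exists (c + c / phi 1), f, f'; split => //.
- move=> x; apply: cvgD; first by apply: cvgM; [exact: cvg_id|exact: cf].
  by apply: cvgB; [exact: hcont|exact: cvg_cst].
- by move=> x; rewrite /f' addrAC subrr add0r.
- move=> x; have [x1|x1] := leP 1 `|x|.
    apply: (@le_trans _ _ c); last by rewrite lerDl divr_ge0// ltW// phi_gt0.
    by apply: le_trans (xf_le x); rewrite [leRHS]normrM ler_peMl.
  apply: (@le_trans _ _ (c / phi 1)); last by rewrite lerDr.
  rewrite /f mulrC normrM normfV (gtr0_norm (phi_gt0 x)).
  apply: (@le_trans _ _ (c / phi x)).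
    rewrite ler_wpM2r ?invr_ge0 ?(ltW (phi_gt0 x))// -lee_fin.
    apply: (le_trans (If_abs _)) => //.
    rewrite -[leRHS]mule1 lee_wpmul2l ?lee_fin//; exact: probability_le1.
  rewrite ler_wpM2l// lef_pV2 ?posrE ?phi_gt0// !phiE ler_wpM2l//.
    by rewrite normal_peak_ge0.
  rewrite ler_expR lerN2 ler_wpM2r// expr1n -(real_normK (num_real x)).
  by rewrite expr_le1// ltW.
- move=> x; rewrite /f' mulrDl mul1r (le_trans (ler_normD _ _))// lerD//.
Qed.

End stein_solution.

End gauss.

(** * Product structure of the noise *)

Definition upd {R : Type} (k : nat) (x : R) (y : nat -> R) : nat -> R :=
  fun j => if j == k then x else y j.

Section observations.
Context {R : realType}.

Lemma measurable_coord k :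
  measurable_fun [set: observations R] (fun y : observations R => y k).
Proof.
move=> _ B mB; rewrite setTI; apply: sub_sigma_algebra.
by exists k => //; exists B => //; rewrite setTI.
Qed.

Lemma measurable_to_obs d (T : measurableType d) (f : T -> observations R) :
  (forall k, measurable_fun setT (fun w => f w k)) -> measurable_fun setT f.
Proof.
move=> mf; apply: (@measurability _ _ T (observations R) setT f (@coordinate_sets R) erefl).
move=> _ [_ [k _ [B mB <-]] <-]; rewrite !setTI.
by have := mf k measurableT B mB; rewrite setTI.
Qed.

Lemma measurable_upd k : measurable_fun setT
  (fun p : measurableTypeR R * observations R => upd k p.1 p.2 : observations R).
Proof.
apply: measurable_to_obs => j; rewrite /upd; case: (j == k).
  exact: measurable_fst.
by apply: (measurableT_comp (measurable_coord j)); exact: measurable_snd.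
Qed.

Lemma upd_upd k (x x' : R) y : upd k x (upd k x' y) = upd k x y.
Proof. by apply/funext => j; rewrite /upd; case: (j == k). Qed.

Lemma upd_id k (y : nat -> R) : upd k (y k) y = y.
Proof. by apply/funext => j; rewrite /upd; case: eqP => // ->. Qed.

(** The pi-system on which mutual independence is stated; it generates the product sigma-algebra. *)
Definition cylinders : set (set (observations R)) :=
  [set C | exists (J : {fset nat}) (B : nat -> set R),
    (forall k, measurable (B k)) /\
    C = \bigcap_(k in [set` J]) ((fun y : nat -> R => y k) @^-1` B k)].

Lemma cylindersI : setI_closed cylinders.
Proof.
move=> _ _ [J1 [B1 [mB1 ->]]] [J2 [B2 [mB2 ->]]].
exists (J1 `|` J2)%fset.
exists (fun k => (if k \in J1 then B1 k else setT) `&` (if k \in J2 then B2 k else setT)).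
split; first by move=> k; apply: measurableI; case: ifP.
apply/seteqP; split => y /=.
  move=> [h1 h2] k /= _; split; case: ifPn => // kJ; [exact: h1|exact: h2].
move=> h; split => k /= kJ.
  by have [] := h k (_ : _); [rewrite /= inE kJ|rewrite kJ].
by have [] := h k (_ : _); [rewrite /= inE kJ orbT|rewrite kJ].
Qed.

Lemma cylinder_setT : cylinders setT.
Proof.
exists fset0, (fun=> setT); split => //.
by apply/seteqP; split => // y _ k.
Qed.

Lemma measurable_cylinders : @measurable _ (observations R) = <<s cylinders >>.
Proof.
apply/seteqP; split.
  apply: smallest_sub; first exact: smallest_sigma_algebra.
  move=> _ [k _ [B mB <-]]; apply: sub_sigma_algebra.
  exists [fset k]%fset, (fun=> B); split => //.
  apply/seteqP; split => y /=; first by move=> [_ yB] j /=; rewrite inE => /eqP ->.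
  by move=> h; split => //; apply: h; rewrite /= inE.
apply: smallest_sub; first exact: smallest_sigma_algebra.
move=> _ [J [B [mB ->]]]; apply: fin_bigcap_measurable => //.
by move=> k _; rewrite -[X in measurable X]setTI; apply: measurable_coord.
Qed.

End observations.

Section iid.
Context {d : measure_display} {T : measurableType d} {R : realType}.
Context (P : probability T R) (xi : nat -> {RV P >-> R}).
Hypothesis Hxi : iid_standard_normal xi.
Local Notation N := (@normal_prob R 0 1).

Definition noise (w : T) : observations R := fun k => xi k w.

Lemma measurable_noise : measurable_fun setT noise.
Proof. by apply: measurable_to_obs => k; exact: measurable_funP. Qed.

Lemma measurable_updl k y : measurable_fun setT (fun x : R => upd k x y : observations R).
Proof. apply: measurable_to_obs => j; rewrite /upd.
by case: (j == k) => //; exact: measurable_cst. Qed.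

Lemma measurable_updr k x :
  measurable_fun setT (fun y : observations R => upd k x y : observations R).
Proof. apply: measurable_to_obs => j; rewrite /upd.
by case: (j == k) => //; exact: measurable_coord. Qed.

(** Overwriting coordinate [k] by a constant removes the dependence on [xi k] and stays within the
    space of full sequences. *)
Let rest k (w : T) : observations R := upd k 0 (noise w).

Let measurable_rest k : measurable_fun setT (rest k).
Proof. by apply: measurableT_comp; [exact: measurable_updr|exact: measurable_noise]. Qed.

Let xi_rest k (w : T) : measurableTypeR R * observations R := (xi k w, rest k w).

Let measurable_xi_rest k : measurable_fun setT (xi_rest k).
Proof.
by apply: measurable_fun_pair; [exact: (measurable_funP (xi k))|exact: measurable_rest].
Qed.

Let restRV k : {RV P >-> observations R} := mfun_Sub (mem_set (measurable_rest k)).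
Let xi_restRV k : {RV P >-> (measurableTypeR R * observations R)%type} :=
  mfun_Sub (mem_set (measurable_xi_rest k)).
Let Q k : probability (observations R) R := distribution P (restRV k).

Let indep_rest_cyl k (A : set R) (C : set (observations R)) : measurable A -> cylinders C ->
  P (xi k @^-1` A `&` rest k @^-1` C) = (N A * P (rest k @^-1` C))%E.
Proof.
move=> mA [J [B [mB ->]]].
(* A cylinder may constrain coordinate [k], where [rest k] is constantly 0: the constraint either
   holds always or empties the event. *)
have [kB0|kB0] := pselect (k \in J -> B k 0); last first.
  have -> : rest k @^-1` (\bigcap_(k0 in [set` J])
      ((fun y : nat -> R => y k0) @^-1` B k0)) = set0.
    apply/seteqP; split => w //= h; case: kB0 => kJ.
    by have := h k kJ; rewrite /= /rest /upd eqxx.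
  by rewrite setI0 measure0 mule0.
have E (A' : set R) : xi k @^-1` A' `&` rest k @^-1` (\bigcap_(k0 in [set` J])
      ((fun y : nat -> R => y k0) @^-1` B k0)) =
   \bigcap_(j in [set` (k |` (J `\ k))%fset]) (xi j @^-1` (if j == k then A' else B j)).
  apply/seteqP; split => w /=.
    move=> [Aw h] j /=; rewrite !inE; case: eqP => [->//|/eqP jk /= jJ].
    by have := h j jJ; rewrite /= /rest /upd (negbTE jk).
  move=> h; split.
    by have := h k; rewrite /= !inE eqxx; apply.
  move=> j /= jJ; rewrite /rest /upd; case: eqP => [jk|/eqP jk].
    by rewrite jk; apply: kB0; rewrite -jk.
  by have := h j; rewrite /= !inE jJ (negbTE jk); apply.
have PE (A' : set R) : measurable A' ->
  P (xi k @^-1` A' `&` rest k @^-1` (\bigcap_(k0 in [set` J])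
      ((fun y : nat -> R => y k0) @^-1` B k0))) =
  (N A' * \prod_(j <- (J `\ k)%fset) P (xi j @^-1` B j))%E.
  move=> mA'; rewrite E Hxi.1; last by move=> j; case: ifP.
  rewrite big_fsetU1/= ?inE ?eqxx//; congr (_ * _)%E.
    by rewrite -(Hxi.2 k A' mA').
  rewrite big_seq [RHS]big_seq; apply: eq_bigr => j.
  by rewrite !inE => /andP[/negbTE ->].
have := PE setT measurableT; rewrite preimage_setT setTI probability_setT mul1e => ->.
exact: PE.
Qed.

(** As functions of [C] both sides are finite measures, and they agree on the cylinders. *)
Let indep_rest k (A : set R) (C : set (observations R)) : measurable A -> measurable C ->
  P (xi k @^-1` A `&` rest k @^-1` C) = (N A * P (rest k @^-1` C))%E.
Proof.
move=> mA mC.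
have mXA : measurable (xi k @^-1` A) by rewrite -[X in measurable X]setTI; exact: measurable_funP.
pose PA : {measure set T -> \bar R} := mrestr P mXA.
pose m1' : {measure set (observations R) -> \bar R} := pushforward PA (rest k).
pose m1 := m1' (measurable_rest k).
pose a := NngNum (fine_ge0 (measure_ge0 N A)).
pose m2 : {measure set (observations R) -> \bar R} := mscale a (Q k).
have aE : (a%:num%:E = N A)%E by rewrite /= fineK// fin_num_measure.
have : m1 C = m2 C.
  apply: (@measure_unique _ _ _ cylinders (fun=> setT)) => //.
  - exact: measurable_cylinders.
  - exact: cylindersI.
  - by move=> _; exact: cylinder_setT.
  - by apply/seteqP; split => // y _; exists 0%N.
  - move=> C' cC'; rewrite /m1 /m2 /= /mscale /pushforward /PA /= /mrestr/=.
    by rewrite setIC aE indep_rest_cyl.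
  - move=> _; rewrite /m1 /= /pushforward /PA /mrestr/=.
    by rewrite (le_lt_trans (probability_le1 _ _)) ?ltry//; rewrite preimage_setT setTI.
rewrite /m1 /m2 /= /mscale /pushforward /PA /= /mrestr/= aE.
by rewrite setIC.
Qed.

Let joint k (X : set (measurableTypeR R * observations R)) : measurable X ->
  (N \x Q k)%E X = distribution P (xi_restRV k) X.
Proof.
by move=> mX; apply: product_measure_unique mX => A B mA mB; rewrite -indep_rest.
Qed.

(** [xi k] and [rest k] have a product law, so Tonelli's theorem integrates coordinate [k]
    separately. All later uses of independence go through this identity. *)
Lemma ge0_integral_resample k (G : _ -> \bar R) :
  measurable_fun [set: observations R] G -> (forall y, 0 <= G y)%E ->
  (\int[P]_w G (noise w) = \int[P]_w \int[N]_x G (upd k x (noise w)))%E.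
Proof.
move=> mG G0.
pose H (p : measurableTypeR R * observations R) := G (upd k p.1 p.2).
have mH : measurable_fun setT H by exact: (measurableT_comp mG (measurable_upd k)).
have H0 p : (0 <= H p)%E by exact: G0.
transitivity (\int[distribution P (xi_restRV k)]_p H p)%E.
  rewrite ge0_integral_distribution//; apply: eq_integral => w _ /=.
  by rewrite /H /= /rest upd_upd -[xi k w]/(noise w k) upd_id.
transitivity (\int[(N \x Q k)%E]_p H p)%E.
  by apply: eq_measure_integral => A mA _; exact/esym/joint.
rewrite fubini_tonelli1// fubini_tonelli// /Q ge0_integral_distribution//.
- by apply: eq_integral => w _ /=; rewrite /fubini_G /H /= /rest; apply: eq_integral => x _; rewrite upd_upd.
- exact: measurable_fun_fubini_tonelli_G.
- by move=> y; apply: integral_ge0 => x _; exact: H0.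
Qed.

(** For signed integrands the identity is applied to the positive and negative parts, whose inner
    integrals coincide by hypothesis. *)
Lemma integral_resample_eq0 k (G : observations R -> R) :
  measurable_fun [set: observations R] G ->
  P.-integrable setT (fun w => (G (noise w))%:E) ->
  (forall y : observations R, N.-integrable setT (fun x => (G (upd k x y))%:E) /\
    (\int[N]_x (G (upd k x y))%:E = 0)%E) ->
  (\int[P]_w (G (noise w))%:E = 0)%E.
Proof.
move=> mG iG G0.
have mGE : measurable_fun setT (EFin \o G) by exact/measurable_EFinP.
rewrite integralE.
have -> : (\int[P]_w (fun w => (G (noise w))%:E)^\- w =
           \int[P]_w (fun w => (G (noise w))%:E)^\+ w)%E.
  transitivity (\int[P]_w (EFin \o G)^\- (noise w))%E.
    by apply: eq_integral => w _; rewrite !funenegE.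
  rewrite (ge0_integral_resample k); [|exact: measurable_funeneg|by move=> y].
  transitivity (\int[P]_w (EFin \o G)^\+ (noise w))%E; last first.
    by apply: eq_integral => w _; rewrite !funeposE.
  rewrite [RHS](ge0_integral_resample k); [|exact: measurable_funepos|by move=> y].
  apply: eq_integral => w _; have [iN] := G0 (noise w).
  have iNn := integrable_funeneg measurableT iN.
  rewrite integralE => /eqP; rewrite sube_eq ?add0e.
  - move=> /eqP E; transitivity (\int[N]_x (fun x => (G (upd k x (noise w)))%:E)^\- x)%E.
      by apply: eq_integral => x _; rewrite !funenegE.
    by rewrite -E; apply: eq_integral => x _; rewrite !funeposE.
  - by rewrite integrable_pos_fin_num.
  - by rewrite fin_num_adde_defr// integrable_neg_fin_num.
by rewrite subee// integrable_pos_fin_num.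
Qed.

End iid.

(** * Random signs *)

Section cosh_bound.
Context {R : realType}.
Implicit Types z t x : R.

Lemma is_derive_ge0_le (f f' : R -> R) z : (forall x, is_derive x 1 f (f' x)) ->
  (forall x, 0 < x -> 0 <= f' x) -> 0 <= z -> f 0 <= f z.
Proof.
move=> df f'0 z0; apply: (@ger0_derive1_ndecry _ f 0) => //.
- by move=> x; rewrite in_itv/= andbT derive1E => x0; case: (df x) => _ ->; exact: f'0.
- apply: continuous_subspaceT => x.
  by apply: differentiable_continuous; apply/derivable1_diffP; case: (df x).
Qed.

Let ch z : R := (expR z + expR (- z)) / 2.
Let sh z : R := (expR z - expR (- z)) / 2.

Let dch z : is_derive z 1 ch (sh z).
Proof. by apply: is_derive_eq; rewrite /GRing.scale/= /sh; field. Qed.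

Let dsh z : is_derive z 1 sh (ch z).
Proof. by apply: is_derive_eq; rewrite /GRing.scale/= /ch; field. Qed.

Let ch_gt0 z : 0 < ch z.
Proof. by rewrite divr_gt0// addr_gt0// expR_gt0. Qed.

Let sh_ge0 z : 0 <= z -> 0 <= sh z.
Proof. by move=> z0; rewrite divr_ge0// subr_ge0 ler_expR; lra. Qed.

Let zch_ge_sh z : 0 <= z -> 0 <= z * ch z - sh z.
Proof.
pose f z := z * ch z - sh z.
have f0 : f 0 = 0 by rewrite /f /sh oppr0 subrr mul0r mul0r subr0.
move=> z0; suff: f 0 <= f z by rewrite f0.
move: z0; apply: (@is_derive_ge0_le f (fun x => x * sh x)) => [x|x x0].
  have := dch x; have := dsh x => ? ?.
  by apply: is_derive_eq; rewrite /GRing.scale/=; ring.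
by rewrite mulr_ge0 ?sh_ge0// ltW.
Qed.

(** This is [tanh z >= z - z ^+ 3 / 3] multiplied by [ch z]; the difference vanishes at 0 and its
    derivative is a sum of two nonnegative terms. *)
Let sh_ge z : 0 <= z -> 0 <= sh z - (z - z ^+ 3 / 3) * ch z.
Proof.
pose f z := sh z - (z - z ^+ 3 / 3) * ch z.
have f0 : f 0 = 0 by rewrite /f /sh oppr0 subrr expr0n/= !mul0r subrr mul0r subr0.
move=> z0; suff: f 0 <= f z by rewrite f0.
move: z0; apply: (@is_derive_ge0_le f
  (fun x => x * (x * ch x - sh x) + x ^+ 3 / 3 * sh x)) => [x|x x0].
  have := dch x; have := dsh x => ? ?.
  by apply: is_derive_eq; rewrite /GRing.scale/=; field.
rewrite addr_ge0// mulr_ge0 ?zch_ge_sh ?sh_ge0 ?divr_ge0 ?exprn_ge0// ltW//.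
Qed.

(** The logarithm of cosh has derivative [tanh z >= z - z ^+ 3 / 3], and the exponent on the left is
    the primitive of this lower bound. Evenness reduces the claim to [z >= 0]. *)
Lemma cosh_ge_expR z : expR (z ^+ 2 / 2 - z ^+ 4 / 12) <= (expR z + expR (- z)) / 2.
Proof.
wlog z0 : z / 0 <= z.
  move=> H; have [/H//|z0] := leP 0 z.
  have e4 : (- z) ^+ 4 = z ^+ 4 by ring.
  have := H (- z); rewrite oppr_ge0 (ltW z0) opprK sqrrN e4 => /(_ isT).
  by rewrite (addrC (expR (- z))).
pose f z := ch z * expR (- (z ^+ 2 / 2 - z ^+ 4 / 12)).
suff : f 0 <= f z.
  rewrite /f {1}/ch oppr0 !expr0n/= !mul0r subrr oppr0 expR0.
  rewrite (_ : (1 + 1) / 2 = 1) ?mul1r; last by field.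
  by rewrite expRN -ler_pdivrMr ?invr_gt0 ?expR_gt0// invrK mul1r.
apply: (@is_derive_ge0_le f (fun x =>
  expR (- (x ^+ 2 / 2 - x ^+ 4 / 12)) * (sh x - (x - x ^+ 3 / 3) * ch x))) => // [x|x x0].
  have := dch x => ?.
  by apply: is_derive_eq; rewrite /GRing.scale/=; field.
by rewrite mulr_ge0 ?expR_ge0 ?sh_ge// ltW.
Qed.

(* Density, with respect to N(0,1), of the symmetric mixture of N(t,1) and N(-t,1). *)
Definition sym_lr t x : R := expR (- (t ^+ 2 / 2)) * ((expR (t * x) + expR (- (t * x))) / 2).

Lemma sym_lr_ge0 t x : 0 <= sym_lr t x.
Proof. by rewrite mulr_ge0 ?expR_ge0// divr_ge0// addr_ge0// expR_ge0. Qed.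

Lemma sym_lrE t x : sym_lr t x =
  (expR (t * x - t ^+ 2 / 2) + expR (- t * x - (- t) ^+ 2 / 2)) / 2.
Proof. by rewrite /sym_lr !expRD sqrrN mulNr; ring. Qed.

Lemma sym_lr_ge t x :
  expR (t ^+ 2 / 2 * (x ^+ 2 - 1) - t ^+ 4 / 12 * x ^+ 4) <= sym_lr t x.
Proof.
apply: (@le_trans _ _ (expR (- (t ^+ 2 / 2)) * expR ((t * x) ^+ 2 / 2 - (t * x) ^+ 4 / 12))).
  rewrite -expRD ler_expR !exprMn; lra.
by rewrite ler_pM2l ?expR_gt0// cosh_ge_expR.
Qed.

Lemma measurable_sym_lr t : measurable_fun setT (sym_lr t).
Proof.
apply: measurable_funM => //; apply: measurable_funM => //.
apply: measurable_funD; apply: measurableT_comp => //.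
by under eq_fun do rewrite -mulNr; apply: measurable_funM.
Qed.

End cosh_bound.

(** * Tilting one coordinate and choosing the signs *)

Section iid.
Context {d : measure_display} {T : measurableType d} {R : realType}.
Context (P : probability T R) (xi : nat -> {RV P >-> R}).
Hypothesis Hxi : iid_standard_normal xi.
Local Notation N := (@normal_prob R 0 1).
Local Notation noise := (noise xi).

Lemma measurable_shift k t : measurable_fun [set: observations R]
    (fun y : observations R => upd k (y k + t) y : observations R).
Proof.
apply: measurable_to_obs => j; rewrite /upd; case: (j == k).
  by apply: measurable_funD => //; exact: measurable_coord.
exact: measurable_coord.
Qed.

Let mean_le (x y : \bar R) : (y <= x)%E -> (2^-1%:E * (x + y) <= x)%E.
Proof.
move=> yx; apply: (@le_trans _ _ (2^-1%:E * (x + x))%E).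
  by rewrite lee_wpmul2l ?lee_fin// leeD2l.
case: x {yx} => [x| |].
- by rewrite -EFinD -EFinM lee_fin; lra.
- by rewrite leey.
- by rewrite mulr_infty gtr0_sg// mul1e.
Qed.

(** Resampling coordinate [k] with the others frozen reduces this to the one-dimensional shift. *)
Lemma ge0_integral_shift k t (G : _ -> \bar R) :
  measurable_fun [set: observations R] G -> (forall y, 0 <= G y)%E ->
  (\int[P]_w G (upd k (xi k w + t)%R (noise w)) =
   \int[P]_w (G (noise w) * (expR (t * xi k w - t ^+ 2 / 2))%:E))%E.
Proof.
move=> mG G0.
have mshift := measurable_shift k t.
have mexp : measurable_fun [set: observations R]
    (fun y : observations R => expR (t * y k - t ^+ 2 / 2)).
  apply: measurableT_comp => //; apply: measurable_funB => //.
  by apply: measurable_funM => //; exact: measurable_coord.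
have := @ge0_integral_resample _ _ _ _ _ Hxi k (fun y => G (upd k (y k + t) y)).
rewrite /= => -> //; last exact: (measurableT_comp mG mshift).
have := @ge0_integral_resample _ _ _ _ _ Hxi k
  (fun y => G y * (expR (t * y k - t ^+ 2 / 2))%:E)%E.
rewrite /= => ->; first last.
- by move=> y; rewrite mule_ge0// lee_fin expR_ge0.
- by apply: emeasurable_funM => //; exact/measurable_EFinP.
apply: eq_integral => w _.
have E x : upd k x (noise w) k = x by rewrite /upd eqxx.
under eq_integral do rewrite E upd_upd.
under [RHS]eq_integral do rewrite E.
have mg : measurable_fun [set: R] (fun x : R => G (upd k x (noise w))).
  apply: (measurableT_comp mG); exact: measurable_updl.
by rewrite -(ge0_integral_normal_shift t mg).
Qed.

(* The left-hand side is the average of the right-hand side over independent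
   random signs of [th]; the signs are fixed one coordinate at a time. *)
Lemma exists_sign_ge (th : nat -> R) n (G : _ -> \bar R) :
  measurable_fun [set: observations R] G -> (forall y, 0 <= G y)%E ->
  exists eta : nat -> R, [/\ forall k, (k < n)%N -> eta k ^+ 2 = th k ^+ 2,
    forall k, (n <= k)%N -> eta k = 0 &
    (\int[P]_w (G (noise w) * (\prod_(k < n) sym_lr (th k) (xi k w))%:E) <=
     \int[P]_w G (fun k => noise w k + eta k)%R)%E].
Proof.
elim: n G => [|n IH] G mG G0.
  exists (fun=> 0); split => //.
  rewrite le_eqVlt; apply/orP; left; apply/eqP; apply: eq_integral => w _.
  rewrite big_ord0 mule1; congr (G _); apply/funext => k; exact/esym/addr0.
pose Lr (y : observations R) := \prod_(k < n) sym_lr (th k) (y k).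
have mLr : measurable_fun [set: observations R] Lr.
  apply: measurable_prod => k _.
  exact: (measurableT_comp (measurable_sym_lr _) (measurable_coord _)).
have Lr0 y : 0 <= Lr y by apply: prodr_ge0 => k _; exact: sym_lr_ge0.
pose G2 y : \bar R := (G y * (Lr y)%:E)%E.
have mG2 : measurable_fun [set: observations R] G2.
  by apply: emeasurable_funM => //; exact/measurable_EFinP.
have G20 y : (0 <= G2 y)%E by rewrite mule_ge0// lee_fin.
have me t : measurable_fun setT (fun w => (expR (t * xi n w - t ^+ 2 / 2))%:E).
  apply/measurable_EFinP; apply: measurableT_comp => //; apply: measurable_funB => //.
  by apply: measurable_funM.
have mG2n : measurable_fun setT (fun w => G2 (noise w)).
  exact: (measurableT_comp mG2 (measurable_noise xi)).
pose I (t : R) := (\int[P]_w G2 (upd n (xi n w + t)%R (noise w)))%E.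
have IE t : I t = (\int[P]_w (G2 (noise w) * (expR (t * xi n w - t ^+ 2 / 2))%:E))%E.
  by rewrite /I ge0_integral_shift.
(* The larger of the two tilted integrals is at least their average. *)
have [t tth It] : exists2 t, t ^+ 2 = th n ^+ 2 &
    (\int[P]_w (G (noise w) * (\prod_(k < n.+1) sym_lr (th k) (xi k w))%:E) <= I t)%E.
  have avg : (\int[P]_w (G (noise w) * (\prod_(k < n.+1) sym_lr (th k) (xi k w))%:E) =
      2^-1%:E * (I (th n) + I (- th n)%R))%E.
    rewrite !IE -ge0_integralD//; first last.
    - by apply: emeasurable_funM => //; exact: me.
    - by move=> w _; rewrite mule_ge0// lee_fin expR_ge0.
    - by apply: emeasurable_funM => //; exact: me.
    - by move=> w _; rewrite mule_ge0// lee_fin expR_ge0.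
    rewrite -ge0_integralZl//; first last.
    - by move=> w _; rewrite adde_ge0// mule_ge0// lee_fin expR_ge0.
    - by apply: emeasurable_funD; apply: emeasurable_funM => //; exact: me.
    apply: eq_integral => w _; rewrite big_ord_recr/= -ge0_muleDr ?lee_fin ?expR_ge0//.
    rewrite /G2 -/(Lr (noise w)) EFinM sym_lrE -EFinD EFinM.
    by rewrite [LHS]muleA [LHS]muleA muleC.
  have [le|le] := leP (I (- th n)) (I (th n)).
    by exists (th n) => //; rewrite avg; exact: mean_le.
  by exists (- th n); [rewrite sqrrN|rewrite avg addeC; apply: mean_le; exact: ltW].
(* The shift chosen in coordinate [n] is absorbed into the function. The induction hypothesis
   settles the coordinates below [n] and leaves coordinate [n] of its [eta] at 0, free to receive
   [t]. *)
pose G' y : \bar R := G (upd n (y n + t) y).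
have [|y|eta [eta1 eta2 eta3]] := IH G' _ _.
- exact: (measurableT_comp mG (measurable_shift n t)).
- exact: G0.
exists (upd n t eta); split.
- move=> k; rewrite ltnS leq_eqVlt /upd; case: eqP => [->//|kn /= ?]; exact: eta1.
- move=> k; rewrite /upd; case: eqP => [->|kn nk]; first by rewrite ltnn.
  by apply: eta2; exact: ltnW.
apply: (le_trans It); apply: (le_trans _ (le_trans eta3 _)).
- rewrite /I /G2 le_eqVlt; apply/orP; left; apply/eqP; apply: eq_integral => w _.
  congr (_ * _%:E)%E; apply: eq_bigr => k _; rewrite /upd ltn_eqF//.
- rewrite le_eqVlt; apply/orP; left; apply/eqP; apply: eq_integral => w _.
  rewrite /G' eta2//; congr (G _); apply/funext => k; rewrite /upd; case: eqP => [->|//].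
  by rewrite addr0.
Qed.

End iid.

(** * Quadratic forms of the noise and Stein's method *)

Section moments.
Context {d : measure_display} {T : measurableType d} {R : realType}.
Context (P : probability T R).

(** The pointwise bound [|X| <= X ^+ 2 / (2 a) + a / 2] takes the place of the Cauchy-Schwarz
    inequality and yields integrability at the same time. *)
Lemma integral_abs_le (X : T -> R) a : measurable_fun setT X -> 0 < a ->
  P.-integrable setT (EFin \o (fun w => X w ^+ 2)) ->
  \int[P]_w (X w ^+ 2) <= a ^+ 2 ->
  P.-integrable setT (EFin \o X) /\ \int[P]_w `|X w| <= a.
Proof.
move=> mX a0 iX2 X2a.
have i1 : P.-integrable setT (EFin \o (fun=> a / 2)) by exact: finite_measure_integrable_cst.
have i2 : P.-integrable setT (EFin \o (fun w => (2 * a)^-1 * X w ^+ 2)).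
  exact: (integrableZl measurableT _ iX2).
have i3 : P.-integrable setT (EFin \o (fun w => (2 * a)^-1 * X w ^+ 2 + a / 2)).
  exact: (integrableD measurableT i2 i1).
have le w : `|X w| <= (2 * a)^-1 * X w ^+ 2 + a / 2.
  have -> : (2 * a)^-1 * X w ^+ 2 + a / 2 = (X w ^+ 2 + a ^+ 2) / (2 * a).
    by field; rewrite gt_eqF.
  rewrite ler_pdivlMr ?mulr_gt0// -(real_normK (num_real (X w))).
  by have := sqr_ge0 (`|X w| - a); lra.
have iX : P.-integrable setT (EFin \o X).
  apply: (le_integrable measurableT _ _ i3); first exact/measurable_EFinP.
  by move=> w _ /=; rewrite lee_fin (le_trans (le w))// ler_norm.
split => //.
apply: (@le_trans _ _ (\int[P]_w ((2 * a)^-1 * X w ^+ 2 + a / 2))).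
  apply: le_Rintegral => //; exact: (integrable_norm iX).
rewrite RintegralD// RintegralZl// Rintegral_cst//= probability_setT mulr1.
apply: (@le_trans _ _ ((2 * a)^-1 * a ^+ 2 + a / 2)).
  by rewrite lerD2r ler_wpM2l// invr_ge0 mulr_ge0// ltW.
rewrite le_eqVlt; apply/orP; left; apply/eqP; by field; rewrite gt_eqF.
Qed.

Lemma chebyshev_le (X : T -> R) a : measurable_fun setT X -> 0 < a ->
  P.-integrable setT (EFin \o (fun w => X w ^+ 2)) ->
  (P [set w | (a <= `|X w|)%R] <= (\int[P]_w (X w ^+ 2) / a ^+ 2)%:E)%E.
Proof.
move=> mX a0 iX2.
have mA : measurable [set w | (a <= `|X w|)%R].
  rewrite -[X in measurable X]setTI.
  have mXn : measurable_fun setT (fun w => `|X w|) by exact: measurableT_comp.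
  have := mXn measurableT _ (measurable_itv `[a, +oo[).
  by congr (measurable (_ `&` _)); apply/seteqP; split => w /=; rewrite in_itv/= andbT.
rewrite -(setIT [set w | _]) -integral_indic//.
have -> : ((\int[P]_w (X w ^+ 2) / a ^+ 2)%:E = \int[P]_w (X w ^+ 2 / a ^+ 2)%:E)%E.
  rewrite EFinM /Rintegral fineK ?integrable_fin_num//.
  by under [RHS]eq_integral do rewrite EFinM; rewrite integralZr.
apply: ge0_le_integral => //=.
- exact/measurable_EFinP.
- by apply/measurable_EFinP; apply: measurable_funM => //; exact: measurable_funX.
- move=> w _; rewrite lee_fin indicE; case: (boolP (_ \in _)) => [|_].
    rewrite inE/= => aX; rewrite ler_pdivlMr ?exprn_gt0// mul1r -[leRHS]real_normK ?num_real//.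
    by apply: lerXn2r; rewrite ?nnegrE// ltW.
  by rewrite divr_ge0// ?sqr_ge0// exprn_ge0// ltW.
Qed.

End moments.

Section iid.
Context {d : measure_display} {T : measurableType d} {R : realType}.
Context (P : probability T R) (xi : nat -> {RV P >-> R}).
Hypothesis Hxi : iid_standard_normal xi.
Local Notation N := (@normal_prob R 0 1).
Local Notation noise := (noise xi).

Lemma integral_xi k (f : R -> R) : measurable_fun setT f ->
  N.-integrable setT (EFin \o f) ->
  P.-integrable setT (EFin \o (fun w => f (xi k w))) /\
  \int[P]_w f (xi k w) = \int[N]_x f x.
Proof.
move=> mf iN.
have dE (h : R -> \bar R) : measurable_fun [set: R] h -> (forall x, 0 <= h x)%E ->
    (\int[P]_w h (xi k w) = \int[N]_x h x)%E.
  move=> mh h0.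
  have := @ge0_integral_resample _ _ _ _ _ Hxi k (fun y => h (y k)).
  rewrite /= => -> //; last exact: (measurableT_comp mh (measurable_coord k)).
  under eq_integral => w _ do under eq_integral do rewrite /upd eqxx.
  by rewrite integral_cst//= probability_setT mule1.
have mfE : measurable_fun [set: R] (EFin \o f) by exact/measurable_EFinP.
have iP : P.-integrable setT (EFin \o (fun w => f (xi k w))).
  apply/integrableP; split.
    by apply/measurable_EFinP; exact: measurableT_comp.
  have /integrableP[_] := iN; congr (_ < _)%E.
  rewrite -(dE (fun x => `|(f x)%:E|)%E)//; exact: measurableT_comp.
split => //; rewrite /Rintegral; congr fine.
rewrite integralE [RHS]integralE; congr (_ - _)%E.
  rewrite -[RHS](dE (EFin \o f)^\+%E)//; last exact: measurable_funepos.
  by apply: eq_integral => w _; rewrite !funeposE.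
rewrite -[RHS](dE (EFin \o f)^\-%E)//; last exact: measurable_funeneg.
by apply: eq_integral => w _; rewrite !funenegE.
Qed.

Section linear_statistic.
Variables (g : R -> R) (c : nat -> R).
Hypotheses (mg : measurable_fun setT g) (ig : N.-integrable setT (EFin \o g))
  (ig2 : N.-integrable setT (EFin \o (fun x => g x ^+ 2)))
  (g0 : \int[N]_x g x = 0).

Lemma measurable_linstat n : measurable_fun [set: observations R]
  (fun y : observations R => \sum_(k < n) c k * g (y k)).
Proof.
apply: measurable_sum => k; apply: measurable_funM => //.
exact: (measurableT_comp mg (measurable_coord _)).
Qed.

(** In the induction the cross term vanishes: resampling coordinate [n] leaves the partial sum
    unchanged and integrates [g] to 0. *)
Lemma variance_linstat n :
  P.-integrable setT (EFin \o (fun w => (\sum_(k < n) c k * g (xi k w)) ^+ 2)) /\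
  \int[P]_w (\sum_(k < n) c k * g (xi k w)) ^+ 2 =
    (\sum_(k < n) c k ^+ 2) * \int[N]_x (g x ^+ 2).
Proof.
have mg2 : measurable_fun setT (fun x => g x ^+ 2) by exact: measurable_funX.
elim: n => [|n [IHi IHe]].
  rewrite big_ord0 mul0r; split.
    under eq_fun do rewrite big_ord0 expr0n/=.
    exact: finite_measure_integrable_cst.
  under eq_Rintegral do rewrite big_ord0 expr0n/=.
  by rewrite Rintegral_cst// mul0r.
pose S w := \sum_(k < n) c k * g (xi k w).
have mS : measurable_fun setT S.
  exact: (measurableT_comp (measurable_linstat n) (measurable_noise xi)).
have [i2 e2] := integral_xi n mg2 ig2.
have mgn : measurable_fun setT (fun w => g (xi n w)) by exact: measurableT_comp.
have ix : P.-integrable setT (EFin \o (fun w => S w * g (xi n w))).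
  apply: (le_integrable measurableT _ _ (integrableD measurableT IHi i2)).
    by apply/measurable_EFinP; exact: measurable_funM.
  move=> w _ /=; rewrite lee_fin -/(S w) normrM [leRHS]ger0_norm ?addr_ge0 ?sqr_ge0//.
  rewrite -(real_normK (num_real (S w))) -(real_normK (num_real (g _))).
  by have := sqr_ge0 (`|S w| - `|g (xi n w)|);
     have := sqr_ge0 (`|S w| + `|g (xi n w)|); lra.
have ex : \int[P]_w (S w * g (xi n w)) = 0.
  rewrite /Rintegral.
  have -> // := @integral_resample_eq0 _ _ _ _ _ Hxi n
    (fun y => (\sum_(k < n) c k * g (y k)) * g (y n)).
  - apply: measurable_funM; first exact: measurable_linstat.
    exact: (measurableT_comp mg (measurable_coord _)).
  - move=> y; set C := \sum_(k < n) c k * g (y k).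
    have E x : (\sum_(k < n) c k * g (upd n x y k)) * g (upd n x y n) = C * g x.
      rewrite {2}/upd eqxx; congr (_ * _); apply: eq_bigr => k _.
      by rewrite /upd ltn_eqF.
    split; first by under eq_fun do rewrite E; exact: (integrableZl measurableT C ig).
    under eq_integral do rewrite E.
    have := RintegralZl C measurableT ig; rewrite g0 mulr0.
    rewrite /Rintegral => H; rewrite -[LHS]fineK ?H//.
    by apply: integrable_fin_num => //; exact: (integrableZl measurableT C ig).
have SE w : (\sum_(k < n.+1) c k * g (xi k w)) ^+ 2 =
    S w ^+ 2 + (2 * c n * (S w * g (xi n w)) + c n ^+ 2 * g (xi n w) ^+ 2).
  by rewrite big_ord_recr/= -/(S w); ring.
have i3 : P.-integrable setT (EFin \o (fun w => 2 * c n * (S w * g (xi n w)))).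
  exact: (integrableZl measurableT _ ix).
have i4 : P.-integrable setT (EFin \o (fun w => c n ^+ 2 * g (xi n w) ^+ 2)).
  exact: (integrableZl measurableT _ i2).
have i5 := integrableD measurableT i3 i4.
split.
  under eq_fun do rewrite SE; exact: (integrableD measurableT IHi i5).
under eq_Rintegral do rewrite SE.
rewrite RintegralD// RintegralD// !RintegralZl// ex mulr0 add0r IHe e2.
by rewrite big_ord_recr/=; ring.
Qed.

End linear_statistic.

Definition chi2stat (c : nat -> R) n (y : nat -> R) : R :=
  \sum_(k < n) c k * (y k ^+ 2 - 1).

Lemma measurable_chi2stat c n :
  measurable_fun [set: observations R] (chi2stat c n : observations R -> R).
Proof.
apply: (@measurable_linstat (fun x : R => x ^+ 2 - 1)).
by apply: measurable_funB => //; exact: measurable_funX.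
Qed.

Let mX m : measurable_fun setT (fun x : R => x ^+ m).
Proof. exact: measurable_funX. Qed.

Let mean_sub1 (f : R -> R) a : N.-integrable setT (EFin \o f) -> \int[N]_x f x = a ->
  N.-integrable setT (EFin \o (fun x => f x - a)) /\ \int[N]_x (f x - a) = 0.
Proof.
move=> iF Ef.
have ia : N.-integrable setT (EFin \o (fun=> a)) by exact: finite_measure_integrable_cst.
split; first exact: (integrableB measurableT iF ia).
by rewrite RintegralB// Ef Rintegral_cst//= probability_setT mulr1 subrr.
Qed.

Let int_var m a : \int[N]_x (x ^+ m) = a ->
  N.-integrable setT (EFin \o (fun x => (x ^+ m - a) ^+ 2)) /\
  \int[N]_x ((x ^+ m - a) ^+ 2) = \int[N]_x (x ^+ (m + m)) - a ^+ 2.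
Proof.
move=> Em.
have E (x : R) : (x ^+ m - a) ^+ 2 = x ^+ (m + m) + (- 2 * a * x ^+ m + a ^+ 2).
  by rewrite exprD; ring.
have i1 := @normal_integrable_exprX R (m + m).
have i2 : N.-integrable setT (EFin \o (fun x => - 2 * a * x ^+ m)).
  exact: (integrableZl measurableT _ (normal_integrable_exprX m)).
have i3 : N.-integrable setT (EFin \o (fun=> a ^+ 2)) by exact: finite_measure_integrable_cst.
have i4 := integrableD measurableT i2 i3.
split; first by under eq_fun do rewrite E; exact: (integrableD measurableT i1 i4).
under eq_Rintegral do rewrite E.
rewrite RintegralD// RintegralD// RintegralZl ?normal_integrable_exprX// Em.
by rewrite Rintegral_cst//= probability_setT mulr1; ring.
Qed.

Lemma chi2stat_moment2 c n :
  P.-integrable setT (EFin \o (fun w => chi2stat c n (noise w) ^+ 2)) /\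
  \int[P]_w (chi2stat c n (noise w) ^+ 2) = 2 * \sum_(k < n) c k ^+ 2.
Proof.
have [i1 e1] := mean_sub1 (normal_integrable_exprX 2) (@normal_moment2 R).
have [i2 e2] := int_var (@normal_moment2 R).
have mg : measurable_fun setT (fun x : R => x ^+ 2 - 1) by exact: measurable_funB.
have [iv ev] := variance_linstat c mg i1 i2 e1 n.
split => //; rewrite ev e2 normal_moment4; ring.
Qed.

(** The constant is the variance of the fourth power of a standard normal variable,
    [105 - 3 ^+ 2 = 96]. *)
Lemma quartic_moment2 (c : nat -> R) n :
  P.-integrable setT (EFin \o (fun w => (\sum_(k < n) c k * (xi k w ^+ 4 - 3)) ^+ 2)) /\
  \int[P]_w ((\sum_(k < n) c k * (xi k w ^+ 4 - 3)) ^+ 2) = 96 * \sum_(k < n) c k ^+ 2.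
Proof.
have [i1 e1] := mean_sub1 (normal_integrable_exprX 4) (@normal_moment4 R).
have [i2 e2] := int_var (@normal_moment4 R).
have mg : measurable_fun setT (fun x : R => x ^+ 4 - 3) by exact: measurable_funB.
have [iv ev] := variance_linstat c mg i1 i2 e1 n.
split => //; rewrite ev e2 normal_moment8; ring.
Qed.

Lemma linear_moment2 (c : nat -> R) n :
  P.-integrable setT (EFin \o (fun w => (\sum_(k < n) c k * xi k w) ^+ 2)) /\
  \int[P]_w ((\sum_(k < n) c k * xi k w) ^+ 2) = \sum_(k < n) c k ^+ 2.
Proof.
have mg : measurable_fun setT (fun x : R => x) by [].
have [iv ev] := variance_linstat c mg (normal_integrable_exprX 1)
  (normal_integrable_exprX 2) (@normal_moment1 R) n.
by split => //; rewrite ev normal_moment2 mulr1.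
Qed.

(** * Stein's method for weighted sums of centred squares *)

Section stein_bound.
Variables (h : R -> R) (b : R).
Hypotheses (hcont : continuous h) (h0b : forall x, 0 <= h x <= b).
Variables (c : nat -> R) (n : nat) (c0 : R).
Hypotheses (sumc : \sum_(k < n) c k ^+ 2 = 2^-1)
  (cc0 : forall k, (k < n)%N -> 0 <= c k <= c0).

Let t (y : observations R) : R := chi2stat c n y.

(* Stein's identity in the coordinate [k] makes the mean of [stein_term] zero.
   Summed over [k], it is [t F(t) - F'(t)] up to
   [2 F'(t) \sum_k c k ^+ 2 * (y k ^+ 2 - 1)], whose mean is at most of order
   [\max_k c k] because the variance of the inner sum is [2 \sum_k c k ^+ 4]. *)
Let stein_term (F F' : R -> R) k (y : observations R) : R :=
  c k * ((y k ^+ 2 - 1) * F (t y)) - 2 * c k ^+ 2 * (y k ^+ 2 * F' (t y)).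

Let stein_term_integral (F F' : R -> R) (K : R) k : (k < n)%N ->
  (forall x : R, is_derive x 1 F (F' x)) -> continuous F' ->
  (forall x, `|F x| <= K) -> (forall x, `|F' x| <= 2 * b) ->
  P.-integrable setT (EFin \o (fun w => stein_term F F' k (noise w))) /\
  \int[P]_w stein_term F F' k (noise w) = 0.
Proof.
move=> kn dF cF' FK F'b.
have K0 : 0 <= K by exact: le_trans (FK 0).
have b0 : 0 <= b by have := le_trans (normr_ge0 _) (F'b 0); lra.
have cF : continuous F.
  by move=> x; apply: differentiable_continuous; apply/derivable1_diffP; case: (dF x).
have mF : measurable_fun setT F by exact: continuous_measurable_fun.
have mF' : measurable_fun setT F' by exact: continuous_measurable_fun.
have mt : measurable_fun [set: observations R] t by exact: measurable_chi2stat.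
have my2 : measurable_fun [set: observations R] (fun y : observations R => y k ^+ 2).
  by apply: (measurableT_comp (mX 2)); exact: measurable_coord.
have mG : measurable_fun [set: observations R] (stein_term F F' k).
  apply: measurable_funB; apply: measurable_funM => //; apply: measurable_funM => //.
  - exact: measurable_funB.
  - exact: measurableT_comp.
  - exact: measurableT_comp.
have iG : P.-integrable setT (EFin \o (fun w => stein_term F F' k (noise w))).
  pose A := `|c k| * K + 4 * c k ^+ 2 * b.
  have [i2 _] := integral_xi k (mX 2) (normal_integrable_exprX 2).
  have i1 : P.-integrable setT (EFin \o (fun=> A)) by exact: finite_measure_integrable_cst.
  have i3 : P.-integrable setT (EFin \o (fun w => A * xi k w ^+ 2)).
    exact: (integrableZl measurableT _ i2).
  apply: (le_integrable measurableT _ _ (integrableD measurableT i3 i1)).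
    by apply/measurable_EFinP; exact: (measurableT_comp mG (measurable_noise xi)).
  move=> w _ /=; rewrite lee_fin.
  have x20 := sqr_ge0 (xi k w); have ck20 := sqr_ge0 (c k).
  have A0 : 0 <= A by rewrite /A; apply: addr_ge0; do ?apply: mulr_ge0 => //.
  rewrite [leRHS]ger0_norm; last by rewrite addr_ge0// mulr_ge0.
  rewrite /stein_term (le_trans (ler_normB _ _))// !normrM.
  rewrite -!expr2 !real_normK ?num_real// (ger0_norm (ler0n _ 2)).
  apply: (@le_trans _ _ (`|c k| * ((xi k w ^+ 2 + 1) * K) + 2 * c k ^+ 2 * (xi k w ^+ 2 * (2 * b)))).
    apply: lerD.
      apply: ler_wpM2l => //; apply: ler_pM => //; rewrite (le_trans (ler_normB _ _))//.
      by rewrite normr1 (ger0_norm x20).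
    apply: ler_wpM2l; first exact: mulr_ge0.
    exact: ler_wpM2l.
  rewrite /A; have := mulr_ge0 ck20 b0; lra.
split => //; rewrite /Rintegral.
have -> // := @integral_resample_eq0 _ _ _ _ _ Hxi k (stein_term F F' k) mG iG.
move=> y; pose C := \sum_(j < n | j != Ordinal kn) c j * (y j ^+ 2 - 1).
pose p x := c k * (x ^+ 2 - 1) + C.
have tE x : t (upd k x y) = p x.
  rewrite /t /chi2stat (bigD1 (Ordinal kn))//= /p /upd eqxx; congr (_ + _).
  by apply: eq_bigr => j jk; rewrite ifN.
(* With the other coordinates frozen in [C], the integrand of Stein's identity for this [g] is
   [stein_term] up to the factor [- c k]. *)
pose g x := x * F (p x).
pose g' x := F (p x) + 2 * c k * (x ^+ 2 * F' (p x)).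
have dp (x : R) : is_derive x 1 p (2 * c k * x).
  by apply: is_derive_eq; rewrite /GRing.scale/=; ring.
have dg (x : R) : is_derive x 1 g (g' x).
  have dFp : is_derive x 1 (F \o p) (2 * c k * x * F' (p x)).
    by have := dp x => ?; have := dF (p x) => ?; apply: is_derive_eq (is_derive1_comp _ _) _; rewrite mulrC.
  have -> : g = (id : R -> R) * (F \o p) by [].
  by apply: is_derive_eq; rewrite /GRing.scale/= /g'; ring.
have cp : continuous p.
  by move=> x; apply: differentiable_continuous; apply/derivable1_diffP; case: (dp x).
have cg' : continuous g'.
  move=> x; apply: cvgD; first by apply: continuous_comp; [exact: cp|exact: cF].
  apply: cvgM; first exact: cvg_cst.
  apply: cvgM; first exact: exprn_continuous.
  by apply: continuous_comp; [exact: cp|exact: cF'].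
pose A := K + 4 * `|c k| * b.
have gA x : `|g x| <= A * (1 + x ^+ 2) ^+ 1.
  rewrite expr1 normrM; apply: (@le_trans _ _ ((1 + x ^+ 2) * K)).
    apply: ler_pM => //; have := abs_exprX_le 1 x; rewrite expr1 mul1r //.
  by rewrite mulrC ler_wpM2r ?addr_ge0 ?sqr_ge0// lerDl !mulr_ge0.
have g'A x : `|g' x| <= A * (1 + x ^+ 2) ^+ 1.
  have x20 := sqr_ge0 x.
  rewrite expr1 (le_trans (ler_normD _ _))// !normrM -!expr2 real_normK ?num_real// (ger0_norm (ler0n _ 2)).
  apply: (@le_trans _ _ (K + 2 * `|c k| * (x ^+ 2 * (2 * b)))).
    by apply: lerD => //; rewrite ler_wpM2l ?mulr_ge0// ler_wpM2l.
  have := mulr_ge0 (normr_ge0 (c k)) b0; have := mulr_ge0 K0 x20; rewrite /A; lra.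
have [iN eN] := normal_ibp dg cg' gA g'A.
have GE x : stein_term F F' k (upd k x y) = - c k * (g' x - x * g x).
  rewrite /stein_term tE /upd eqxx /g' /g; ring.
split; first by under eq_fun do rewrite GE; exact: (integrableZl measurableT _ iN).
under eq_integral do rewrite GE EFinM.
by rewrite integralZl// eN mule0.
Qed.

(** The constant is the product of [|F'| <= 2 b] and [E|D| <= 2 c0], where [D] is the sum of the
    [2 c k ^+ 2 * (y k ^+ 2 - 1)]; its second moment is [8 \sum_k c k ^+ 4 <= 4 c0 ^+ 2]. *)
Lemma stein_bound : `|\int[P]_w h (t (noise w)) - \int[N]_x h x| <= 4 * b * c0.
Proof.
have [K [F [F' [dF cF' FE FK F'b]]]] := stein_solution hcont h0b.
have b0 : 0 <= b by have := le_trans (normr_ge0 _) (F'b 0); lra.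
have c00 : 0 < c0.
  rewrite ltNge; apply/negP => c00.
  have : \sum_(k < n) c k ^+ 2 = 0.
    apply: big1 => k _; have /andP[h1 h2] := cc0 (ltn_ord k).
    by rewrite (_ : c k = 0) ?expr0n//; apply/eqP; rewrite eq_le h1 (le_trans h2).
  by rewrite sumc => /eqP; rewrite invr_eq0 pnatr_eq0.
have [iS eS] : P.-integrable setT (EFin \o (fun w => \sum_(k < n) stein_term F F' k (noise w))) /\
    \int[P]_w \sum_(k < n) stein_term F F' k (noise w) = 0.
  (* The induction runs over the number of summands, while the statistic [t] inside [stein_term]
     keeps all its [n] coordinates. *)
  have : (n <= n)%N by [].
  elim: {-2}n => [_|j IH jn].
    split.
      under eq_fun do rewrite big_ord0; exact: finite_measure_integrable_cst.
    by under eq_Rintegral do rewrite big_ord0; rewrite Rintegral_cst// mul0r.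
  have [i1 e1] := IH (ltnW jn).
  have [i2 e2] := stein_term_integral jn dF cF' FK F'b.
  split.
    under eq_fun do rewrite big_ord_recr/=; exact: (integrableD measurableT i1 i2).
  under eq_Rintegral do rewrite big_ord_recr/=.
  by rewrite RintegralD// e1 e2 addr0.
pose D (y : observations R) := chi2stat (fun k => 2 * c k ^+ 2) n y.
have mD : measurable_fun setT (fun w => D (noise w)).
  exact: (measurableT_comp (measurable_chi2stat _ _) (measurable_noise xi)).
have [iD2 eD2] := chi2stat_moment2 (fun k => 2 * c k ^+ 2) n.
have [iD eD] : P.-integrable setT (EFin \o (fun w => D (noise w))) /\
    \int[P]_w `|D (noise w)| <= 2 * c0.
  apply: (integral_abs_le mD _ iD2); first by rewrite mulr_gt0.
  rewrite eD2; apply: (@le_trans _ _ (2 * (4 * c0 ^+ 2 * \sum_(k < n) c k ^+ 2))).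
    rewrite ler_pM2l// mulr_sumr; apply: ler_sum => k _.
    have /andP[h1 h2] := cc0 (ltn_ord k).
    rewrite exprMn -exprM [leLHS](_ : _ = 4 * c k ^+ 2 * c k ^+ 2); last by rewrite (exprD _ 2 2); ring.
    rewrite ler_wpM2r ?sqr_ge0// ler_pM2l// lerXn2r ?nnegrE//; exact: le_trans h2.
  by rewrite sumc le_eqVlt; apply/orP; left; apply/eqP; field.
have mt : measurable_fun setT (fun w => t (noise w)).
  exact: (measurableT_comp (measurable_chi2stat _ _) (measurable_noise xi)).
have ih : P.-integrable setT (EFin \o (fun w => h (t (noise w)))).
  have ib : P.-integrable setT (EFin \o (fun=> b)) by exact: finite_measure_integrable_cst.
  apply: (le_integrable measurableT _ _ ib).
    apply/measurable_EFinP; apply: measurableT_comp mt.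
    exact: continuous_measurable_fun.
  move=> w _ /=; have /andP[h1 h2] := h0b (t (noise w)).
  by rewrite lee_fin !ger0_norm// (le_trans h1).
set m := \int[N]_x h x.
have im : P.-integrable setT (EFin \o (fun=> m)) by exact: finite_measure_integrable_cst.
(* As [\sum_k 2 c k ^+ 2 = 1], the Stein terms add up to [t F(t) - (D + 1) F'(t)]; Stein's equation
   cancels everything but [D F'(t)]. *)
have key w : h (t (noise w)) - m + \sum_(k < n) stein_term F F' k (noise w) =
    - (D (noise w) * F' (t (noise w))).
  have -> : \sum_(k < n) stein_term F F' k (noise w) =
      t (noise w) * F (t (noise w)) - (D (noise w) + 1) * F' (t (noise w)).
    rewrite sumrB; congr (_ - _).
      by rewrite mulr_suml; apply: eq_bigr => k _; rewrite mulrA.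
    have -> : D (noise w) + 1 = \sum_(k < n) 2 * c k ^+ 2 * xi k w ^+ 2.
      rewrite [X in _ + X](_ : 1 = \sum_(k < n) 2 * c k ^+ 2); last first.
        by rewrite -mulr_sumr sumc divff.
      by rewrite /D /chi2stat -big_split/=; apply: eq_bigr => k _; rewrite /noise; ring.
    by rewrite mulr_suml; apply: eq_bigr => k _; rewrite mulrA.
  by rewrite -FE; ring.
have i1 : P.-integrable setT (EFin \o (fun w => h (t (noise w)) - m)).
  exact: (integrableB measurableT ih im).
have i2 : P.-integrable setT (EFin \o (fun w => h (t (noise w)) - m +
    \sum_(k < n) stein_term F F' k (noise w))).
  exact: (integrableD measurableT i1 iS).
have -> : \int[P]_w h (t (noise w)) - m = \int[P]_w (h (t (noise w)) - m +
    \sum_(k < n) stein_term F F' k (noise w)).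
  rewrite RintegralD// eS addr0 RintegralB// Rintegral_cst//= probability_setT.
  by rewrite mulr1.
have i3 : P.-integrable setT (EFin \o (fun w => 2 * b * `|D (noise w)|)).
  exact: (integrableZl measurableT _ (integrable_norm iD)).
apply: (le_trans (le_normr_Rintegral measurableT i2)).
apply: (@le_trans _ _ (\int[P]_w (2 * b * `|D (noise w)|))).
  apply: le_Rintegral => //; first exact: (integrable_norm i2).
  move=> w _; rewrite key normrN normrM mulrC; exact: ler_wpM2r.
rewrite RintegralZl//; last exact: (integrable_norm iD).
apply: (@le_trans _ _ (2 * b * (2 * c0))); last by lra.
by rewrite ler_wpM2l// mulr_ge0.
Qed.

End stein_bound.

End iid.

(** * The extreme problem *)

Section series.
Context {R : realType}.
Implicit Types f g p : nat -> R.

Definition nnsum f : \bar R := (\sum_(0 <= k <oo) (f k)%:E)%E.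

Lemma nnsum_ge0 f : (forall k, 0 <= f k) -> (0 <= nnsum f)%E.
Proof. by move=> f0; apply: nneseries_ge0 => k _ _; rewrite lee_fin. Qed.

Lemma nnsum_lin f g x y : (forall k, 0 <= f k) -> (forall k, 0 <= g k) ->
  0 <= x -> 0 <= y ->
  nnsum (fun k => x * f k + y * g k) = (x%:E * nnsum f + y%:E * nnsum g)%E.
Proof.
move=> f0 g0 x0 y0; rewrite /nnsum -!nneseriesZl; last 2 first.
- by move=> k _; rewrite lee_fin.
- by move=> k _; rewrite lee_fin.
rewrite -nneseriesD//.
- by move=> k _ _; rewrite -EFinM lee_fin mulr_ge0.
- by move=> k _ _; rewrite -EFinM lee_fin mulr_ge0.
Qed.

Lemma nnsum_split n f : (forall k, 0 <= f k) ->
  nnsum f = ((\sum_(0 <= k < n) f k)%:E + \sum_(n <= k <oo) (f k)%:E)%E.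
Proof.
move=> f0; rewrite /nnsum (nneseries_split 0 n) ?add0n; last by move=> k _; rewrite lee_fin.
by rewrite sumEFin.
Qed.

Lemma nnsum_finite n f : (forall k, 0 <= f k) -> (forall k, (n <= k)%N -> f k = 0) ->
  nnsum f = (\sum_(0 <= k < n) f k)%:E.
Proof.
move=> f0 fn; rewrite (nnsum_split n f0) eseries0 ?adde0// => k nk _.
by rewrite fn.
Qed.

(** [p] may take negative values; being finitely supported, it contributes a real number, and no
    difference of infinite series appears. *)
Lemma nnsum_perturb n f p : (forall k, 0 <= f k) -> (forall k, 0 <= f k + p k) ->
  (forall k, (n <= k)%N -> p k = 0) ->
  nnsum (fun k => f k + p k) = (nnsum f + (\sum_(0 <= k < n) p k)%:E)%E.
Proof.
move=> f0 fp0 pn; rewrite (nnsum_split n f0) (nnsum_split n fp0) big_split/= EFinD.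
rewrite -!addeA; congr (_ + _)%E; rewrite addeC; congr (_ + _)%E.
apply: congr_lim; apply/funext => N; apply: eq_big_nat => k /andP[nk _].
by rewrite pn ?addr0.
Qed.

Lemma le_nnsum f k : (forall k, 0 <= f k) -> ((f k)%:E <= nnsum f)%E.
Proof.
move=> f0; rewrite (nnsum_split k.+1 f0) big_nat_recr//=.
apply: (@le_trans _ _ ((\sum_(0 <= i < k) f i + f k)%:E)).
  by rewrite lee_fin lerDr sumr_ge0.
by rewrite leeDl//; apply: nneseries_ge0 => i _ _; rewrite lee_fin.
Qed.

Lemma nnsum_mul_fin f g : (forall k, 0 <= f k) -> (forall k, 0 <= g k) ->
  (nnsum f < +oo)%E -> (nnsum g < +oo)%E -> (nnsum (fun k => f k * g k)%R < +oo)%E.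
Proof.
move=> f0 g0 foo goo.
have [S SE] : exists S, nnsum f = S%:E.
  by exists (fine (nnsum f)); rewrite fineK// ge0_fin_numE// nnsum_ge0.
have fS k : f k <= S by rewrite -lee_fin -SE le_nnsum.
have S0 : 0 <= S by apply: le_trans (fS 0%N).
apply: (@le_lt_trans _ _ (S%:E * nnsum g)%E).
  rewrite /nnsum -nneseriesZl; last by move=> k _; rewrite lee_fin.
  apply: lee_nneseries => [k _ _|k _]; first by rewrite lee_fin mulr_ge0.
  by rewrite -EFinM lee_fin ler_wpM2r.
by rewrite lte_mul_pinfty// lee_fin.
Qed.

Lemma sum_pick n j (f : nat -> R) : (j < n)%N ->
  \sum_(0 <= k < n) f k * (k == j)%:R = f j.
Proof.
move=> jn; rewrite (bigD1_seq j) ?mem_index_iota ?iota_uniq//= eqxx mulr1.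
by rewrite big1 ?addr0// => k /negbTE ->; rewrite mulr0.
Qed.

End series.

(** * First-order condition and support of the extreme sequence *)

Section extreme.
Context {R : realType}.
Variables (a s : nat -> R) (r : R).
Hypotheses (Ha_gt0 : forall k, 0 < a k) (Ha : a @ \oo --> +oo)
    (Hs_gt0 : forall k, 0 < s k) (Hs : s @ \oo --> +oo).

Lemma Theta2rP eta : Theta2r a s r eta <->
  [/\ (nnsum (fun k => eta k ^+ 2)%R < +oo)%E,
      (nnsum (fun k => (a k * s k) ^+ 2 * eta k ^+ 2)%R <= 1)%E &
      ((r ^+ 2)%:E <= nnsum (fun k => s k ^+ 2 * eta k ^+ 2)%R)%E].
Proof.
have E1 : sqsum (fun k => a k * s k * eta k) = nnsum (fun k => (a k * s k) ^+ 2 * eta k ^+ 2).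
  by apply: eq_eseriesr => k _; rewrite exprMn.
have E2 : sqsum (fun k => s k * eta k) = nnsum (fun k => s k ^+ 2 * eta k ^+ 2).
  by apply: eq_eseriesr => k _; rewrite exprMn.
rewrite /Theta2r /Theta2 /ell2 /= E1 E2; split; first by move=> [[]].
by move=> [].
Qed.

(** Consequently every choice of signs on the extreme sequence is again an alternative. *)
Lemma eq_sqr_Theta2r eta eta' : (forall k, eta k ^+ 2 = eta' k ^+ 2) ->
  Theta2r a s r eta -> Theta2r a s r eta'.
Proof.
move=> E /Theta2rP H; apply/Theta2rP.
have E' (f : nat -> R) : (fun k => f k * eta' k ^+ 2) = (fun k => f k * eta k ^+ 2).
  by apply/funext => k; rewrite E.
have E1 : (fun k => eta' k ^+ 2) = (fun k => eta k ^+ 2) by apply/funext => k; rewrite E.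
by rewrite E1 !E'.
Qed.

Lemma quartsumE (eta : nat -> R) : quartsum eta = nnsum (fun k => eta k ^+ 2 * eta k ^+ 2).
Proof. by apply: eq_eseriesr => k _; rewrite -exprD. Qed.

Let fin_nnsum (f : nat -> R) : (forall k, 0 <= f k) -> (nnsum f < +oo)%E ->
  nnsum f = (fine (nnsum f))%:E.
Proof. by move=> f0 foo; rewrite fineK// ge0_fin_numE// nnsum_ge0. Qed.

Variable teta : nat -> R.
Hypothesis Hteta : extreme_sequence a s r teta.

Let v k := teta k ^+ 2.
Let v0 k : 0 <= v k. Proof. exact: sqr_ge0. Qed.

Let tetaT : Theta2r a s r teta. Proof. by case: Hteta. Qed.

Let quart_le eta : Theta2r a s r eta -> (nnsum (fun k => v k * v k)%R <= quartsum eta)%E.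
Proof.
by move=> etaT; rewrite -quartsumE Hteta.2; apply: ereal_inf_lbound; exists eta.
Qed.

(** On the segment from [v] to [z] the functional equals [Q - 2 t (Q - S) + t ^+ 2 B]; if [S < Q], a
    small [t] would bring it below its minimum [Q]. *)
Lemma extreme_variational eta : Theta2r a s r eta ->
  (nnsum (fun k => teta k ^+ 2 * teta k ^+ 2)%R <= nnsum (fun k => teta k ^+ 2 * eta k ^+ 2)%R)%E.
Proof.
move=> etaT; pose z k := eta k ^+ 2.
have z0 k : 0 <= z k by exact: sqr_ge0.
have [v1 v2 v3] := (Theta2rP teta).1 tetaT.
have [z1 z2 z3] := (Theta2rP eta).1 etaT.
have QE := fin_nnsum (fun k => mulr_ge0 (v0 k) (v0 k)) (nnsum_mul_fin v0 v0 v1 v1).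
have SE := fin_nnsum (fun k => mulr_ge0 (v0 k) (z0 k)) (nnsum_mul_fin v0 z0 v1 z1).
have WE := fin_nnsum (fun k => mulr_ge0 (z0 k) (z0 k)) (nnsum_mul_fin z0 z0 z1 z1).
rewrite -/v -/z [leLHS]QE [leRHS]SE lee_fin.
set Q := fine _ in QE *; set S := fine _ in SE *; set W := fine _ in WE.
rewrite leNgt; apply/negP => SQ.
pose B := Q - 2 * S + W.
have B1 : 0 < `|B| + 1 by rewrite ltr_wpDl.
(* The second cap keeps [t ^+ 2 B] at most [t (Q - S)], half of the first-order gain, with [+ 1]
   guarding against [B = 0]; the cap 1/2 keeps the point on the segment. *)
pose t := Num.min 2^-1 ((Q - S) / (`|B| + 1)).
have t0 : 0 < t by rewrite lt_min invr_gt0 ltr0n/= divr_gt0// subr_gt0.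
have t1 : t <= 2^-1 by rewrite ge_min lexx.
have t2 : t * (`|B| + 1) <= Q - S by rewrite -ler_pdivlMr// ge_min lexx orbT.
have ct0 : 0 <= 1 - t by lra.
pose x k := (1 - t) * v k + t * z k.
have x0 k : 0 <= x k by rewrite addr_ge0// mulr_ge0// ltW.
pose zeta k := Num.sqrt (x k).
have zetaE k : zeta k ^+ 2 = x k by rewrite sqr_sqrtr.
have lin (b : nat -> R) : (forall k, 0 <= b k) ->
    nnsum (fun k => b k * zeta k ^+ 2) =
    ((1 - t)%:E * nnsum (fun k => b k * v k)%R + t%:E * nnsum (fun k => b k * z k)%R)%E.
  move=> b0; rewrite -nnsum_lin//; first last.
  - by rewrite ltW.
  - by move=> k; rewrite mulr_ge0.
  - by move=> k; rewrite mulr_ge0.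
  by congr nnsum; apply/funext => k; rewrite zetaE /x; ring.
have zetaT : Theta2r a s r zeta.
  apply/Theta2rP; split.
  - have := lin (fun=> 1) (fun=> ler01).
    under [X in nnsum X]eq_fun do rewrite mul1r.
    under [X in (_ * nnsum X + _)%E]eq_fun do rewrite mul1r.
    under [X in (_ + _ * nnsum X)%E]eq_fun do rewrite mul1r.
    by move=> ->; rewrite lte_add_pinfty// lte_mul_pinfty// ?lee_fin// ltW.
  - rewrite (lin (fun k => (a k * s k) ^+ 2)); last by move=> k; exact: sqr_ge0.
    have -> : 1%E = ((1 - t)%:E * 1 + t%:E * 1)%E :> \bar R.
      by rewrite !mule1 -EFinD subrK.
    by apply: leeD; apply: lee_wpmul2l => //; rewrite lee_fin// ltW.
  - rewrite (lin (fun k => s k ^+ 2)); last by move=> k; exact: sqr_ge0.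
    have -> : (r ^+ 2)%:E = ((1 - t)%:E * (r ^+ 2)%:E + t%:E * (r ^+ 2)%:E)%E.
      by rewrite -!EFinM -EFinD; congr EFin; ring.
    by apply: leeD; apply: lee_wpmul2l => //; rewrite lee_fin// ltW.
have := quart_le zetaT; rewrite quartsumE QE.
rewrite (lin (fun k => zeta k ^+ 2)); last by move=> k; exact: sqr_ge0.
have -> : nnsum (fun k => zeta k ^+ 2 * v k) = ((1 - t) * Q + t * S)%:E.
  rewrite (_ : (fun k => _) = (fun k => v k * zeta k ^+ 2)); last first.
    by apply/funext => k; rewrite mulrC.
  by rewrite (lin v)// QE SE -!EFinM -EFinD.
have -> : nnsum (fun k => zeta k ^+ 2 * z k) = ((1 - t) * S + t * W)%:E.
  rewrite (_ : (fun k => _) = (fun k => z k * zeta k ^+ 2)); last first.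
    by apply/funext => k; rewrite mulrC.
  have SE' : nnsum (fun k => z k * v k) = S%:E.
    by rewrite -SE; congr nnsum; apply/funext => k; rewrite mulrC.
  by rewrite (lin z)// SE' WE -!EFinM -EFinD.
rewrite -!EFinM -EFinD lee_fin.
have : t * B <= Q - S.
  by apply: le_trans t2; rewrite ler_pM2l// (le_trans (ler_norm B))// lerDl.
move=> /(ler_wpM2l (ltW t0)); have : 0 < t * (Q - S) by rewrite mulr_gt0// subr_gt0.
rewrite /B; lra.
Qed.

(* With [g k = v k / s k ^+ 2], shifting mass so as to keep both constraints
   tight gives [g j >= (1 - y) * g i + y * g k] whenever [a i < a j < a k] with
   [i], [k] in the support; letting [k] go to infinity along the support makes
   [g j >= g i], against [g j --> 0]. *)
Lemma extreme_finite_support : exists n, forall k, (n <= k)%N -> teta k = 0.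
Proof.
have [v1 v2 v3] := (Theta2rP teta).1 tetaT.
have SE := fin_nnsum v0 v1; set S := fine _ in SE.
have vS k : v k <= S by rewrite -lee_fin -SE; exact: le_nnsum.
apply: contrapT => /forallNP nsupp.
have supp n : exists2 k, (n <= k)%N & teta k != 0.
  by have /existsNP[k /not_implyP[nk /eqP tk]] := nsupp n; exists k.
have [i _ ti] := supp 0%N.
have vi : 0 < v i by rewrite exprn_even_gt0.
have s20 k : 0 < s k ^+ 2 by rewrite exprn_gt0.
pose g k := v k / s k ^+ 2.
have gi : 0 < g i by rewrite divr_gt0.
(* [v] is bounded by its sum while [s ^+ 2] tends to infinity. The summand 1 in the threshold gives
   [s j >= 1], hence [s j <= s j ^+ 2]. *)
have [j aij gj] : exists2 j, a i < a j & g j < g i / 2.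
  have [n1 _ N1] := (cvgryPgt a).1 Ha (a i).
  have [n2 _ N2] := (cvgryPgt s).1 Hs (1 + 2 * S / g i).
  exists (maxn n1 n2); first by apply: N1; exact: leq_maxl.
  have sj : 1 + 2 * S / g i < s (maxn n1 n2) by apply: N2; exact: leq_maxr.
  set j := maxn _ _ in sj *.
  have S0 : 0 <= S by apply: le_trans (vS 0%N).
  have q0 : 0 <= 2 * S / g i by apply: divr_ge0; [exact: mulr_ge0|exact: ltW].
  have sj2 : 2 * S / g i < s j ^+ 2.
    have : s j <= s j ^+ 2 by rewrite expr2 ler_peMl// ltW//; lra.
    lra.
  rewrite [ltLHS]/g ltr_pdivrMr//; move: sj2; rewrite ltr_pdivrMr// => H.
  have := vS j; lra.
pose A k := a k ^+ 2.
have A0 k : 0 < A k by rewrite exprn_gt0.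
have Aij : A i < A j.
  have : 0 < (a j - a i) * (a j + a i) by rewrite mulr_gt0 ?subr_gt0 ?addr_gt0.
  rewrite /A; lra.
(* This far out [y] is at most 1/4, and [g j < g i / 2] already contradicts
   [g j >= (1 - y) * g i + y * g k]; no limit in [k] has to be taken. *)
have [n3 _ N3] := (cvgryPgt a).1 Ha (1 + 4 * A j + A i).
have [k n3k tk] := supp n3.
have Ak : 4 * A j + A i < A k.
  have h : 1 + 4 * A j + A i < a k by exact: N3.
  have a1 : 1 <= a k by have := A0 j; have := A0 i; lra.
  have : a k <= A k by rewrite /A expr2 ler_peMl// ltW.
  lra.
have vk : 0 < v k by rewrite exprn_even_gt0.
(* [A j] is the barycentre [(1 - y) * A i + y * A k]: mass moved to [j] from [i] and [k] in these
   proportions preserves the constraint that involves [a]. *)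
pose y := (A j - A i) / (A k - A i).
have Aki : 0 < A k - A i by have := A0 j; lra.
have y0 : 0 <= y by rewrite divr_ge0// ltW// subr_gt0.
have y1 : y <= 4^-1 by rewrite ler_pdivrMr//; have := A0 j; have := A0 i; lra.
have yE : y * (A k - A i) = A j - A i by rewrite divfK// gt_eqF.
have ij : (i == j) = false by apply/negP => /eqP ij; move: aij; rewrite ij ltxx.
have ik : (i == k) = false by apply/negP => /eqP ik; move: Aki; rewrite ik subrr ltxx.
have jk : (j == k) = false.
  by apply/negP => /eqP jk; move: Ak; rewrite -jk; have := A0 j; have := A0 i; lra.
pose m := (maxn i (maxn j k)).+1.
have im : (i < m)%N by rewrite ltnS leq_maxl.
have jm : (j < m)%N by rewrite ltnS leq_max leq_maxl orbT.
have km : (k < m)%N by rewrite ltnS !leq_max leqnn !orbT.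
(* The amount moved, measured in [s ^+ 2 * v]; the minimum keeps the new squares nonnegative at [i]
   and [k]. *)
pose dl := Num.min (s i ^+ 2 * v i) (s k ^+ 2 * v k).
have dl0 : 0 < dl by rewrite lt_min (mulr_gt0 (s20 i) vi) (mulr_gt0 (s20 k) vk).
have dli : dl <= s i ^+ 2 * v i by rewrite ge_min lexx.
have dlk : dl <= s k ^+ 2 * v k by rewrite ge_min lexx orbT.
pose cj : R := dl / s j ^+ 2; pose ci : R := - ((1 - y) * dl / s i ^+ 2).
pose ck : R := - (y * dl / s k ^+ 2).
pose p (l : nat) : R := cj * (l == j)%:R + ci * (l == i)%:R + ck * (l == k)%:R.
have pn l : (m <= l)%N -> p l = 0.
  move=> ml; rewrite /p (gtn_eqF (leq_trans jm ml)) (gtn_eqF (leq_trans im ml)).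
  by rewrite (gtn_eqF (leq_trans km ml)) !mulr0 !addr0.
have sp (b : nat -> R) : \sum_(0 <= l < m) b l * p l = b j * cj + b i * ci + b k * ck.
  transitivity (\sum_(0 <= l < m) (b l * cj * (l == j)%:R) +
    \sum_(0 <= l < m) (b l * ci * (l == i)%:R) + \sum_(0 <= l < m) (b l * ck * (l == k)%:R)).
    by rewrite -!big_split/=; apply: eq_bigr => l _; rewrite /p; ring.
  by rewrite (sum_pick (fun l => b l * cj))// (sum_pick (fun l => b l * ci))// (sum_pick (fun l => b l * ck)).
have vp0 l : 0 <= v l + p l.
  rewrite /p; have [->|lj] := eqVneq l j.
    rewrite eq_sym ij jk mulr1 !mulr0 !addr0 addr_ge0// divr_ge0// ltW//.
  have [->|li] := eqVneq l i.
    rewrite ik mulr1 !mulr0 add0r addr0 /ci subr_ge0 ler_pdivrMr//.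
    have := ler_wpM2r (ltW dl0) (_ : 1 - y <= 1); rewrite mul1r => /(_ _)/le_trans; apply; first lra.
    by rewrite mulrC.
  have [->|lk] := eqVneq l k.
    rewrite mulr1 !mulr0 !add0r /ck subr_ge0 ler_pdivrMr//.
    have := ler_wpM2r (ltW dl0) (_ : y <= 1); rewrite mul1r => /(_ _)/le_trans; apply; first lra.
    by rewrite mulrC.
  by rewrite !mulr0 !addr0.
pose eta l := Num.sqrt (v l + p l).
have etaE l : eta l ^+ 2 = v l + p l by rewrite sqr_sqrtr.
have pert (b : nat -> R) : (forall l, 0 <= b l) ->
    nnsum (fun l => b l * eta l ^+ 2) =
    (nnsum (fun l => b l * v l)%R + (b j * cj + b i * ci + b k * ck)%:E)%E.
  move=> b0; rewrite -sp -nnsum_perturb.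
  - by congr nnsum; apply/funext => l; rewrite etaE mulrDr.
  - by move=> l; rewrite mulr_ge0.
  - by move=> l; rewrite -mulrDr mulr_ge0.
  - by move=> l ml; rewrite pn// mulr0.
have etaT : Theta2r a s r eta.
  apply/Theta2rP; split.
  - have := pert (fun=> 1) (fun=> ler01).
    under [X in nnsum X]eq_fun do rewrite mul1r.
    under [X in (nnsum X + _)%E]eq_fun do rewrite mul1r.
    by move=> ->; rewrite lte_add_pinfty// ltry.
  - rewrite (pert (fun k => (a k * s k) ^+ 2)); last by move=> l; exact: sqr_ge0.
    rewrite (_ : _ + _ + _ = 0) ?adde0//.
    have -> : 0 = dl * (A j - A i - y * (A k - A i)) by rewrite yE subrr mulr0.
    rewrite /cj /ci /ck /A; field.
    by rewrite !gt_eqF.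
  - rewrite (pert (fun k => s k ^+ 2)); last by move=> l; exact: sqr_ge0.
    rewrite (_ : _ + _ + _ = 0) ?adde0//.
    by rewrite /cj /ci /ck; field; rewrite !gt_eqF.
have := extreme_variational etaT; rewrite (pert v)//.
rewrite (fin_nnsum (fun k => mulr_ge0 (v0 k) (v0 k)) (nnsum_mul_fin v0 v0 v1 v1)).
rewrite -EFinD lee_fin lerDl leNgt => /negP; apply.
rewrite (_ : _ + _ = dl * (g j - (1 - y) * g i - y * g k)); last first.
  by rewrite /cj /ci /ck /g; field; rewrite !gt_eqF.
rewrite pmulr_rlt0//.
have gk : 0 <= y * g k by apply: mulr_ge0 => //; exact: ltW (divr_gt0 vk (s20 k)).
have : y * g i <= 4^-1 * g i by rewrite ler_wpM2r// ltW.
lra.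
Qed.

(** All rests on [Q = 2 * eps ^+ 4 * u ^+ 2]: the weights have normaliser [2 * eps ^+ 2 * u], and
    the first-order condition divided by [2 * eps ^+ 4 * u] is the drift bound. The squared weights
    add up to 1/2, so each weight is at most 1 and [weight0] is a genuine supremum. *)
Lemma extreme_weights (eps : R) (u := extreme_value a s r eps) : 0 < eps -> 0 < u ->
  exists n, [/\ forall k, (n <= k)%N -> teta k = 0,
    forall k, weight teta k = (teta k / eps) ^+ 2 / (2 * u),
    \sum_(k < n) weight teta k ^+ 2 = 2^-1,
    forall k, 0 <= weight teta k <= weight0 teta /\ weight0 teta <= 1 &
    forall eta, Theta2r a s r eta ->
      u <= \sum_(k < n) weight teta k * (eta k / eps) ^+ 2].
Proof.
move=> eps0 u0; have [n tn] := extreme_finite_support; exists n.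
pose Q := \sum_(k < n) teta k ^+ 2 * teta k ^+ 2.
have QE : quartsum teta = Q%:E.
  rewrite quartsumE (nnsum_finite (n := n)) ?big_mkord// => k.
    by rewrite mulr_ge0// sqr_ge0.
  by move=> nk; rewrite tn// expr0n mul0r.
have Q0 : 0 <= Q by apply: sumr_ge0 => k _; rewrite mulr_ge0// sqr_ge0.
have eps4 : 0 < eps ^+ 4 by rewrite exprn_gt0.
have uQ : Q = 2 * eps ^+ 4 * u ^+ 2.
  rewrite /u /extreme_value -Hteta.2 QE /= sqr_sqrtr.
    by rewrite mulrA divff ?mul1r// mulf_neq0// gt_eqF.
  by rewrite mulr_ge0// invr_ge0 mulr_ge0// ltW.
have wE k : weight teta k = (teta k / eps) ^+ 2 / (2 * u).
  rewrite /weight QE/= uQ.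
  have -> : 2 * (2 * eps ^+ 4 * u ^+ 2) = (2 * eps ^+ 2 * u) ^+ 2 by ring.
  rewrite sqrtr_sqr ger0_norm; last by rewrite !mulr_ge0 ?sqr_ge0// ltW.
  by field; rewrite !gt_eqF.
have w0 k : 0 <= weight teta k.
  by rewrite wE divr_ge0 ?sqr_ge0// mulr_ge0// ltW.
have sw : \sum_(k < n) weight teta k ^+ 2 = 2^-1.
  transitivity ((4 * eps ^+ 4 * u ^+ 2)^-1 * Q).
    rewrite mulr_sumr; apply: eq_bigr => k _; rewrite wE.
    by field; rewrite !gt_eqF.
  by rewrite uQ; field; rewrite !gt_eqF.
have w1 k : weight teta k <= 1.
  have [kn|nk] := ltnP k n; last first.
    by rewrite wE tn// mul0r expr0n mul0r.
  have : weight teta k ^+ 2 <= 2^-1.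
    rewrite -sw (bigD1 (Ordinal kn))//= lerDl sumr_ge0// => j _; exact: sqr_ge0.
  move=> H; rewrite leNgt; apply/negP => w1.
  have : 1 < weight teta k ^+ 2 by rewrite exprn_egt1.
  lra.
have ub : has_ubound (range (weight teta)) by exists 1 => _ [k _ <-].
split => //.
- move=> k; split; last by apply: ge_sup; [exists (weight teta 0%N); exists 0%N|move=> _ [j _ <-]].
  by rewrite w0; apply: ub_le_sup => //; exists k.
- move=> eta etaT.
  have := extreme_variational etaT; rewrite -quartsumE QE (nnsum_finite (n := n)).
  + rewrite big_mkord lee_fin => H.
    have -> : \sum_(k < n) weight teta k * (eta k / eps) ^+ 2 =
        (2 * eps ^+ 4 * u)^-1 * \sum_(k < n) teta k ^+ 2 * eta k ^+ 2.
      rewrite mulr_sumr; apply: eq_bigr => k _; rewrite wE.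
      by field; rewrite !gt_eqF.
    apply: (@le_trans _ _ ((2 * eps ^+ 4 * u)^-1 * Q)).
      by rewrite uQ le_eqVlt; apply/orP; left; apply/eqP; field; rewrite !gt_eqF.
    by rewrite ler_wpM2l// invr_ge0 !mulr_ge0// ltW.
  + by move=> k; rewrite mulr_ge0// sqr_ge0.
  + by move=> k nk; rewrite tn// expr0n mul0r.
Qed.

End extreme.

(** * Normal approximation *)

Section ramp.
Context {R : realType}.
Implicit Types a dl x : R.

(** A continuous stand-in for the indicator of [x <= a], since [stein_bound] takes continuous
    functions. *)
Definition ramp a dl x : R := Num.max 0 (Num.min 1 ((a + dl - x) / dl)).

Lemma continuous_ramp a dl : continuous (ramp a dl).
Proof.
move=> x; apply: (@continuous_max R R (fun=> 0) (fun x => Num.min 1 ((a + dl - x) / dl))).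
  exact: cvg_cst.
apply: (@continuous_min R R (fun=> 1) (fun x => (a + dl - x) / dl)); first exact: cvg_cst.
apply: cvgM; last exact: cvg_cst.
by apply: cvgB; [exact: cvg_cst|exact: cvg_id].
Qed.

Lemma ramp01 a dl x : 0 <= ramp a dl x <= 1.
Proof. by rewrite /ramp le_max lexx ge_max ler01 ge_min lexx. Qed.

Lemma ramp_left a dl x : 0 < dl -> x <= a -> ramp a dl x = 1.
Proof.
move=> dl0 xa; rewrite /ramp min_l; first by rewrite max_r.
by rewrite ler_pdivlMr// mul1r; lra.
Qed.

Lemma ramp_right a dl x : 0 < dl -> a + dl < x -> ramp a dl x = 0.
Proof.
move=> dl0 xa; rewrite /ramp max_l// ge_min; apply/orP; right.
by rewrite ler_pdivrMr// mul0r; lra.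
Qed.

Lemma ramp_sandwich d (T : measurableType d) (m : probability T R) (X : T -> R) a dl :
  measurable_fun setT X -> 0 < dl ->
  fine (m [set w | X w <= a]) <= \int[m]_w ramp a dl (X w) <=
  fine (m [set w | X w <= a + dl]).
Proof.
move=> mX dl0.
have mle b : measurable [set w | X w <= b].
  rewrite -[X in measurable X]setTI.
  have := mX measurableT _ (measurable_itv `]-oo, b]).
  by congr (measurable (_ `&` _)); apply/seteqP; split => w /=; rewrite in_itv.
have mr : measurable_fun setT (fun w => ramp a dl (X w)).
  apply: measurableT_comp mX; apply: continuous_measurable_fun; exact: continuous_ramp.
have ir : m.-integrable setT (EFin \o (fun w => ramp a dl (X w))).
  have i1 : m.-integrable setT (EFin \o (fun=> 1 : R)) by exact: finite_measure_integrable_cst.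
  apply: (le_integrable measurableT _ _ i1); first exact/measurable_EFinP.
  by move=> w _ /=; have /andP[h0 h1] := ramp01 a dl (X w); rewrite lee_fin !ger0_norm.
have E b : fine (m [set w | X w <= b]) = \int[m]_w (\1_[set w | X w <= b] w).
  by rewrite /Rintegral integral_indic// setIT.
have i1 b : m.-integrable setT (EFin \o (\1_[set w | X w <= b] : T -> R)).
  exact: integrable_indic.
rewrite !E; apply/andP; split; apply: le_Rintegral => // w _; rewrite indicE.
  case: (boolP (_ \in _)) => [|_]; last by case/andP: (ramp01 a dl (X w)).
  by rewrite inE/= => Xa; rewrite ramp_left.
case: (boolP (_ \in _)) => [_|]; first by case/andP: (ramp01 a dl (X w)).
by rewrite notin_setE/= => /negP; rewrite -ltNge => Xa; rewrite ramp_right.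
Qed.

End ramp.

Section clt.
Context {d : measure_display} {T : measurableType d} {R : realType}.
Context (P : probability T R) (xi : nat -> {RV P >-> R}).
Hypothesis Hxi : iid_standard_normal xi.
Local Notation N := (@normal_prob R 0 1).
Local Notation noise := (noise xi).
Variables (c : nat -> R) (n : nat) (c0 : R).
Hypotheses (sumc : \sum_(k < n) c k ^+ 2 = 2^-1)
  (cc0 : forall k, (k < n)%N -> 0 <= c k <= c0).

Let t (w : T) : R := chi2stat c n (noise w).

Let mt : measurable_fun setT t.
Proof. exact: (measurableT_comp (measurable_chi2stat _ _) (measurable_noise xi)). Qed.

Let Phi_set x : fine (N [set y | y <= x]) = Phi x.
Proof. by rewrite /Phi; congr (fine (N _)); apply/seteqP; split => y /=; rewrite in_itv. Qed.

(** The Stein bound does not see the slope of the ramp, so its width [dl] can shrink to 0 and the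
    error remains linear in [c0]. *)
Lemma chi2stat_kolmogorov x :
  Phi x - 4 * c0 <= fine (P [set w | t w <= x]) <= Phi x + 4 * c0.
Proof.
have mid : measurable_fun [set: measurableTypeR R] (fun y : measurableTypeR R => y : R) by [].
have S y dl := stein_bound Hxi (@continuous_ramp R y dl) (ramp01 y dl) sumc cc0.
apply/andP; split; apply/ler_addgt0Pr => dl dl0.
  have /andP[_ h1] := ramp_sandwich P (x - dl) mt dl0.
  have /andP[h2 _] := ramp_sandwich N (x - dl) mid dl0.
  have := S (x - dl) dl; rewrite mulr1 ler_norml => /andP[h3 _].
  have xd : x - dl <= x by rewrite lerBlDr lerDl ltW.
  have /andP[_ h4] := Phi_lip xd.
  by move: h1 h2 h3; rewrite Phi_set subrK /t; lra.
have /andP[h1 _] := ramp_sandwich P x mt dl0.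
have /andP[_ h2] := ramp_sandwich N x mid dl0.
have := S x dl; rewrite mulr1 ler_norml => /andP[_ h3].
have xd : x <= x + dl by rewrite lerDl ltW.
have /andP[_ h4] := Phi_lip xd.
by move: h1 h2 h3; rewrite Phi_set /t; lra.
Qed.

(** Truncation at [q] makes the likelihood ratio a continuous function with values in [[0, q]], to
    which the Stein bound applies. *)
Lemma chi2stat_min_expR u H (q := expR (u * H - u ^+ 2 / 2)) : 0 < u ->
  Phi (H - u) + q * (1 - Phi H) - 4 * q * c0 <=
  \int[P]_w Num.min (expR (u * t w - u ^+ 2 / 2)) q.
Proof.
move=> u0.
have hc : continuous (fun x : R => Num.min (expR (u * x - u ^+ 2 / 2)) q).
  move=> x; apply: (@continuous_min R R (fun x => expR (u * x - u ^+ 2 / 2)) (fun=> q)); last exact: cvg_cst.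
  apply: (@continuous_comp _ _ _ (fun x : R => u * x - u ^+ 2 / 2) expR); last exact: continuous_expR.
  apply: cvgB; last exact: cvg_cst.
  by apply: cvgM; [exact: cvg_cst|exact: cvg_id].
have h0 x : 0 <= Num.min (expR (u * x - u ^+ 2 / 2)) q <= q.
  by rewrite le_min !expR_ge0 ge_min lexx orbT.
have := stein_bound Hxi hc h0 sumc cc0.
rewrite integral_min_expR// ler_norml => /andP[+ _].
by rewrite lerBrDl /t /q; apply: le_trans; rewrite -/q; lra.
Qed.

End clt.

(** * Bounds on the errors of tests *)

Section tests.
Context {d : measure_display} {T : measurableType d} {R : realType}.
Context (P : probability T R) (xi : nat -> {RV P >-> R}).

Lemma measurable_observe eps eta :
  measurable_fun setT (observe xi eps eta : T -> observations R).
Proof.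
apply: measurable_to_obs => k; apply: measurable_funD => //.
exact: measurable_funM.
Qed.

Lemma EobsE eps eta f : Eobs xi eps eta f = \int[P]_w f (observe xi eps eta w).
Proof. by rewrite /Eobs unlock. Qed.

Lemma test_integrable eps eta psi : is_test psi ->
  P.-integrable setT (EFin \o (fun w => psi (observe xi eps eta w))).
Proof.
move=> [mpsi psi01].
have i1 : P.-integrable setT (EFin \o (fun=> 1 : R)) by exact: finite_measure_integrable_cst.
apply: (le_integrable measurableT _ _ i1).
  by apply/measurable_EFinP; apply: (measurableT_comp mpsi); exact: measurable_observe.
by move=> w _ /=; have /andP[h0 h1] := psi01 (observe xi eps eta w); rewrite lee_fin !ger0_norm.
Qed.

Lemma is_testC psi : is_test psi -> is_test (fun y : nat -> R => 1 - psi y).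
Proof.
move=> [mpsi psi01]; split; first exact: measurable_funB.
by move=> y; have /andP[h0 h1] := psi01 y; rewrite subr_ge0 h1 lerBlDr lerDl.
Qed.

Lemma is_testZ x psi : 0 <= x <= 1 -> is_test psi -> is_test (fun y : nat -> R => x * psi y).
Proof.
move=> /andP[x0 x1] [mpsi psi01]; split; first exact: measurable_funM.
by move=> y; have /andP[h0 h1] := psi01 y; rewrite mulr_ge0//= mulr_ile1.
Qed.

Lemma is_test_cst (x : R) : 0 <= x <= 1 -> is_test (fun=> x).
Proof. by move=> x01; split. Qed.

Lemma Eobs_cst eps eta x : Eobs xi eps eta (fun=> x) = x.
Proof. by rewrite EobsE Rintegral_cst//= probability_setT mulr1. Qed.

Lemma Eobs01 eps eta psi : is_test psi -> 0 <= Eobs xi eps eta psi <= 1.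
Proof.
move=> tpsi; have [mpsi psi01] := tpsi; rewrite EobsE; apply/andP; split.
  by apply: Rintegral_ge0 => w _; case/andP: (psi01 (observe xi eps eta w)).
have <- : \int[P]_w (1 : R) = 1 by rewrite Rintegral_cst//= probability_setT mulr1.
apply: le_Rintegral => //; first exact: test_integrable.
  exact: finite_measure_integrable_cst.
by move=> w _; case/andP: (psi01 (observe xi eps eta w)).
Qed.

Lemma EobsC eps eta psi : is_test psi ->
  Eobs xi eps eta (fun y => 1 - psi y) = 1 - Eobs xi eps eta psi.
Proof.
move=> tpsi; rewrite !EobsE RintegralB//; last exact: test_integrable.
  by rewrite Rintegral_cst//= probability_setT mulr1.
exact: finite_measure_integrable_cst.
Qed.

Lemma EobsZ eps eta x psi : is_test psi ->
  Eobs xi eps eta (fun y => x * psi y) = x * Eobs xi eps eta psi.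
Proof. by move=> tpsi; rewrite !EobsE RintegralZl//; exact: test_integrable. Qed.

Variables (eps : R) (Theta : set (nat -> R)).

Lemma beta_ge eta psi : is_test psi -> Theta eta ->
  Eobs xi eps eta (fun y => 1 - psi y) <= beta xi eps Theta psi.
Proof.
move=> tpsi etaT; apply: ub_le_sup; last by exists eta.
by exists 1 => _ [eta' _ <-]; case/andP: (Eobs01 eps eta' (is_testC tpsi)).
Qed.

Hypothesis Theta0 : Theta !=set0.

Lemma beta_le B psi : (forall eta, Theta eta -> Eobs xi eps eta (fun y => 1 - psi y) <= B) ->
  beta xi eps Theta psi <= B.
Proof.
move=> H; apply: ge_sup; last by move=> _ [eta etaT <-]; exact: H.
by have [eta etaT] := Theta0; exists (Eobs xi eps eta (fun y => 1 - psi y)), eta.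
Qed.

Lemma beta_ge0 psi : is_test psi -> 0 <= beta xi eps Theta psi.
Proof.
move=> tpsi; have [eta etaT] := Theta0; apply: le_trans (beta_ge tpsi etaT).
by case/andP: (Eobs01 eps eta (is_testC tpsi)).
Qed.

Lemma beta_le1 psi : is_test psi -> beta xi eps Theta psi <= 1.
Proof. by move=> tpsi; apply: beta_le => eta _; case/andP: (Eobs01 eps eta (is_testC tpsi)). Qed.

Lemma alpha01 psi : is_test psi -> 0 <= alpha xi eps psi <= 1.
Proof. exact: Eobs01. Qed.

(** Scaling a test down repairs a slight excess of its level at a price of at most [1 - x] in the
    other error. *)
Lemma beta_scale x psi : 0 <= x <= 1 -> is_test psi ->
  beta xi eps Theta (fun y => x * psi y) <= beta xi eps Theta psi + (1 - x).
Proof.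
move=> x01 tpsi; apply: beta_le => eta etaT.
rewrite EobsC; last exact: is_testZ.
rewrite EobsZ//; have := beta_ge tpsi etaT; rewrite EobsC//.
have /andP[E0 E1] := Eobs01 eps eta tpsi; have /andP[x0 x1] := x01.
have : (1 - x) * Eobs xi eps eta psi <= 1 - x by rewrite ler_piMr// subr_ge0.
lra.
Qed.

Lemma minimax_beta_le theta psi : is_test psi -> alpha xi eps psi <= theta ->
  minimax_beta xi eps Theta theta <= beta xi eps Theta psi.
Proof.
move=> tpsi apsi; apply: ge_inf; last by exists psi.
by exists 0 => _ [psi' [tpsi' _] <-]; exact: beta_ge0.
Qed.

Lemma minimax_beta_ge theta B : 0 <= theta ->
  (forall psi, is_test psi -> alpha xi eps psi <= theta -> B <= beta xi eps Theta psi) ->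
  B <= minimax_beta xi eps Theta theta.
Proof.
move=> theta0 H; apply: lb_le_inf; last by move=> _ [psi [tpsi apsi] <-]; exact: H.
exists (beta xi eps Theta (fun=> 0)), (fun=> 0) => //; split.
  by apply: is_test_cst; rewrite lexx ler01.
by rewrite /alpha Eobs_cst.
Qed.

Lemma minimax_gamma_le psi : is_test psi ->
  minimax_gamma xi eps Theta <= gamma xi eps Theta psi.
Proof.
move=> tpsi; apply: ge_inf; last by exists psi.
exists 0 => _ [psi' tpsi' <-]; rewrite addr_ge0 ?beta_ge0//.
by case/andP: (alpha01 tpsi').
Qed.

Lemma minimax_gamma_ge B : (forall psi, is_test psi -> B <= gamma xi eps Theta psi) ->
  B <= minimax_gamma xi eps Theta.
Proof.
move=> H; apply: lb_le_inf; last by move=> _ [psi tpsi <-]; exact: H.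
exists (gamma xi eps Theta (fun=> 0)), (fun=> 0) => //.
by apply: is_test_cst; rewrite lexx ler01.
Qed.

End tests.

(** * Error bounds at a fixed noise level *)

Section bounds.
Context {d : measure_display} {T : measurableType d} {R : realType}.
Context (P : probability T R) (xi : nat -> {RV P >-> R}).
Hypothesis Hxi : iid_standard_normal xi.
Local Notation noise := (noise xi).
Variables (a s : nat -> R) (r eps u : R) (teta : nat -> R) (n : nat).
Local Notation c := (weight teta).
Local Notation w0 := (weight0 teta).
Local Notation Theta := (Theta2r a s r).
Local Notation beta_ := (beta xi eps Theta).
Local Notation alpha_ := (alpha xi eps).
Hypotheses (eps0 : 0 < eps) (u0 : 0 < u) (tetaT : Theta teta)
  (teta0 : forall k, (n <= k)%N -> teta k = 0)
  (cE : forall k, c k = (teta k / eps) ^+ 2 / (2 * u))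
  (sumc : \sum_(k < n) c k ^+ 2 = 2^-1)
  (cw : forall k, 0 <= c k <= w0) (w01 : w0 <= 1)
  (drift : forall eta, Theta eta -> u <= \sum_(k < n) c k * (eta k / eps) ^+ 2).

Let w00 : 0 < w0.
Proof.
rewrite ltNge; apply/negP => w00.
have : \sum_(k < n) c k ^+ 2 = 0.
  apply: big1 => k _; have /andP[h1 h2] := cw k.
  by rewrite (_ : c k = 0) ?expr0n//; apply/eqP; rewrite eq_le h1 (le_trans h2).
by rewrite sumc => /eqP; rewrite invr_eq0 pnatr_eq0.
Qed.

Let cc0 k : (k < n)%N -> 0 <= c k <= w0. Proof. by []. Qed.

Let Theta0 : Theta !=set0. Proof. by exists teta. Qed.

Let sumc4 : \sum_(k < n) (c k ^+ 2) ^+ 2 <= w0 ^+ 2 / 2.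
Proof.
rewrite -sumc mulr_sumr; apply: ler_sum => k _; rewrite expr2 ler_wpM2r ?sqr_ge0//.
by have /andP[h1 h2] := cw k; apply: lerXn2r; rewrite ?nnegrE// (le_trans h1).
Qed.

(** [loglr] bounds the log-likelihood ratio of the random-sign prior from below. With
    [th_k ^+ 2 = 2 * u * c k] the quadratic terms add up to [u * t0], and the quartic ones
    [(u * c k) ^+ 2 / 3 * xi_k ^+ 4] have total mean [u ^+ 2 / 2], exactly the normalising term of
    N(u,1) against N(0,1). Splitting it off centres [D4]. *)
Let t0 (w : T) : R := chi2stat c n (noise w).
Let D4 (w : T) : R := \sum_(k < n) (u * c k) ^+ 2 / 3 * (xi k w ^+ 4 - 3).
Let loglr (w : T) : R := u * t0 w - u ^+ 2 / 2 - D4 w.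

Let mt0 : measurable_fun setT t0.
Proof. exact: (measurableT_comp (measurable_chi2stat _ _) (measurable_noise xi)). Qed.

Let mD4 : measurable_fun setT D4.
Proof.
apply: measurable_sum => k; apply: measurable_funM => //; apply: measurable_funB => //.
exact: measurable_funX.
Qed.

Let mloglr : measurable_fun setT loglr.
Proof.
apply: measurable_funB; last exact: mD4.
by apply: measurable_funB => //; apply: measurable_funM => //; exact: mt0.
Qed.

Let it0 : P.-integrable setT (EFin \o t0) /\ \int[P]_w `|t0 w| <= 1.
Proof.
have [i2 e2] := chi2stat_moment2 Hxi c n.
apply: integral_abs_le => //.
by rewrite /t0 e2 sumc expr1n divff.
Qed.

(** The second moment is at most [16 / 3 * u ^+ 4 * w0 ^+ 2], rounded up to the square of
    [3 * u ^+ 2 * w0]. *)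
Let iD4 : P.-integrable setT (EFin \o D4) /\ \int[P]_w `|D4 w| <= 3 * u ^+ 2 * w0.
Proof.
have [i2 e2] := quartic_moment2 Hxi (fun k => (u * c k) ^+ 2 / 3) n.
apply: integral_abs_le => //.
  by rewrite !mulr_gt0// exprn_gt0.
rewrite /D4 e2; apply: (@le_trans _ _ (96 * (u ^+ 4 / 9 * (w0 ^+ 2 / 2)))).
  rewrite ler_pM2l//; apply: (@le_trans _ _ (u ^+ 4 / 9 * \sum_(k < n) (c k ^+ 2) ^+ 2)).
    rewrite mulr_sumr le_eqVlt; apply/orP; left; apply/eqP.
    by apply: eq_bigr => k _; field.
  by rewrite ler_wpM2l// divr_ge0// exprn_ge0// ltW.
have : 0 <= u ^+ 4 * w0 ^+ 2 by rewrite mulr_ge0 ?sqr_ge0// exprn_ge0// ltW.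
have -> : (3 * u ^+ 2 * w0) ^+ 2 = 9 * (u ^+ 4 * w0 ^+ 2) by ring.
have -> : 96 * (u ^+ 4 / 9 * (w0 ^+ 2 / 2)) = 16 / 3 * (u ^+ 4 * w0 ^+ 2) by field.
lra.
Qed.

Let null psi : is_test psi -> alpha_ psi = \int[P]_w psi (fun k => eps * xi k w).
Proof.
move=> _; rewrite /alpha EobsE; apply: eq_Rintegral => w _; congr (psi _).
by apply/funext => k; rewrite /observe add0r.
Qed.

Let nullC psi : is_test psi ->
  \int[P]_w (1 - psi (fun k => eps * xi k w)) = 1 - alpha_ psi.
Proof. by move=> tpsi; have := null (is_testC tpsi); rewrite /alpha EobsC. Qed.

Lemma prod_sym_lr_ge w :
  expR (loglr w) <= \prod_(k < n) sym_lr (teta k / eps) (xi k w).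
Proof.
have -> : loglr w = \sum_(k < n) ((teta k / eps) ^+ 2 / 2 * (xi k w ^+ 2 - 1) -
    (teta k / eps) ^+ 4 / 12 * xi k w ^+ 4).
  have th2 k : (teta k / eps) ^+ 2 = 2 * u * c k by rewrite cE; field; rewrite !gt_eqF.
  have th4 k : (teta k / eps) ^+ 4 = (2 * u * c k) ^+ 2 by rewrite -th2 -exprM.
  rewrite /loglr /t0 /D4 /chi2stat.
  have -> : u ^+ 2 / 2 = \sum_(k < n) u ^+ 2 * c k ^+ 2 by rewrite -mulr_sumr sumc.
  rewrite mulr_sumr -!sumrB; apply: eq_bigr => k _; rewrite th2 th4 /noise; by field.
rewrite expR_sum; apply: ler_prod => k _; rewrite expR_ge0/=; exact: sym_lr_ge.
Qed.

(** [exists_sign_ge], applied to the acceptance probability in units of [eps], provides a signed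
    copy of [teta] whose error dominates the average over signs; [prod_sym_lr_ge] then replaces the
    likelihood ratio by [expR loglr]. *)
Lemma bayes_bound psi : is_test psi ->
  P.-integrable setT (EFin \o (fun w => expR (loglr w) * (1 - psi (fun k => eps * xi k w)))) /\
  \int[P]_w (expR (loglr w) * (1 - psi (fun k => eps * xi k w))) <= beta_ psi.
Proof.
move=> tpsi; have [mpsi1 psi01] := is_testC tpsi.
have mscale : measurable_fun [set: observations R]
    (fun y : observations R => (fun k => eps * y k) : observations R).
  by apply: measurable_to_obs => k; apply: measurable_funM => //; exact: measurable_coord.
pose G (y : observations R) : \bar R := (1 - psi (fun k => eps * y k))%:E.
have mG : measurable_fun setT G.
  by apply/measurable_EFinP; exact: (measurableT_comp mpsi1 mscale).
have G0 y : (0 <= G y)%E by rewrite lee_fin; case/andP: (psi01 (fun k => eps * y k)).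
have [eta' [eta1 eta2 eta3]] := exists_sign_ge Hxi (fun k => teta k / eps) n mG G0.
pose eta k := eps * eta' k.
have etaT : Theta eta.
  apply: (@eq_sqr_Theta2r _ _ _ _ teta) => // k; rewrite /eta exprMn.
  have [kn|nk] := ltnP k n; first by rewrite eta1//; field; rewrite gt_eqF.
  by rewrite eta2// teta0// expr0n mulr0.
have EE : (\int[P]_w G (fun k => noise w k + eta' k)%R =
    (Eobs xi eps eta (fun y => 1 - psi y))%:E)%E.
  rewrite EobsE /Rintegral fineK; last first.
    by apply: integrable_fin_num => //; exact: test_integrable (is_testC tpsi).
  apply: eq_integral => w _; congr ((1 - psi _)%:E); apply/funext => k.
  by rewrite /observe /noise /eta mulrDr addrC.
have mf : measurable_fun setT (fun w => expR (loglr w) * (1 - psi (fun k => eps * xi k w))).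
  apply: measurable_funM; first exact: measurableT_comp.
  exact: (measurableT_comp mpsi1 (measurableT_comp mscale (measurable_noise xi))).
have f0 w : 0 <= expR (loglr w) * (1 - psi (fun k => eps * xi k w)).
  by rewrite mulr_ge0 ?expR_ge0//; case/andP: (psi01 (fun k => eps * xi k w)).
have le : (\int[P]_w (expR (loglr w) * (1 - psi (fun k => eps * xi k w)))%:E <= (beta_ psi)%:E)%E.
  apply: (@le_trans _ _ (Eobs xi eps eta (fun y => 1 - psi y))%:E); last first.
    by rewrite lee_fin; exact: beta_ge.
  rewrite -EE; apply: le_trans eta3; apply: ge0_le_integral => //.
  - by move=> w _; rewrite lee_fin.
  - exact/measurable_EFinP.
  - apply: emeasurable_funM; first exact: (measurableT_comp mG (measurable_noise xi)).
    apply/measurable_EFinP; apply: measurable_prod => k _.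
    by apply: measurableT_comp => //; exact: measurable_sym_lr.
  - move=> w _; rewrite -EFinM lee_fin mulrC ler_wpM2l//; last exact: prod_sym_lr_ge.
    by case/andP: (psi01 (fun k => eps * xi k w)).
have int : P.-integrable setT (EFin \o (fun w => expR (loglr w) * (1 - psi (fun k => eps * xi k w)))).
  apply/integrableP; split; first exact/measurable_EFinP.
  apply: (@le_lt_trans _ _ (beta_ psi)%:E); last exact: ltry.
  apply: le_trans le; rewrite le_eqVlt; apply/orP; left; apply/eqP.
  by apply: eq_integral => w _ /=; rewrite ger0_norm.
by split => //; rewrite -lee_fin /Rintegral fineK// integrable_fin_num.
Qed.

Let integrable_test psi : is_test psi ->
  P.-integrable setT (EFin \o (fun w => psi (fun k => eps * xi k w))).
Proof.
move=> tpsi; have := test_integrable xi eps (fun=> 0) tpsi.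
by congr (P.-integrable _ (EFin \o _)); apply/funext => w; congr psi; apply/funext => k;
  rewrite /observe add0r.
Qed.

(* [e^x >= e^(- M) (1 + M + x)] reduces the bound to the first absolute moment
   of the log-likelihood ratio. *)
Lemma beta_ge_expR M psi : 0 <= M -> is_test psi ->
  expR (- M) * ((1 + M) * (1 - alpha_ psi) - (u + 4 * u ^+ 2)) <= beta_ psi.
Proof.
move=> M0 tpsi; have [i1 le1] := bayes_bound tpsi; apply: le_trans le1.
have i2 := integrable_test (is_testC tpsi).
have [i3 e3] := it0; have [i4 e4] := iD4.
pose B w := u * `|t0 w| + `|D4 w|.
have i5 : P.-integrable setT (EFin \o (fun w => u * `|t0 w|)).
  exact: (integrableZl measurableT _ (integrable_norm i3)).
have iB : P.-integrable setT (EFin \o B).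
  exact: (integrableD measurableT i5 (integrable_norm i4)).
(* Together with [u ^+ 2 / 2] this bounds the first absolute moment of [loglr]; the statement rounds
   7/2 up to 4. *)
have EB : \int[P]_w B w <= u + 3 * u ^+ 2.
  rewrite RintegralD//; last exact: integrable_norm.
  rewrite RintegralZl//; last exact: integrable_norm.
  apply: lerD; first by rewrite ler_piMr// ltW.
  by apply: le_trans e4 _; rewrite ler_piMr// mulr_ge0 ?sqr_ge0.
have i6 : P.-integrable setT (EFin \o (fun w => (1 + M) * (1 - psi (fun k => eps * xi k w)))).
  exact: (integrableZl measurableT _ i2).
have i7 : P.-integrable setT (EFin \o (fun=> u ^+ 2 / 2)) by exact: finite_measure_integrable_cst.
have i8 := integrableD measurableT iB i7.
have i9 := integrableB measurableT i6 i8.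
have i10 : P.-integrable setT (EFin \o (fun w => expR (- M) *
   ((1 + M) * (1 - psi (fun k => eps * xi k w)) - (B w + u ^+ 2 / 2)))).
  exact: (integrableZl measurableT _ i9).
apply: (@le_trans _ _ (\int[P]_w (expR (- M) *
   ((1 + M) * (1 - psi (fun k => eps * xi k w)) - (B w + u ^+ 2 / 2))))).
  rewrite RintegralZl// ler_pM2l ?expR_gt0// (RintegralB measurableT i6 i8).
  rewrite (RintegralZl _ measurableT i2) (RintegralD measurableT iB i7).
  rewrite nullC// Rintegral_cst//= probability_setT mulr1.
  have := sqr_ge0 u; lra.
apply: le_Rintegral => // w _; set p := 1 - psi _.
have /andP[p0 p1] : 0 <= p <= 1 by have [_] := is_testC tpsi; apply.
apply: (@le_trans _ _ (expR (- M) * ((1 + (loglr w + M)) * p))).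
  rewrite ler_pM2l ?expR_gt0//.
  have : - (B w + u ^+ 2 / 2) <= loglr w * p.
    have : `|loglr w| <= B w + u ^+ 2 / 2.
      rewrite /loglr /B (le_trans (ler_normB _ _))// -[leRHS]addrAC lerD2r.
      rewrite (le_trans (ler_normB _ _))// normrM (gtr0_norm u0) lerD2l ger0_norm//.
      by rewrite divr_ge0// sqr_ge0.
    have : `|loglr w * p| <= `|loglr w| by rewrite normrM (ger0_norm p0) ler_piMr.
    have : - `|loglr w * p| <= loglr w * p by rewrite lerNl -normrN ler_norm.
    lra.
  lra.
rewrite mulrA ler_wpM2r//.
have -> : expR (loglr w) = expR (- M) * expR (loglr w + M).
  by rewrite -expRD; congr expR; ring.
by rewrite ler_pM2l ?expR_gt0// expR_ge1Dx.
Qed.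

(* [q] is the critical value of the Neyman-Pearson test of N(0,1) against
   N(u,1) that rejects above [H]. *)
Lemma beta_ge_normal H (q := expR (u * H - u ^+ 2 / 2)) psi : is_test psi ->
  Phi (H - u) + q * (1 - Phi H - alpha_ psi) - q * (4 + 3 * u ^+ 2) * w0 <= beta_ psi.
Proof.
move=> tpsi; have [i1 le1] := bayes_bound tpsi; apply: le_trans le1.
have q0 : 0 < q by exact: expR_gt0.
have i2 := integrable_test tpsi.
have [i4 e4] := iD4.
pose m w := Num.min (expR (u * t0 w - u ^+ 2 / 2)) q.
have mm : measurable_fun setT m.
  apply: measurable_minr => //; apply: measurableT_comp => //.
  by apply: measurable_funB => //; apply: measurable_funM.
have m0 w : 0 <= m w <= q by rewrite le_min !expR_ge0 ge_min lexx orbT.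
have im : P.-integrable setT (EFin \o m).
  have iq : P.-integrable setT (EFin \o (fun=> q)) by exact: finite_measure_integrable_cst.
  apply: (le_integrable measurableT _ _ iq); first exact/measurable_EFinP.
  by move=> w _ /=; have /andP[h0 h1] := m0 w; rewrite lee_fin !ger0_norm// ltW.
have i5 : P.-integrable setT (EFin \o (fun w => q * `|D4 w|)).
  exact: (integrableZl measurableT _ (integrable_norm i4)).
have i6 : P.-integrable setT (EFin \o (fun w => q * psi (fun k => eps * xi k w))).
  exact: (integrableZl measurableT _ i2).
have i7 := integrableB measurableT im i5.
have i8 : P.-integrable setT (EFin \o (fun w => m w - q * `|D4 w| - q * psi (fun k => eps * xi k w))).
  exact: (integrableB measurableT i7 i6).
apply: (@le_trans _ _ (\int[P]_w (m w - q * `|D4 w| - q * psi (fun k => eps * xi k w)))).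
  rewrite (RintegralB measurableT i7 i6) (RintegralB measurableT im i5).
  rewrite (RintegralZl _ measurableT i2) (RintegralZl _ measurableT (integrable_norm i4)).
  rewrite -null//.
  (* Here [4 * q * w0] is the cost of the normal approximation and [3 * q * u ^+ 2 * w0] that of
     [D4]. *)
  have := chi2stat_min_expR Hxi sumc cc0 H u0; rewrite -/q => h1.
  have := ler_wpM2l (ltW q0) e4; rewrite /m /t0; lra.
apply: le_Rintegral => // w _; set p := psi _.
have /andP[p0 p1] : 0 <= p <= 1 by have [_] := tpsi; apply.
(* Dropping [D4] from the exponent costs at most [q * |D4|]: nothing has to be paid if [D4 <= 0],
   the left side is nonpositive if [D4 >= 1], and [exp (- D4) >= 1 - D4] settles the rest. *)
have key : m w - q * `|D4 w| <= Num.min (expR (loglr w)) q.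
  rewrite le_min; apply/andP; split; last first.
    have /andP[_ h] := m0 w; apply: le_trans h; rewrite lerBlDr lerDl mulr_ge0// ltW//.
  have [D0|D0] := leP (D4 w) 0.
    apply: (@le_trans _ _ (m w)); first by rewrite lerBlDr lerDl mulr_ge0// ltW.
    by rewrite /m ge_min ler_expR /loglr lerBrDr gerDl D0.
  rewrite gtr0_norm//.
  have [D1|D1] := leP 1 (D4 w).
    apply: (@le_trans _ _ 0); last exact: expR_ge0.
    have /andP[_ h] := m0 w; rewrite subr_le0 (le_trans h)// ler_peMr// ltW//.
  apply: (@le_trans _ _ (m w * (1 - D4 w))).
    have /andP[_ h] := m0 w; have := ler_wpM2r (ltW D0) h; lra.
  have -> : loglr w = (u * t0 w - u ^+ 2 / 2) + (- D4 w) by [].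
  rewrite expRD; apply: ler_pM.
  - by case/andP: (m0 w).
  - by rewrite subr_ge0 ltW.
  - by rewrite /m ge_min lexx.
  - exact: expR_ge1Dx.
(* Pointwise Neyman-Pearson inequality: [L * (1 - p) + q * p] is a mean of [L] and [q], hence at
   least their minimum. *)
apply: (@le_trans _ _ (Num.min (expR (loglr w)) q - q * p)); first by rewrite lerD2r.
have [lq|ql] := leP (expR (loglr w)) q.
  have := ler_wpM2r p0 lq; lra.
have : q * (1 - p) <= expR (loglr w) * (1 - p) by rewrite ler_wpM2r ?subr_ge0// ltW.
lra.
Qed.

(** The weights vanish from [n] on, so the partial sums are eventually constant and [limn] is a true
    limit for every [y]. *)
Let tstatE y : tstat teta eps y = chi2stat c n (fun k => y k / eps).
Proof.
rewrite /tstat; apply: cvg_lim => //; apply: cvg_near_cst; near=> m.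
have nm : (n <= m)%N by near: m; exact: nbhs_infty_ge.
rewrite /series/= /chi2stat -(big_mkord xpredT (fun k => c k * ((y k / eps) ^+ 2 - 1))).
rewrite (big_cat_nat (n := n))//= [X in _ + X]big_nat [X in _ + X]big1 ?addr0// => k /andP[nk _].
by rewrite cE teta0// mul0r expr0n !mul0r.
Unshelve. all: by end_near. Qed.

Let measurable_accept H : measurable [set y : observations R | tstat teta eps y <= H].
Proof.
have m1 : measurable_fun [set: observations R]
    (fun y : observations R => (fun k => y k / eps) : observations R).
  by apply: measurable_to_obs => k; apply: measurable_funM => //; exact: measurable_coord.
have := (measurableT_comp (measurable_chi2stat c n) m1) measurableT _ (measurable_itv `]-oo, H]).
rewrite setTI; congr measurable; apply/seteqP; split => y /=; by rewrite in_itv/= tstatE.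
Qed.

Lemma is_test_psi_test H : is_test (psi_test teta eps H).
Proof.
split.
  rewrite /psi_test; apply: measurable_indic.
  rewrite (_ : [set y | _] = ~` [set y : observations R | tstat teta eps y <= H]).
    exact: measurableC.
  by apply/seteqP; split => y /=; [move/lt_geF/negbT/negP|move/negP; rewrite -ltNge].
by move=> y; rewrite /psi_test indicE ler0n lern1; case: (_ \in _).
Qed.

Let drift_ (eta : nat -> R) := \sum_(k < n) c k * (eta k / eps) ^+ 2.
Let lin (eta : nat -> R) (w : T) := \sum_(k < n) 2 * c k * (eta k / eps) * xi k w.

Let mlin eta : measurable_fun setT (lin eta).
Proof. by apply: measurable_sum => k; apply: measurable_funM. Qed.

Let Eobs_psi_test eta H : Eobs xi eps eta (fun y => 1 - psi_test teta eps H y) =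
  fine (P [set w | t0 w + lin eta w + drift_ eta <= H]).
Proof.
have -> : [set w | t0 w + lin eta w + drift_ eta <= H] =
    observe xi eps eta @^-1` [set y : observations R | tstat teta eps y <= H].
  apply/seteqP; split => w /=; rewrite tstatE;
  (suff -> : chi2stat c n (fun k => observe xi eps eta w k / eps) =
       t0 w + lin eta w + drift_ eta by []);
  rewrite /chi2stat /t0 /lin /drift_ /chi2stat -!big_split/=; apply: eq_bigr => k _;
  rewrite /observe /noise; field; by rewrite gt_eqF.
rewrite EobsE /Rintegral -[X in P X]setIT -integral_indic//; last first.
  rewrite -[X in measurable X]setTI.
  exact: (measurable_observe xi eps eta measurableT (measurable_accept H)).
congr fine; apply: eq_integral => w _; congr EFin.
rewrite /psi_test !indicE; have [h|h] := leP (tstat teta eps (observe xi eps eta w)) H.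
  by rewrite memNset ?mem_set ?subr0//= => /(le_lt_trans h); rewrite ltxx.
by rewrite mem_set// memNset ?subrr//= => /(lt_le_trans h); rewrite ltxx.
Qed.

Let alpha_psi_test H : alpha_ (psi_test teta eps H) = 1 - fine (P [set w | t0 w <= H]).
Proof.
have := EobsC xi eps (fun=> 0) (is_test_psi_test H); rewrite Eobs_psi_test => E.
rewrite /alpha -[LHS](subKr 1) -E; congr (1 - fine (P _)).
apply/seteqP; split => w /=; rewrite /lin /drift_;
by rewrite !big1 ?addr0// => k _; rewrite mul0r ?expr0n ?mulr0 ?mul0r.
Qed.

Lemma alpha_psi_test_le H : alpha_ (psi_test teta eps H) <= 1 - Phi H + 4 * w0.
Proof.
rewrite alpha_psi_test; have /andP[h _] := chi2stat_kolmogorov Hxi sumc cc0 H.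
by move: h; rewrite /t0; lra.
Qed.

Let mle (X : T -> R) b : measurable_fun setT X -> measurable [set w | X w <= b].
Proof.
move=> mX; rewrite -[X in measurable X]setTI.
have := mX measurableT _ (measurable_itv `]-oo, b]).
by congr (measurable (_ `&` _)); apply/seteqP; split => w /=; rewrite in_itv.
Qed.

Let mge (X : T -> R) b : measurable_fun setT X -> measurable [set w | b <= `|X w|].
Proof.
move=> mX; have mXn : measurable_fun setT (fun w => `|X w|) by exact: measurableT_comp.
rewrite -[X in measurable X]setTI.
have := mXn measurableT _ (measurable_itv `[b, +oo[).
by congr (measurable (_ `&` _)); apply/seteqP; split => w /=; rewrite in_itv/= andbT.
Qed.

Let pr_le (A B : set T) : measurable A -> measurable B -> A `<=` B -> fine (P A) <= fine (P B).
Proof. by move=> mA mB AB; rewrite fine_le ?fin_num_measure// le_measure// inE. Qed.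

Let pr_leU (A B C : set T) : measurable A -> measurable B -> measurable C ->
  A `<=` B `|` C -> fine (P A) <= fine (P B) + fine (P C).
Proof.
move=> mA mB mC ABC; rewrite -fineD ?fin_num_measure//.
rewrite fine_le ?fin_numD ?fin_num_measure//.
apply: le_trans (measureU2 _ _ _) => //.
by apply: le_measure => //; rewrite inE//; exact: measurableU.
Qed.

Let t0_tail b : 0 < b -> fine (P [set w | b <= `|t0 w|]) <= 1 / b ^+ 2.
Proof.
move=> b0; have [i2 e2] := chi2stat_moment2 Hxi c n.
have := chebyshev_le mt0 b0 i2; rewrite /t0 e2 sumc divff// => h.
by rewrite -lee_fin fineK// fin_num_measure//; exact: mge.
Qed.

Let lin_tail eta b : 0 < b -> fine (P [set w | b <= `|lin eta w|]) <= 4 * w0 * drift_ eta / b ^+ 2.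
Proof.
move=> b0; have [i2 e2] := linear_moment2 Hxi (fun k => 2 * c k * (eta k / eps)) n.
have := chebyshev_le (mlin eta) b0 i2; rewrite /lin e2 => h.
rewrite -lee_fin fineK; last by rewrite fin_num_measure//; exact: (mge _ (mlin eta)).
apply: le_trans h _; rewrite lee_fin ler_wpM2r ?invr_ge0 ?exprn_ge0 ?(ltW b0)//.
rewrite mulr_sumr; apply: ler_sum => k _; have /andP[h1 h2] := cw k.
have -> : (2 * c k * (eta k / eps)) ^+ 2 = 4 * c k * (c k * (eta k / eps) ^+ 2) by ring.
apply: ler_wpM2r; first by apply: mulr_ge0 => //; exact: sqr_ge0.
by rewrite ler_pM2l.
Qed.

Lemma alpha_psi_test_chebyshev H : 0 < H -> alpha_ (psi_test teta eps H) <= 1 / H ^+ 2.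
Proof.
move=> H0; rewrite alpha_psi_test; apply: le_trans (t0_tail H0).
have -> : 1 - fine (P [set w | t0 w <= H]) = fine (P (~` [set w | t0 w <= H])).
  by rewrite probability_setC ?fineB ?fin_num_measure//; exact: mle.
apply: pr_le; [by apply: measurableC; exact: mle|exact: mge|].
by move=> w /= /negP; rewrite -ltNge => h; rewrite (le_trans (ltW h))// ler_norm.
Qed.

(** Either the linear term reaches [b2] in absolute value, or [t0] alone must fall to [H - b1]. *)
Let shifted_tail eta H b1 b2 : b1 + b2 <= drift_ eta -> 0 < b2 ->
  fine (P [set w | t0 w + lin eta w + drift_ eta <= H]) <=
  fine (P [set w | t0 w <= H - b1]) + 4 * w0 * drift_ eta / b2 ^+ 2.
Proof.
move=> bb b20; apply: (@le_trans _ _ (fine (P [set w | t0 w <= H - b1]) +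
   fine (P [set w | b2 <= `|lin eta w|]))); last by rewrite lerD2l lin_tail.
apply: pr_leU; [|exact: mle|exact: mge|].
  by apply: mle; apply: measurable_funD => //; apply: measurable_funD.
move=> w /= h; have [h2|h2] := leP b2 `|lin eta w|; [by right|left].
have : - `|lin eta w| <= lin eta w by rewrite lerNl -normrN ler_norm.
lra.
Qed.

(* The factor [dl] splits the drift [D >= u]: [(1 - dl) D] shifts [t0], and
   [dl D] absorbs the linear term by Chebyshev's inequality. *)
Lemma beta_psi_test_le H dl : 0 < dl <= 1 ->
  beta_ (psi_test teta eps H) <= Phi (H - u) + dl * u + 4 * w0 + 4 * w0 / (dl ^+ 2 * u).
Proof.
move=> /andP[dl0 dl1]; apply: beta_le => // eta etaT; rewrite Eobs_psi_test.
have hu : u <= drift_ eta by exact: drift.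
have h0 : 0 < drift_ eta by exact: lt_le_trans hu.
set h := drift_ eta in hu h0 *.
have dh : 0 < dl * h by rewrite mulr_gt0.
have bb : (1 - dl) * h + dl * h <= h by rewrite -mulrDl subrK mul1r.
apply: (le_trans (shifted_tail (eta := eta) H bb dh)).
have /andP[_ h1] := chi2stat_kolmogorov Hxi sumc cc0 (H - (1 - dl) * h).
have x1 : H - (1 - dl) * h <= H - (1 - dl) * u.
  by rewrite lerD2l lerN2 ler_wpM2l// subr_ge0.
have /andP[h2 _] := Phi_lip x1.
have x2 : H - u <= H - (1 - dl) * u.
  by rewrite lerD2l lerN2 ler_piMl ?gerBl ?ltW.
have /andP[_ h3] := Phi_lip x2.
(* The variance of the linear term grows only linearly with the drift while the threshold is
   squared, so the bound is worst at the smallest drift [u]. *)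
have h4 : 4 * w0 * h / (dl * h) ^+ 2 <= 4 * w0 / (dl ^+ 2 * u).
  have -> : 4 * w0 * h / (dl * h) ^+ 2 = 4 * w0 / (dl ^+ 2 * h).
    by field; rewrite !gt_eqF.
  rewrite ler_wpM2l ?mulr_ge0 ?(ltW w00)// lef_pV2 ?posrE ?mulr_gt0 ?exprn_gt0//.
  by rewrite ler_pM2l// exprn_gt0.
move: h1; rewrite /t0 -/h; lra.
Qed.

(** Half of the gap [(1 - k) * h] between drift and threshold is given to the linear term. What
    remains forces [t0] down to [- (1 - k) * u / 2] or lower, and Chebyshev's inequality handles
    both events, with [w0 <= 1] in the second. *)
Lemma beta_psi_test_chebyshev H k : 0 <= k < 1 -> H <= k * u ->
  beta_ (psi_test teta eps H) <= 4 / ((1 - k) ^+ 2 * u ^+ 2) + 16 / ((1 - k) ^+ 2 * u).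
Proof.
move=> /andP[k0 k1] Hk; apply: beta_le => // eta etaT; rewrite Eobs_psi_test.
have hu : u <= drift_ eta by exact: drift.
have h0 : 0 < drift_ eta by exact: lt_le_trans hu.
set h := drift_ eta in hu h0 *.
have ck : 0 < 1 - k by rewrite subr_gt0.
have ckh : 0 < (1 - k) * h by rewrite mulr_gt0.
have b20 : 0 < (1 - k) * h / 2 by rewrite divr_gt0.
have bb : (h - (1 - k) * h / 2) + (1 - k) * h / 2 <= h by rewrite subrK.
apply: (le_trans (shifted_tail (eta := eta) H bb b20)); rewrite -/h; apply: lerD.
  apply: (@le_trans _ _ (fine (P [set w | (1 - k) * u / 2 <= `|t0 w|]))).
    apply: pr_le; [exact: mle|exact: mge|] => w /= ht.
    have k2 : k * u - (h - (1 - k) * h / 2) <= - ((1 - k) * u / 2).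
      have : (1 + k) * u <= (1 + k) * h by rewrite ler_wpM2l// addr_ge0.
      lra.
    rewrite -normrN; apply: le_trans (ler_norm _); lra.
  have b0 : 0 < (1 - k) * u / 2 by rewrite divr_gt0// mulr_gt0.
  apply: (le_trans (t0_tail b0)); rewrite le_eqVlt; apply/orP; left; apply/eqP.
  by field; rewrite !gt_eqF.
apply: (@le_trans _ _ (16 * w0 / ((1 - k) ^+ 2 * h))).
  by rewrite le_eqVlt; apply/orP; left; apply/eqP; field; rewrite !gt_eqF.
apply: ler_pM.
- by rewrite mulr_ge0// ltW.
- by rewrite invr_ge0 mulr_ge0 ?sqr_ge0// ltW.
- by rewrite ler_piMr.
- rewrite lef_pV2 ?posrE ?mulr_gt0 ?exprn_gt0// ler_pM2l// exprn_gt0//.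
Qed.

End bounds.

(** * Asymptotics *)

(** The interface between the estimates at one noise level and the asymptotics: weights, support and
    extreme sequence are forgotten, and only [u] and [w0] remain. *)
Record sharp_bounds {d : measure_display} {T : measurableType d} {R : realType}
  {P : probability T R} (xi : nat -> {RV P >-> R}) (eps : R) (Theta : set (nat -> R))
  (u w0 : R) (psi : R -> (nat -> R) -> R) : Prop := SharpBounds {
  bounds_Theta : Theta !=set0;
  bounds_u : 0 < u;
  bounds_w0 : 0 < w0 <= 1;
  bounds_beta_ge_expR : forall M phi, 0 <= M -> is_test phi ->
    expR (- M) * ((1 + M) * (1 - alpha xi eps phi) - (u + 4 * u ^+ 2)) <=
    beta xi eps Theta phi;
  bounds_beta_ge_normal : forall H phi, is_test phi ->
    Phi (H - u) + expR (u * H - u ^+ 2 / 2) * (1 - Phi H - alpha xi eps phi) -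
      expR (u * H - u ^+ 2 / 2) * (4 + 3 * u ^+ 2) * w0 <= beta xi eps Theta phi;
  bounds_test : forall H, is_test (psi H);
  bounds_alpha_normal : forall H, alpha xi eps (psi H) <= 1 - Phi H + 4 * w0;
  bounds_alpha_chebyshev : forall H, 0 < H -> alpha xi eps (psi H) <= 1 / H ^+ 2;
  bounds_beta_normal : forall H, beta xi eps Theta (psi H) <=
    Phi (H - u) + Num.sqrt (Num.sqrt w0) * u + 4 * w0 + 4 * Num.sqrt w0 / u;
  bounds_beta_chebyshev : forall H k, 0 <= k < 1 -> H <= k * u ->
    beta xi eps Theta (psi H) <=
    4 / ((1 - k) ^+ 2 * u ^+ 2) + 16 / ((1 - k) ^+ 2 * u) }.

Lemma extreme_sharp_bounds {d : measure_display} {T : measurableType d} {R : realType}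
    (P : probability T R) (xi : nat -> {RV P >-> R}) (a s teta : nat -> R) (r eps : R)
    (u := extreme_value a s r eps) :
  iid_standard_normal xi -> (forall k, 0 < a k) -> a @ \oo --> +oo ->
  (forall k, 0 < s k) -> s @ \oo --> +oo -> extreme_sequence a s r teta ->
  0 < eps -> 0 < u ->
  sharp_bounds xi eps (Theta2r a s r) u (weight0 teta) (psi_test teta eps).
Proof.
move=> Hxi a0 Ha s0 Hs Hteta eps0 u0.
have [n [teta0 cE sumc cw drift]] := extreme_weights a0 Ha s0 Hs Hteta eps0 u0.
have w01 : weight0 teta <= 1 by have [_] := cw 0%N.
have cw' k : 0 <= weight teta k <= weight0 teta by have [] := cw k.
have w00 : 0 < weight0 teta.
  rewrite ltNge; apply/negP => w00.
  have : \sum_(k < n) weight teta k ^+ 2 = 0.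
    apply: big1 => k _; have /andP[h1 h2] := cw' k.
    by rewrite (_ : weight teta k = 0) ?expr0n//; apply/eqP; rewrite eq_le h1 (le_trans h2).
  by rewrite sumc => /eqP; rewrite invr_eq0 pnatr_eq0.
have [tetaT _] := Hteta.
split.
- by exists teta.
- exact: u0.
- by rewrite w00 w01.
- move=> M phi M0 tphi.
  exact: (beta_ge_expR Hxi eps0 u0 tetaT teta0 cE sumc cw' w01 M0 tphi).
- move=> H phi tphi.
  exact: (beta_ge_normal Hxi eps0 u0 tetaT teta0 cE sumc cw' H tphi).
- move=> H; exact: (is_test_psi_test teta0 cE).
- move=> H; exact: (alpha_psi_test_le Hxi eps0 teta0 cE sumc cw').
- move=> H; exact: (alpha_psi_test_chebyshev Hxi eps0 teta0 cE sumc).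
- move=> H.
  have q0 : 0 < Num.sqrt (weight0 teta) by rewrite sqrtr_gt0.
  (* With [dl] the fourth root of [w0], both [dl * u] and [4 * w0 / (dl ^+ 2 * u)] vanish with [w0]
     when [u] is bounded and bounded away from 0. *)
  have d01 : 0 < Num.sqrt (Num.sqrt (weight0 teta)) <= 1.
    rewrite sqrtr_gt0 q0/= -sqrtr1 ler_sqrt//.
    by rewrite -[leRHS]sqrtr1 ler_sqrt.
  have := beta_psi_test_le Hxi eps0 u0 tetaT teta0 cE sumc cw' drift H d01.
  rewrite sqr_sqrtr ?(ltW q0)// => h; apply: le_trans h _; rewrite lerD2l.
  rewrite -{1}(sqr_sqrtr (ltW w00)) le_eqVlt; apply/orP; left; apply/eqP.
  by field; rewrite !gt_eqF.
- move=> H k k01 Hk.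
  exact: (beta_psi_test_chebyshev Hxi eps0 u0 tetaT teta0 cE sumc cw' w01 drift k01 Hk).
Qed.

(** * Consequences for the minimax errors *)

Section consequences.
Context {d : measure_display} {T : measurableType d} {R : realType}.
Context {P : probability T R} {xi : nat -> {RV P >-> R}} {eps : R} {Theta : set (nat -> R)}
  {u w0 : R} {psi : R -> (nat -> R) -> R}.
Hypothesis B : sharp_bounds xi eps Theta u w0 psi.
Local Notation beta_ := (beta xi eps Theta).
Local Notation alpha_ := (alpha xi eps).
Local Notation mbeta := (minimax_beta xi eps Theta).
Local Notation mgamma := (minimax_gamma xi eps Theta).

Let Theta0 := bounds_Theta B.
Let u0 := bounds_u B.
Let w00 : 0 < w0. Proof. by case/andP: (bounds_w0 B). Qed.

Lemma minimax_beta_le_trivial theta : 0 <= theta <= 1 -> mbeta theta <= 1 - theta.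
Proof.
move=> t01; have tt := is_test_cst t01.
apply: (le_trans (minimax_beta_le Theta0 tt _)); first by rewrite /alpha Eobs_cst.
by apply: beta_le => // eta _; rewrite Eobs_cst.
Qed.

Lemma minimax_gamma_le1 : mgamma <= 1.
Proof.
have tt : is_test (fun=> 0 : R) by apply: is_test_cst; rewrite lexx ler01.
apply: (le_trans (minimax_gamma_le xi eps Theta0 tt)).
by rewrite /gamma /alpha Eobs_cst add0r; exact: beta_le1.
Qed.

Let beta_ge_expR0 phi : is_test phi -> 1 - alpha_ phi - (u + 4 * u ^+ 2) <= beta_ phi.
Proof.
move=> tphi; have := bounds_beta_ge_expR B (lexx 0) tphi.
by rewrite oppr0 expR0 addr0 !mul1r.
Qed.

Lemma minimax_beta_ge_small theta : 0 <= theta ->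
  1 - theta - (u + 4 * u ^+ 2) <= mbeta theta.
Proof.
move=> t0; apply: minimax_beta_ge => // phi tphi aphi.
by apply: le_trans (beta_ge_expR0 tphi); rewrite lerD2r lerD2l lerN2.
Qed.

Lemma minimax_gamma_ge_small : 1 - (u + 4 * u ^+ 2) <= mgamma.
Proof.
apply: minimax_gamma_ge => phi tphi; have := beta_ge_expR0 tphi.
rewrite /gamma; lra.
Qed.

(** [M] solves [M * p = C + 4 * C ^+ 2], so the bracket in [bounds_beta_ge_expR] is at least
    [(1 + M) * p - M * p = p]. *)
Let beta_ge_bounded C p phi (M := (C + 4 * C ^+ 2) / p) : u <= C -> 0 < p ->
  is_test phi -> p <= 1 - alpha_ phi -> expR (- M) * p <= beta_ phi.
Proof.
move=> uC p0 tphi ap.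
have C0 : 0 < C by exact: lt_le_trans uC.
have M0 : 0 <= M by rewrite divr_ge0 ?addr_ge0 ?mulr_ge0 ?sqr_ge0// ltW.
apply: le_trans (bounds_beta_ge_expR B M0 tphi); rewrite ler_pM2l ?expR_gt0//.
have -> : p = (1 + M) * p - (C + 4 * C ^+ 2) by rewrite /M; field; rewrite gt_eqF.
apply: lerB; first by rewrite ler_pM2l// ltr_wpDr.
by rewrite lerD// ler_pM2l// lerXn2r// nnegrE ltW.
Qed.

Lemma minimax_beta_ge_bounded C theta : u <= C -> 0 < theta < 1 ->
  expR (- ((C + 4 * C ^+ 2) / (1 - theta))) * (1 - theta) <= mbeta theta.
Proof.
move=> uC /andP[t0 t1]; apply: minimax_beta_ge => [|phi tphi aphi]; first exact: ltW.
by apply: beta_ge_bounded; rewrite ?subr_gt0// lerD2l lerN2.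
Qed.

(** If [alpha_ phi] exceeds 1/2 it suffices alone; otherwise [beta_ge_bounded] applies with
    [p = 1/2]. *)
Lemma minimax_gamma_ge_bounded C : u <= C ->
  expR (- ((C + 4 * C ^+ 2) / 2^-1)) * 2^-1 <= mgamma.
Proof.
move=> uC; apply: minimax_gamma_ge => phi tphi; rewrite /gamma.
have /andP[a0 a1] := alpha01 xi eps tphi.
have b0 := beta_ge0 xi eps Theta0 tphi.
have C0 : 0 < C by exact: lt_le_trans uC.
have [h|h] := leP (alpha_ phi) 2^-1.
  have h2 : 2^-1 <= 1 - alpha_ phi by lra.
  have := beta_ge_bounded uC _ tphi h2; rewrite invr_gt0 ltr0n => /(_ isT).
  lra.
have : expR (- ((C + 4 * C ^+ 2) / 2^-1)) <= 1.
  by rewrite -expR0 ler_expR oppr_le0 divr_ge0 ?addr_ge0 ?mulr_ge0 ?sqr_ge0// ltW.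
lra.
Qed.

Variables (cu Cu : R).
Hypotheses (cu0 : 0 < cu) (cuC : cu <= u <= Cu).

(** The error in [bounds_beta_normal], made uniform over [cu <= u <= Cu]; it vanishes with [w0]. *)
Let err := Num.sqrt (Num.sqrt w0) * Cu + 4 * w0 + 4 * Num.sqrt w0 / cu.

Let beta_normal H : beta_ (psi H) <= Phi (H - u) + err.
Proof.
have /andP[cu_u uC] := cuC.
have h1 : Num.sqrt (Num.sqrt w0) * u <= Num.sqrt (Num.sqrt w0) * Cu.
  by rewrite ler_wpM2l// sqrtr_ge0.
have h2 : 4 * Num.sqrt w0 / u <= 4 * Num.sqrt w0 / cu.
  by rewrite ler_wpM2l ?mulr_ge0 ?sqrtr_ge0// lef_pV2.
have := bounds_beta_normal B H; rewrite /err; lra.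
Qed.

(** The slack [4 * w0] in the level lets one bound cover both the tests of level [theta] and
    [psi H], whose level may exceed [theta]. The slack costs [4 * q * w0], which turns the constant
    4 into 8; [Q] bounds [q] uniformly in [u]. *)
Lemma beta_ge_fixed_level H theta (Q := expR (Cu * `|H|)) phi : Phi H = 1 - theta ->
  is_test phi -> alpha_ phi <= theta + 4 * w0 ->
  Phi (H - u) - Q * (8 + 3 * Cu ^+ 2) * w0 <= beta_ phi.
Proof.
move=> PhiH tphi aphi; have /andP[cu_u uC] := cuC.
apply: le_trans (bounds_beta_ge_normal B H tphi).
set q := expR (u * H - _); rewrite PhiH.
have q0 : 0 < q by exact: expR_gt0.
have qQ : q <= Q.
  rewrite ler_expR; apply: (@le_trans _ _ (u * `|H|)).
    have : u * H <= u * `|H| by rewrite ler_pM2l// ler_norm.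
    have := sqr_ge0 u; lra.
  by rewrite ler_wpM2r.
have uu : u ^+ 2 <= Cu ^+ 2 by rewrite lerXn2r// nnegrE ltW// (lt_le_trans u0).
have : q * (8 + 3 * u ^+ 2) * w0 <= Q * (8 + 3 * Cu ^+ 2) * w0.
  rewrite ler_wpM2r ?(ltW w00)//; apply: ler_pM => //; first exact: ltW.
    by have := sqr_ge0 u; lra.
  by rewrite lerD2l ler_pM2l.
have : q * (1 - (1 - theta) - alpha_ phi) >= q * (- (4 * w0)) by rewrite ler_pM2l//; lra.
lra.
Qed.

Lemma beta_psi_between H theta (Q := expR (Cu * `|H|)) : Phi H = 1 - theta ->
  Phi (H - u) - Q * (8 + 3 * Cu ^+ 2) * w0 <= beta_ (psi H) <= Phi (H - u) + err.
Proof.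
move=> PhiH; rewrite beta_normal andbT.
apply: (beta_ge_fixed_level PhiH); first exact: bounds_test B H.
by apply: le_trans (bounds_alpha_normal B H) _; rewrite PhiH; lra.
Qed.

Lemma minimax_beta_between H theta (Q := expR (Cu * `|H|)) :
  Phi H = 1 - theta -> 0 < theta < 1 ->
  Phi (H - u) - Q * (8 + 3 * Cu ^+ 2) * w0 <= mbeta theta <=
  Phi (H - u) + err + 4 / theta * w0.
Proof.
move=> PhiH /andP[t0 t1]; apply/andP; split.
  apply: minimax_beta_ge => [|phi tphi aphi]; first exact: ltW.
  apply: (beta_ge_fixed_level PhiH) => //; apply: le_trans aphi _.
  by rewrite lerDl mulr_ge0// ltW.
(* Scaling the test by [x] brings its first-kind error below [theta]. *)
pose x := theta / (theta + 4 * w0).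
have tw : 0 < theta + 4 * w0 by rewrite addr_gt0// mulr_gt0.
have x01 : 0 <= x <= 1.
  by rewrite divr_ge0 ?(ltW t0) ?(ltW tw)//= ler_pdivrMr// mul1r lerDl mulr_ge0// ltW.
have tpsi := bounds_test B H.
have txpsi := is_testZ x01 tpsi.
apply: (le_trans (minimax_beta_le Theta0 txpsi _)).
  rewrite /alpha EobsZ// /x mulrAC ler_pdivrMr// ler_pM2l//.
  by apply: le_trans (bounds_alpha_normal B H) _; rewrite PhiH; lra.
apply: (le_trans (beta_scale xi eps Theta0 x01 tpsi)); apply: lerD; first exact: beta_normal.
have -> : 1 - x = 4 * w0 / (theta + 4 * w0) by rewrite /x; field; rewrite gt_eqF.
rewrite [leRHS]mulrAC ler_wpM2l ?mulr_ge0 ?(ltW w00)// lef_pV2 ?posrE// lerDl mulr_ge0// ltW//.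
Qed.

(** At the midpoint [u / 2] the two limiting errors coincide, both being [Phi (- (u / 2))]. *)
Lemma gamma_psi_le : gamma xi eps Theta (psi (u / 2)) <= 2 * Phi (- (u / 2)) + err + 4 * w0.
Proof.
have h1 := bounds_alpha_normal B (u / 2); have h2 := beta_normal (u / 2).
have e1 : u / 2 - u = - (u / 2) by field.
have e2 := PhiN (u / 2).
rewrite e1 in h2; rewrite /gamma; lra.
Qed.

(** At [H = u / 2] the critical value is 1, so [alpha_ phi] enters [bounds_beta_ge_normal] with
    coefficient one, as it does in [gamma]. *)
Lemma minimax_gamma_ge_normal : 2 * Phi (- (u / 2)) - (4 + 3 * Cu ^+ 2) * w0 <= mgamma.
Proof.
have /andP[cu_u uC] := cuC.
apply: minimax_gamma_ge => phi tphi; have := bounds_beta_ge_normal B (u / 2) tphi.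
have -> : u * (u / 2) - u ^+ 2 / 2 = 0 by field.
have -> : u / 2 - u = - (u / 2) by field.
rewrite expR0 !mul1r PhiN.
have : (4 + 3 * u ^+ 2) * w0 <= (4 + 3 * Cu ^+ 2) * w0.
  rewrite ler_wpM2r ?(ltW w00)// lerD2l ler_pM2l// lerXn2r// nnegrE ltW// (lt_le_trans u0)//.
rewrite /gamma; lra.
Qed.

Lemma minimax_gamma_le_psi H : mgamma <= gamma xi eps Theta (psi H).
Proof. exact: minimax_gamma_le Theta0 _ (bounds_test B H). Qed.

End consequences.

(** A threshold at distance of order [u] from both 0 and [u] makes each error small by Chebyshev's
    inequality, without any condition on [w0] tending to 0. *)
Lemma gamma_chebyshev {d : measure_display} {T : measurableType d} {R : realType}
    {P : probability T R} {xi : nat -> {RV P >-> R}} {eps : R} {Theta : set (nat -> R)}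
    {u w0 : R} {psi : R -> (nat -> R) -> R} (b k H : R) :
  sharp_bounds xi eps Theta u w0 psi -> 0 < b -> 0 <= k < 1 -> b * u <= H <= k * u ->
  0 <= gamma xi eps Theta (psi H) <=
    (b ^- 2 + 4 * (1 - k) ^- 2) * (u^-1) ^+ 2 + 16 * (1 - k) ^- 2 * u^-1.
Proof.
move=> B b0 k01 /andP[bH Hk]; have u0 := bounds_u B; have tpsi := bounds_test B H.
apply/andP; split.
  by rewrite addr_ge0 ?beta_ge0//; [case/andP: (alpha01 xi eps tpsi)|exact: bounds_Theta B].
have bu : 0 < b * u by rewrite mulr_gt0.
have H0 : 0 < H by exact: lt_le_trans bH.
have h1 := bounds_alpha_chebyshev B H0.
have h2 := bounds_beta_chebyshev B k01 Hk.
have h3 : 1 / H ^+ 2 <= 1 / (b * u) ^+ 2.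
  by rewrite ler_wpM2l// lef_pV2 ?posrE ?exprn_gt0// lerXn2r// nnegrE ltW.
have k1 : 0 < 1 - k by case/andP: k01 => _; rewrite subr_gt0.
have -> : (b ^- 2 + 4 * (1 - k) ^- 2) * (u^-1) ^+ 2 + 16 * (1 - k) ^- 2 * u^-1 =
   1 / (b * u) ^+ 2 + (4 / ((1 - k) ^+ 2 * u ^+ 2) + 16 / ((1 - k) ^+ 2 * u)).
  by field; rewrite !gt_eqF.
by apply: lerD; [exact: le_trans h1 h3|].
Qed.

(** * Passage to the limit *)

Lemma limf_einf_gt0 (R : realType) (f : R -> R) (b : R) : 0 < b ->
  (\forall e \near 0^'+, b <= f e) -> (0 < limf_einf (fun e => (f e)%:E) 0^'+)%E.
Proof.
move=> b0 bf; apply: (@lt_le_trans _ _ b%:E); first by rewrite lte_fin.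
rewrite limf_einfE.
apply: (@le_trans _ _ (ereal_inf [set (f e)%:E | e in [set e | b <= f e]])).
  by apply: le_ereal_inf_tmp => _ [e /= be <-]; rewrite lee_fin.
by apply: ereal_sup_ubound; exists [set e | b <= f e].
Qed.

Theorem theorem4p1 (R : realType) (d : measure_display) (T : measurableType d)
    (P : probability T R) (xi : nat -> {RV P >-> R})
    (a s : nat -> R) (r : R -> R) (teta : R -> nat -> R)
    (Hxi : iid_standard_normal xi)
    (Ha_gt0 : forall k, 0 < a k) (Ha : a @ \oo --> +oo)
    (Hs_gt0 : forall k, 0 < s k) (Hs : s @ \oo --> +oo)
    (Hr_gt0 : \forall e \near 0^'+, 0 < r e) (Hr : r @ 0^'+ --> (0 : R))
    (HTheta : \forall e \near 0^'+, Theta2r a s (r e) !=set0)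
    (Hu : \forall e \near 0^'+, 0 < extreme_value a s (r e) e)
    (Hteta : \forall e \near 0^'+, extreme_sequence a s (r e) (teta e)) :
  let Theta := fun e : R => Theta2r a s (r e) in
  let u := fun e : R => extreme_value a s (r e) e in
  let w0 := fun e : R => weight0 (teta e) in
  let psi := fun e H : R => psi_test (teta e) e H in
  let beta_ := fun theta e : R => minimax_beta xi e (Theta e) theta in
  let gamma_ := fun e : R => minimax_gamma xi e (Theta e) in
  (u @ 0^'+ --> (0 : R) ->
    (forall theta : R, 0 < theta < 1 -> beta_ theta @ 0^'+ --> 1 - theta) /\
    gamma_ @ 0^'+ --> (1 : R)) /\
  ((exists C : R, \forall e \near 0^'+, u e <= C) ->
    (forall theta : R, 0 < theta < 1 ->
      (0 < limf_einf (fun e => (beta_ theta e)%:E) 0^'+)%E) /\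
    (0 < limf_einf (fun e => (gamma_ e)%:E) 0^'+)%E) /\
  ((exists c C : R, 0 < c /\ \forall e \near 0^'+, c <= u e <= C) ->
   w0 @ 0^'+ --> (0 : R) ->
    (forall theta Htheta : R, 0 < theta < 1 -> Phi Htheta = 1 - theta ->
      (exists2 o : R -> R, o @ 0^'+ --> (0 : R) &
         \forall e \near 0^'+, alpha xi e (psi e Htheta) <= theta + o e) /\
      beta xi e (Theta e) (psi e Htheta) - beta_ theta e @[e --> 0^'+]
        --> (0 : R) /\
      beta_ theta e - Phi (Htheta - u e) @[e --> 0^'+] --> (0 : R)) /\
    gamma xi e (Theta e) (psi e (u e / 2)) - gamma_ e @[e --> 0^'+]
      --> (0 : R) /\
    gamma_ e - 2 * Phi (- (u e / 2)) @[e --> 0^'+] --> (0 : R)) /\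
  (u @ 0^'+ --> +oo ->
    forall (c : R) (H : R -> R), 0 < c < 1 ->
      H e / (c * u e) @[e --> 0^'+] --> (1 : R) ->
      gamma xi e (Theta e) (psi e (H e)) @[e --> 0^'+] --> (0 : R)).

Proof.
move=> Theta u w0 psi beta_ gamma_.
have B : \forall e \near 0^'+, sharp_bounds xi e (Theta e) (u e) (w0 e) (psi e).
  near=> e; apply: extreme_sharp_bounds => //; near: e => //.
split; [|split; [|split]].
- move=> u_0.
  have ev : u e + 4 * u e ^+ 2 @[e --> 0^'+] --> (0 : R).
    rewrite [X in _ --> X](_ : 0 = 0 + 4 * 0 ^+ 2); last by rewrite expr0n mulr0 addr0.
    by apply: cvgD => //; apply: cvgMl_tmp; exact: (cvgM u_0 u_0).
  split=> [theta /andP[t0 t1]|].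
    apply: (@squeeze_cvgr _ _ _ _ (fun e => 1 - theta - (u e + 4 * u e ^+ 2)) (fun=> 1 - theta)).
    + apply: filterS B => e Be; apply/andP; split.
        by apply: (minimax_beta_ge_small Be); exact: ltW.
      by apply: (minimax_beta_le_trivial Be); rewrite !ltW.
    + by rewrite -[X in _ --> X]subr0; apply: cvgB => //; exact: cvg_cst.
    + exact: cvg_cst.
  apply: (@squeeze_cvgr _ _ _ _ (fun e => 1 - (u e + 4 * u e ^+ 2)) (fun=> 1)).
  + apply: filterS B => e Be.
    by rewrite (minimax_gamma_ge_small Be) (minimax_gamma_le1 Be).
  + by rewrite -[X in _ --> X]subr0; apply: cvgB => //; exact: cvg_cst.
  + exact: cvg_cst.
- move=> [C uC]; split=> [theta /andP[t0 t1]|].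
    apply: (@limf_einf_gt0 _ _ (expR (- ((C + 4 * C ^+ 2) / (1 - theta))) * (1 - theta))).
      by rewrite mulr_gt0 ?expR_gt0 ?subr_gt0.
    apply: filterS2 B uC => e Be ueC.
    by apply: (minimax_beta_ge_bounded Be) => //; rewrite t0.
  apply: (@limf_einf_gt0 _ _ (expR (- ((C + 4 * C ^+ 2) / 2^-1)) * 2^-1)).
    by rewrite mulr_gt0 ?expR_gt0.
  by apply: filterS2 B uC => e Be ueC; exact: (minimax_gamma_ge_bounded Be).
- move=> [c [C [c0 ucC]]] w0_0.
  have lin_w0 b : b * w0 e @[e --> 0^'+] --> (0 : R).
    by rewrite -[X in _ --> X](mulr0 b); exact: cvgMl_tmp.
  have sqrt_w0 : Num.sqrt (w0 e) @[e --> 0^'+] --> (0 : R).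
    by rewrite -[X in _ --> X](sqrtr0 R); apply: continuous_cvg => //; exact: sqrt_continuous.
  have sqrt2_w0 : Num.sqrt (Num.sqrt (w0 e)) @[e --> 0^'+] --> (0 : R).
    by rewrite -[X in _ --> X](sqrtr0 R); apply: continuous_cvg => //; exact: sqrt_continuous.
  pose err e := Num.sqrt (Num.sqrt (w0 e)) * C + 4 * w0 e + 4 * Num.sqrt (w0 e) / c.
  have err0 : err e @[e --> 0^'+] --> (0 : R).
    rewrite [X in _ --> X](_ : 0 = 0 * C + 4 * 0 + 4 * 0 / c); last by rewrite !(mul0r, mulr0) !addr0.
    apply: cvgD; [apply: cvgD|].
    + exact: cvgMr_tmp.
    + exact: cvgMl_tmp.
    + by apply: cvgMr_tmp; exact: cvgMl_tmp.
  split=> [theta H t01 PhiH|].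
    pose Q := expR (C * `|H|) * (8 + 3 * C ^+ 2).
    have low : - (Q * w0 e) @[e --> 0^'+] --> (0 : R).
      by rewrite -[X in _ --> X]oppr0; exact: cvgN.
    have up : err e + 4 / theta * w0 e @[e --> 0^'+] --> (0 : R).
      by rewrite -[X in _ --> X]addr0; exact: cvgD.
    split; [|split].
    + exists (fun e => 4 * w0 e); first exact: lin_w0.
      apply: filterS B => e Be.
      by apply: le_trans (bounds_alpha_normal Be H) _; rewrite PhiH; lra.
    (* The level of the test may exceed [theta] slightly, so the difference has no definite sign;
       both terms are compared with [Phi (H - u e)]. *)
    + apply: (@squeeze_cvgr _ _ _ _ (fun e => - (Q * w0 e) - (err e + 4 / theta * w0 e))
          (fun e => err e - - (Q * w0 e))).
      * apply: filterS2 B ucC => e Be uc.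
        have /andP[h1 h2] := minimax_beta_between Be c0 uc PhiH t01.
        have /andP[h3 h4] := beta_psi_between Be c0 uc PhiH.
        by move: h1 h2 h3 h4; rewrite -/(err e) -/Q /beta_; lra.
      * by rewrite -[X in _ --> X]subr0; exact: cvgB.
      * by rewrite -[X in _ --> X]subr0; exact: cvgB.
    + apply: (@squeeze_cvgr _ _ _ _ (fun e => - (Q * w0 e)) (fun e => err e + 4 / theta * w0 e)) => //.
      apply: filterS2 B ucC => e Be uc.
      have := minimax_beta_between Be c0 uc PhiH t01; rewrite -/(err e) -/Q /beta_; lra.
  have gup : err e + 4 * w0 e @[e --> 0^'+] --> (0 : R).
    by rewrite -[X in _ --> X]addr0; exact: cvgD.
  have glow : - ((4 + 3 * C ^+ 2) * w0 e) @[e --> 0^'+] --> (0 : R).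
    by rewrite -[X in _ --> X]oppr0; exact: cvgN.
  split.
    (* The total error carries no level constraint, so the difference is nonnegative. *)
    apply: (@squeeze_cvgr _ _ _ _ (fun=> 0)
      (fun e => err e + 4 * w0 e - - ((4 + 3 * C ^+ 2) * w0 e))).
    + apply: filterS2 B ucC => e Be uc.
      have := minimax_gamma_le_psi Be (u e / 2); have := gamma_psi_le Be c0 uc.
      have := minimax_gamma_ge_normal Be uc; rewrite -/(err e) /gamma_; lra.
    + exact: cvg_cst.
    + by rewrite -[X in _ --> X]subr0; exact: cvgB.
  apply: (@squeeze_cvgr _ _ _ _ (fun e => - ((4 + 3 * C ^+ 2) * w0 e))
    (fun e => err e + 4 * w0 e)) => //.
  apply: filterS2 B ucC => e Be uc.
  have := minimax_gamma_le_psi Be (u e / 2); have := gamma_psi_le Be c0 uc.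
  have := minimax_gamma_ge_normal Be uc; rewrite -/(err e) /gamma_; lra.
- move=> u_oo c H /andP[c0 c1] Hcu.
  (* [k] lies strictly between [c] and 1 and [b] strictly below [c], so [b * u e <= H e <= k * u e]
     holds eventually. *)
  pose k := (1 + c) / 2; pose b := c / 2.
  have uV : (u e)^-1 @[e --> 0^'+] --> (0 : R).
    apply/gtr0_cvgV0 => //; by apply: filterS B => e; exact: bounds_u.
  apply: (@squeeze_cvgr _ _ _ _ (fun=> 0) (fun e =>
    (b ^- 2 + 4 * (1 - k) ^- 2) * ((u e)^-1) ^+ 2 + 16 * (1 - k) ^- 2 * (u e)^-1)).
  + near=> e; have Be : sharp_bounds xi e (Theta e) (u e) (w0 e) (psi e) by near: e.
    have u0 := bounds_u Be; have cu0 : 0 < c * u e by rewrite mulr_gt0.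
    apply: (gamma_chebyshev Be).
    * by rewrite divr_gt0.
    * by rewrite /k; apply/andP; split; lra.
    * have h1 : 2^-1 <= H e / (c * u e).
        near: e; apply: (cvgr_ge 1) => //; lra.
      have h2 : H e / (c * u e) <= k / c.
        near: e; apply: (cvgr_le 1) => //; rewrite ltr_pdivlMr// /k; lra.
      rewrite ler_pdivlMr// in h1; rewrite ler_pdivrMr// in h2.
      have e2 : k / c * (c * u e) = k * u e by field; rewrite gt_eqF.
      rewrite e2 in h2; rewrite h2 andbT; apply: le_trans h1; rewrite /b; lra.
  + exact: cvg_cst.
  + set K := _ + _; set L := 16 * _.
    rewrite [X in _ --> X](_ : 0 = K * 0 ^+ 2 + L * 0); last by rewrite expr0n !mulr0 addr0.
    by apply: cvgD; apply: cvgMl_tmp => //; exact: (cvgM uV uV).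
Unshelve. all: by end_near. Qed.
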